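(* Let $\alpha\in(0,2)$, $d\ge1$, $m\ge0$ and $\lambda>0$, and assume that $d<2\alpha$. Let $V:\mathbb{R}^d\to\mathbb{R}$ be measurable. Then the following hold: (1) If $V\in\overline{\mathcal{R}}_{d,\alpha}$, then $K^m_\lambda$ is a Hilbert-Schmidt operator and there exists a constant $C_{d,\alpha,\lambda,m}$, independent of $V$, such that $\|K^m_\lambda\|_{\rm HS}\le C_{d,\alpha,\lambda,m}[V]_{\overline{\mathcal{R}}_{d,\alpha}}$. (2) If $K^m_\lambda$ is a Hilbert-Schmidt operator, then $V\in\overline{\mathcal{R}}^m_{d,\alpha}$ and there exists a constant $C_{d,\alpha,\lambda,m}$, independent of $V$, such that $[V]_{\overline{\mathcal{R}}^m_{d,\alpha}}\le C_{d,\alpha,\lambda,m}\|K^m_\lambda\|_{\rm HS}$. (3) If $\lambda>m$, then $K^m_\lambda$ is a Hilbert-Schmidt operator if and only if $V\in\overline{\mathcal{R}}^m_{d,\alpha}$, and there exists a constant $C_{d,\alpha,\lambda,m}>1$, independent of $V$, such that $$\frac{1}{C_{d,\alpha,\lambda,m}}[V]_{\overline{\mathcal{R}}^m_{d,\alpha}}\le\|K^m_\lambda\|_{\rm HS}\le C_{d,\alpha,\lambda,m}[V]_{\overline{\mathcal{R}}^m_{d,\alpha}}.$$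
   Context: For $\alpha\in(0,2)$, $m\ge0$, $L_{m,\alpha}=(-\Delta+m^{2/\alpha})^{\alpha/2}-m$ on $L^2(\mathbb{R}^d)$ is the non-negative self-adjoint operator with Fourier multiplier $(|y|^2+m^{2/\alpha})^{\alpha/2}-m$ (for $m=0$: $|y|^\alpha$). $e^{-tL_{m,\alpha}}$ has integral kernel $p^m_t(x-y)$, and $R^m_\lambda(x)=\int_0^\infty e^{-\lambda t}p^m_t(x)\,dt$, so $(\lambda+L_{m,\alpha})^{-1}$ has integral kernel $R^m_\lambda(x-y)$. $K^m_\lambda=|V|^{1/2}(\lambda+L_{m,\alpha})^{-1}|V|^{1/2}$ is the integral operator on $L^2(\mathbb{R}^d)$ with kernel $\sqrt{|V(x)|}\,R^m_\lambda(x-y)\sqrt{|V(y)|}$; it is Hilbert-Schmidt iff this kernel is square-integrable on $\mathbb{R}^{2d}$, and $\|K^m_\lambda\|_{\rm HS}$ is the $L^2(\mathbb{R}^{2d})$-norm of the kernel. For $d<2\alpha$ and $m\ge0$, the extended fractional Rollnik-class $\overline{\mathcal{R}}^m_{d,\alpha}$ is the set of measurable $V:\mathbb{R}^d\to\mathbb{R}$ with $$[V]^2_{\overline{\mathcal{R}}^m_{d,\alpha}}=\int_{\mathbb{R}^d}\int_{\mathbb{R}^d}H^m_{d,\alpha}(|x-y|)^2|V(x)||V(y)|\,dx\,dy<\infty ,$$ and the superscript is omitted if $m=0$. Here, for $r>0$, put $h(r)=r^{-(d-\alpha)}$ if $\alpha<d$, $h(r)=\log(1+\frac1r)$ if $\alpha=d=1$,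 $h(r)=1$ if $\alpha>d=1$. Then $$H^0_{d,\alpha}(r)=h(r)\mathbf{1}_{\{r\le1\}}+2^{\frac{d+\alpha}{2}-1}\Gamma\big(\tfrac{d+\alpha}{2}\big)r^{-(d+\alpha)}\mathbf{1}_{\{r>1\}},$$ $$H^m_{d,\alpha}(r)=h(r)\mathbf{1}_{\{r\le1\}}+r^{-\frac{d+\alpha}{2}}\kappa_m(r)\mathbf{1}_{\{r>1\}}\quad(m>0),$$ where $\kappa_m(r)=m^{(d+\alpha)/(2\alpha)}K_{(d+\alpha)/2}(m^{1/\alpha}r)$ and $K_\rho(z)=\frac12(\frac z2)^\rho\int_0^\infty t^{-\rho-1}e^{-t-\frac{z^2}{4t}}dt$ is the modified Bessel function of the second kind. *)

(* Defs.v *)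
From HB Require Import structures.
From mathcomp Require Import all_boot all_order all_algebra.
From mathcomp Require Import all_classical all_reals all_analysis.
From mathcomp Require Import measurable_realfun.
Set Implicit Arguments.
Unset Strict Implicit.
Unset Printing Implicit Defensive.
Import Order.TTheory GRing.Theory Num.Theory.
Import numFieldNormedType.Exports.
Local Open Scope classical_set_scope.
Local Open Scope ring_scope.

(* R^d, with the product (= Borel) sigma-algebra; [lebesgueE] below is Lebesgue
   measure on it, the d-fold product of the one-dimensional one (see
   [lebesgueE_box]). *)
Notation euclid R d := (d.-tuple (measurableTypeR R)).

Section lebesgue_measure_euclid.
Context {R : realType}.
Local Open Scope ereal_scope.

Definition cons_euclid n (p : measurableTypeR R * euclid R n) :
  euclid R n.+1 := [the n.+1.-tuple _ of p.1 :: p.2].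

Lemma measurable_cons_euclid n :
  measurable_fun [set: measurableTypeR R * euclid R n] (@cons_euclid n).
Proof.
by apply: measurable_cons; [exact: measurable_fst|exact: measurable_snd].
Qed.

Section step.
Context (n : nat) (mu : {sigma_finite_measure set (euclid R n) -> \bar R}).

Definition cons_measure : set (euclid R n.+1) -> \bar R :=
  pushforward (@lebesgue_measure R \x mu) (@cons_euclid n).

Let mcons (A : set (euclid R n.+1)) :
  measurable A -> measurable (@cons_euclid n @^-1` A).
Proof.
by move=> mA; rewrite -[X in measurable X]setTI; exact: measurable_cons_euclid.
Qed.

Let cons_measure0 : cons_measure set0 = 0.
Proof. by rewrite /cons_measure /pushforward preimage_set0 measure0. Qed.

Let cons_measure_ge0 A : 0 <= cons_measure A.
Proof. by rewrite /cons_measure /pushforward; exact: measure_ge0. Qed.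

Let cons_measure_sigma_additive : semi_sigma_additive cons_measure.
Proof.
move=> F mF tF mUF; rewrite /cons_measure /pushforward preimage_bigcup.
apply: measure_semi_sigma_additive.
- by move=> i; exact: mcons.
- apply/trivIsetP => /= i j _ _ ij; rewrite -preimage_setI.
  by move/trivIsetP : tF => /(_ _ _ _ _ ij) ->//; rewrite preimage_set0.
- by rewrite -preimage_bigcup; exact: mcons.
Qed.

HB.instance Definition _ := isMeasure.Build _ _ _ cons_measure
  cons_measure0 cons_measure_ge0 cons_measure_sigma_additive.

Let cons_measure_sigma_finite : sigma_finite setT cons_measure.
Proof.
have /sigma_finiteP[F [TF ndF Foo]] := sigma_finiteT (@lebesgue_measure R).
have /sigma_finiteP[G [TG ndG Goo]] := sigma_finiteT mu.
pose uncons (x : euclid R n.+1) : measurableTypeR R * euclid R n :=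
  (thead x, [tuple of behead x]).
have muncons : measurable_fun setT uncons.
  apply/measurable_fun_pair; first exact: measurable_tnth.
  exact: measurable_behead.
have unconsK p : uncons (cons_euclid p) = p.
  by case: p => a x; rewrite /uncons/=; congr pair; exact/val_inj.
exists (fun i => uncons @^-1` (F i `*` G i)) => [|i].
  rewrite -preimage_bigcup (_ : \bigcup_i _ = setT) ?preimage_setT//.
  apply/seteqP; split => // -[x y] _.
  have : setT x by []. have : setT y by [].
  rewrite {1}TG {1}TF => -[j _ Gjy] [i _ Fix].
  exists (maxn i j) => //; split.
  - by move: x Fix; exact/subsetPset/ndF/leq_maxl.
  - by move: y Gjy; exact/subsetPset/ndG/leq_maxr.
have [[mF Foo'] [mG Goo']] := (Foo i, Goo i).
split.
  rewrite -[X in measurable X]setTI; apply: muncons => //.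
  exact: measurableX.
rewrite /cons_measure /pushforward.
rewrite (_ : _ @^-1` _ = F i `*` G i).
  by rewrite product_measure1E// lte_mul_pinfty// ge0_fin_numE.
rewrite -comp_preimage (_ : _ \o _ = id) ?preimage_id//.
exact/funext/unconsK.
Qed.

HB.instance Definition _ := Measure_isSigmaFinite.Build _ _ _ cons_measure
  cons_measure_sigma_finite.

End step.

Fixpoint lebesgueE n : {sigma_finite_measure set (euclid R n) -> \bar R} :=
  match n with
  | 0%N => dirac ([tuple] : euclid R 0)
  | n'.+1 => cons_measure (lebesgueE n')
  end.

Lemma lebesgueE_box n (A : 'I_n -> set (measurableTypeR R)) :
  (forall i, measurable (A i)) ->
  lebesgueE n [set x | forall i, A i (tnth x i)] =
  \prod_(i < n) lebesgue_measure (A i).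
Proof.
elim: n A => [|n IH] A mA.
  by rewrite big_ord0 /= diracE mem_set// => -[].
rewrite big_ord_recl /= /cons_measure /pushforward.
rewrite (_ : _ @^-1` _ =
    A ord0 `*` [set x | forall i, A (lift ord0 i) (tnth x i)]).
  rewrite product_measure1E//; first by congr (_ * _); exact: IH.
  rewrite (_ : mkset _ = \bigcap_(i in [set: 'I_n])
      ((@tnth n (measurableTypeR R) ^~ i) @^-1` A (lift ord0 i))).
    apply: fin_bigcap_measurable => // i _.
    by rewrite -[X in measurable X]setTI; exact: measurable_tnth.
  by apply/seteqP; split => [x Ax i _|x Ax i]; [exact: Ax|exact: Ax].
apply/seteqP; split => [[a x]/= Ax|[a x]/= [Aa Ax] i].
  split; first by have := Ax ord0; rewrite tnth0.
  by move=> i; have := Ax (lift ord0 i); rewrite tnthS.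
by case: (unliftP ord0 i) => [j|] ->; [rewrite tnthS|rewrite tnth0].
Qed.

End lebesgue_measure_euclid.

Section definitions.
Context {R : realType}.

Definition dotE d (x y : euclid R d) : R := \sum_(i < d) tnth x i * tnth y i.

Definition normE d (x : euclid R d) : R := Num.sqrt (dotE x x).

Definition subE d (x y : euclid R d) : euclid R d :=
  [tuple (tnth x i - tnth y i : measurableTypeR R) | i < d].

(* The Fourier multiplier of L_{m,alpha}; for m = 0 it is |y|^alpha, since
   [0 `^ (2 / alpha) = 0]. *)
Definition symbolL d (alpha m : R) (y : euclid R d) : R :=
  (normE y ^+ 2 + m `^ (2 / alpha)) `^ (alpha / 2) - m.

(* The convolution kernel of exp(- t L_{m,alpha}): the inverse Fourier transform
   of exp(- t symbolL). The multiplier is even, so only the cosine part of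
   exp(i x.y) contributes. *)
Definition heat_kernel d (alpha m t : R) (x : euclid R d) : R :=
  (2 * pi) ^- d *
  \int[lebesgueE d]_y (cos (dotE x y) * expR (- t * symbolL alpha m y)).

(* Extended-real valued: it may be +oo at x = 0. *)
Definition resolvent_kernel d (alpha m lambda : R) (x : euclid R d) : \bar R :=
  (\int[lebesgue_measure]_(t in `]0%R, +oo[)
     (expR (- lambda * t) * heat_kernel alpha m t x)%:E)%E.

(* The integral kernel of the Birman-Schwinger operator
   K^m_lambda = |V|^{1/2} (lambda + L_{m,alpha})^{-1} |V|^{1/2}. *)
Definition BS_kernel d (alpha m lambda : R) (V : euclid R d -> R)
    (z : euclid R d * euclid R d) : \bar R :=
  ((Num.sqrt `|V z.1|)%:E * resolvent_kernel alpha m lambda (subE z.1 z.2) *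
   (Num.sqrt `|V z.2|)%:E)%E.

(* An integral operator on L^2(R^d) with kernel k is Hilbert-Schmidt iff k is
   square-integrable on R^d x R^d, and its Hilbert-Schmidt norm is then the
   L^2-norm of k. *)
Definition HS_norm d (k : euclid R d * euclid R d -> \bar R) : \bar R :=
  ('N[(lebesgueE d \x lebesgueE d)%E]_(2%:E)[k])%E.

Definition is_HS d (k : euclid R d * euclid R d -> \bar R) : Prop :=
  measurable_fun setT k /\ (HS_norm k < +oo)%E.

Definition Gamma (s : R) : R :=
  \int[lebesgue_measure]_(t in `]0%R, +oo[) (t `^ (s - 1) * expR (- t)).

(* The modified Bessel function of the second kind K_rho(z), z > 0. *)
Definition besselK (rho z : R) : R :=
  2^-1 * (z / 2) `^ rho *
  \int[lebesgue_measure]_(t in `]0%R, +oo[)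
    (t `^ (- rho - 1) * expR (- t - z ^+ 2 / (4 * t))).

(* For d >= 1 and alpha < 2, the cases alpha = d and alpha > d force d = 1. *)
Definition rollnik_h (d : nat) (alpha r : R) : R :=
  if alpha < d%:R then r `^ (- (d%:R - alpha))
  else if alpha == d%:R then ln (1 + r^-1)
  else 1.

Definition rollnik_kappa (d : nat) (alpha m r : R) : R :=
  m `^ ((d%:R + alpha) / (2 * alpha)) *
  besselK ((d%:R + alpha) / 2) (m `^ alpha^-1 * r).

(* Only meant for r > 0; the value at r = 0 is irrelevant below, the diagonal
   of R^d x R^d being a null set. *)
Definition rollnik_H (d : nat) (alpha m r : R) : R :=
  if r <= 1 then rollnik_h d alpha r
  else if m == 0 then
    2 `^ ((d%:R + alpha) / 2 - 1) * Gamma ((d%:R + alpha) / 2) *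
    r `^ (- (d%:R + alpha))
  else r `^ (- ((d%:R + alpha) / 2)) * rollnik_kappa d alpha m r.

(* The quantity [V], not its square; it may be +oo. *)
Definition rollnik_norm d (alpha m : R) (V : euclid R d -> R) : \bar R :=
  sqrte (\int[lebesgueE d]_x \int[lebesgueE d]_y
    (rollnik_H d alpha m (normE (subE x y)) ^+ 2 * `|V x| * `|V y|)%:E)%E.

Definition rollnik_class d (alpha m : R) (V : euclid R d -> R) : Prop :=
  measurable_fun setT V /\ (rollnik_norm alpha m V < +oo)%E.

End definitions.

(* Main.v *)
Require Import Defs.
From mathcomp Require Import all_boot all_order all_algebra.
From mathcomp Require Import all_classical all_reals all_analysis.
From mathcomp Require Import measurable_realfun.
From mathcomp Require Import ring lra.
Set Implicit Arguments.
Unset Strict Implicit.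
Unset Printing Implicit Defensive.
Import Order.TTheory GRing.Theory Num.Theory.
Import numFieldNormedType.Exports.
Local Open Scope classical_set_scope.
Local Open Scope ring_scope.

(** Write b = alpha/2, M = m^(1/b) and s = |y|^2. The multiplier of the resolvent is then 1/(lambda
    + (s+M)^b - m). The proof rests on subordination: as a function of s this multiplier is the
    Laplace transform of a nonnegative density g on the half-line ([resolvent_density]). Since the
    Fourier transform of e^(-u|y|^2) is Gaussian, the resolvent kernel R(x) is a constant times the
    integral of g(u) u^(-d/2) e^(-|x|^2/(4u)) du ([resolvent_kernelE]). So R is nonnegative and its
    size is read off that of g.

    With kappa(u) = u^(b-1) for u <= 1 and u^(-b-1) for u > 1, one has c e^(-Mu) kappa(u) <= g(u) <=
    C kappa(u), and the upper bound keeps the factor e^(-Mu) when lambda > m. Integrated against the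
    Gaussian, e^(-Mu) kappa(u) gives a function comparable with H^m, and kappa(u) one comparable
    with H^0 ([potential_rollnik_H]): small u produces h near the origin, while the tail is a Bessel
    integral. Hence H^m <= C R, R <= C H^0, and R <= C H^m if lambda > m
    ([resolvent_kernel_bounds]). Squaring and integrating against |V(x)||V(y)| turns these pointwise
    bounds into the three statements ([resolvent_rollnik]).

    Two points cost work. The first is the existence of g. If lambda > m, then 1/(n + s^b) with n =
    lambda - m is the Stieltjes transform of an explicit positive density ([stieltjes_transform]),
    found by rotating a half-line through the upper half-plane; the Laplace transform of that
    density gives g. If lambda <= m, a geometric series in (s+M)^(-b) is inverted term by term,
    which makes g equal to e^(-Mu) times a series of Mittag-Leffler type.

    The second is the interchange of integrals: the heat kernel is an oscillating integral, and the
    resolvent multiplier need not be absolutely integrable in y. A factor e^(-e|y|^2) makes Fubini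
    applicable ([resolvent_regularized]) and is then removed by dominated convergence
    ([resolvent_radial]). The domination is where d < 2 alpha enters: it forces d <= 3, and
    half-period estimates bound the Fourier transform of e^(-t symbol) by C(1 + t^(-p)) with p < 1
    at points without zero coordinate ([radial_hphi_bound]). The excluded points form a null set. *)

Section integration_on_sets.
Context {d1 d2} {T1 : measurableType d1} {T2 : measurableType d2} {R : realType}.
Local Open Scope ereal_scope.

(** * Integrability, Tonelli and Fubini for real functions on subsets *)

Lemma le_integrable_EFin d (T : measurableType d) (mu : {measure set T -> \bar R})
    (D : set T) (f g : T -> R) : measurable D -> measurable_fun D f ->
  (forall x, D x -> `|f x|%R <= g x)%R -> mu.-integrable D (EFin \o g) ->
  mu.-integrable D (EFin \o f).
Proof.
move=> mD mf fg; apply: le_integrable => //; first exact/measurable_EFinP.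
move=> x Dx /=; rewrite lee_fin (le_trans (fg x Dx))//.
exact: ler_norm.
Qed.

Lemma ge0_integrable_EFin d (T : measurableType d) (mu : {measure set T -> \bar R})
    (D : set T) (f : T -> R) : measurable D -> measurable_fun D f ->
  (forall x, D x -> 0 <= f x)%R -> \int[mu]_(x in D) (f x)%:E < +oo ->
  mu.-integrable D (EFin \o f).
Proof.
move=> mD mf f0 foo; apply/integrableP; split; first exact/measurable_EFinP.
rewrite (le_lt_trans _ foo)//; apply: ge0_le_integral => //=.
- by do 2 apply: measurableT_comp => //.
- exact/measurable_EFinP.
- by move=> x Dx; rewrite /= lee_fin ger0_norm// f0.
Qed.

Lemma integrableZl_EFin d (T : measurableType d) (mu : {measure set T -> \bar R})
    (D : set T) (k : R) (f : T -> R) : measurable D ->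
  mu.-integrable D (EFin \o f) ->
  mu.-integrable D (EFin \o (fun x => k * f x)%R).
Proof.
move=> mD intf; apply: (eq_integrable _ (fun x => k%:E * (EFin \o f) x)) => //.
exact: integrableZl.
Qed.

Lemma integrableD_EFin d (T : measurableType d) (mu : {measure set T -> \bar R})
    (D : set T) (f g : T -> R) : measurable D ->
  mu.-integrable D (EFin \o f) -> mu.-integrable D (EFin \o g) ->
  mu.-integrable D (EFin \o (fun x => f x + g x)%R).
Proof.
move=> mD intf intg.
apply: (eq_integrable _ ((EFin \o f) \+ (EFin \o g))) => //.
exact: integrableD.
Qed.

Lemma ge0_le_integral_EFin d (T : measurableType d) (mu : {measure set T -> \bar R})
    (D : set T) (f g : T -> R) : measurable D ->
  measurable_fun setT f -> measurable_fun setT g ->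
  (forall x, D x -> 0 <= f x)%R -> (forall x, D x -> f x <= g x)%R ->
  \int[mu]_(x in D) (f x)%:E <= \int[mu]_(x in D) (g x)%:E.
Proof.
move=> mD mf mg f0 fg; apply: ge0_le_integral => //.
- exact/measurable_EFinP/measurable_funTS.
- exact/measurable_EFinP/measurable_funTS.
Qed.

Lemma indic_setXE (D1 : set T1) (D2 : set T2) (x : T1) (y : T2) :
  (\1_(D1 `*` D2) (x, y) = \1_D1 x * \1_D2 y :> R)%R.
Proof.
rewrite !indicE in_setX.
by case: (x \in D1); case: (y \in D2); rewrite /= ?(mulr1, mulr0).
Qed.

Section tonelli.
Variables (m1 : {sigma_finite_measure set T1 -> \bar R}).
Variables (m2 : {sigma_finite_measure set T2 -> \bar R}).
Variables (D1 : set T1) (D2 : set T2).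
Hypotheses (mD1 : measurable D1) (mD2 : measurable D2).

Lemma patch_mul_indic d (T : measurableType d) (D : set T) (f : T -> R) :
  (EFin \o f) \_ D = (fun x => (f x * \1_D x)%:E) :> (T -> \bar R).
Proof.
apply/funext => x; rewrite patchE indicE; case: ifPn => _; by rewrite ?mulr1 ?mulr0.
Qed.

(** Multiplying by the indicator of [D1] times [D2] turns integrals over subsets into integrals over
    the whole spaces, where Tonelli and Fubini apply. *)
Lemma integral_indic2 (f : T1 * T2 -> R) :
  \int[m1]_(x in D1) \int[m2]_(y in D2) (f (x, y))%:E =
  \int[m1]_x \int[m2]_y (f (x, y) * \1_(D1 `*` D2) (x, y))%:E.
Proof.
rewrite integral_mkcond; apply: eq_integral => x _; rewrite patchE.
case: ifPn => xD.
  rewrite integral_mkcond; apply: eq_integral => y _.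
  rewrite patchE indic_setXE indicE xD mul1r indicE.
  by case: ifPn; rewrite ?mulr1 ?mulr0.
rewrite integral0_eq// => y _.
by rewrite indic_setXE indicE (negbTE xD) mul0r mulr0.
Qed.

Lemma integral_indic2' (f : T1 * T2 -> R) :
  \int[m2]_(y in D2) \int[m1]_(x in D1) (f (x, y))%:E =
  \int[m2]_y \int[m1]_x (f (x, y) * \1_(D1 `*` D2) (x, y))%:E.
Proof.
rewrite integral_mkcond; apply: eq_integral => x _; rewrite patchE.
case: ifPn => xD.
  rewrite integral_mkcond; apply: eq_integral => y _.
  rewrite patchE indic_setXE mulrC indicE indicE xD mulr1.
  by case: ifPn; rewrite ?mul1r ?mul0r.
rewrite integral0_eq// => y _.
by rewrite indic_setXE mulrC mulrAC indicE indicE (negbTE xD) mulr0.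
Qed.

Lemma tonelli_on (f : T1 * T2 -> R) : measurable_fun setT f ->
  (forall z, 0 <= f z)%R ->
  \int[m1]_(x in D1) \int[m2]_(y in D2) (f (x, y))%:E =
  \int[m2]_(y in D2) \int[m1]_(x in D1) (f (x, y))%:E.
Proof.
move=> mf f0; rewrite integral_indic2 integral_indic2'.
apply: (@fubini_tonelli _ _ _ _ _ m1 m2
  (fun z => (f z * \1_(D1 `*` D2) z)%:E)) => /=.
  apply/measurable_EFinP/measurable_funM => //.
  by apply: measurable_indic; exact: measurableX.
by move=> z; rewrite lee_fin mulr_ge0.
Qed.

Lemma fubini_on (f : T1 * T2 -> R) : measurable_fun setT f ->
  \int[m1]_(x in D1) \int[m2]_(y in D2) (`|f (x, y)|)%:E < +oo ->
  \int[m1]_(x in D1) \int[m2]_(y in D2) (f (x, y))%:E =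
  \int[m2]_(y in D2) \int[m1]_(x in D1) (f (x, y))%:E.
Proof.
move=> mf foo; rewrite integral_indic2 integral_indic2'.
apply: (@Fubini _ _ _ _ _ m1 m2
  (fun z => (f z * \1_(D1 `*` D2) z)%:E)) => /=.
have mfi : measurable_fun setT
    (fun z => (f z * \1_(D1 `*` D2) z)%:E : \bar R).
  apply/measurable_EFinP/measurable_funM => //.
  by apply: measurable_indic; exact: measurableX.
apply/integrable12ltyP => //=.
apply: le_lt_trans foo.
rewrite (integral_indic2 (fun z => `|f z|%R)).
rewrite le_eqVlt; apply/orP; left; apply/eqP; apply: eq_integral => x _.
apply: eq_integral => y _; rewrite normrM [X in (_ * X)%R]ger0_norm//.
Qed.

End tonelli.
End integration_on_sets.

(** * Dilations of the half-line *)

Section scaling.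
Context {R : realType}.
Notation mu := (@lebesgue_measure R).
Local Open Scope ereal_scope.

Let scl (c : R) : R -> measurableTypeR R := fun x => (c * x)%R.

Let measurable_scl (c : R) : measurable_fun setT (scl c).
Proof. by apply: measurable_funM. Qed.

Let dilated (c : R) : {measure set (measurableTypeR R) -> \bar R}.
Proof.
refine [the {measure set (measurableTypeR R) -> \bar R} of pushforward mu (scl c)].
exact: measurable_scl.
Defined.

(** Both measures agree on half-open intervals, and Lebesgue measure is determined by its values
    there. *)
Lemma lebesgue_measure_scale (c : {posnum R}) (A : set R) : measurable A ->
  mscale (c%:num%:nng)%R (dilated c%:num) A = mu A.
Proof.
move=> mA; apply/esym/lebesgue_measure_unique => //= _ [[a b]] _ <-.
have c0 : (0 < c%:num)%R by [].
rewrite /mscale/= /pushforward.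
rewrite (_ : scl _ @^-1` _ = `](a / c%:num)%R, (b / c%:num)%R]%classic).
  rewrite !lebesgue_measure_itv/= !lte_fin ltr_pM2r ?invr_gt0//.
  case: ifPn => _; last by rewrite mule0.
  by rewrite -!EFinB -EFinM; congr EFin; field.
apply/seteqP; split => x /=; rewrite !in_itv/= /scl.
  by rewrite ltr_pdivrMr// ler_pdivlMr// mulrC.
by rewrite ltr_pdivrMr// ler_pdivlMr// mulrC.
Qed.

Lemma ge0_integral_scale (c : R) (f : R -> \bar R) : (0 < c)%R ->
  measurable_fun setT f -> (forall x, 0 <= f x) ->
  \int[mu]_(x in `]0%R, +oo[) f x =
  c%:E * \int[mu]_(x in `]0%R, +oo[) f (c * x)%R.
Proof.
move=> c0 mf f0.
have E : scl c @^-1` `]0%R, +oo[%classic = `]0%R, +oo[%classic :> set R.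
  by apply/seteqP; split => x /=; rewrite !in_itv/= !andbT /scl pmulr_rgt0.
have mfD : measurable_fun (`]0%R, +oo[ : set R) f by exact: measurable_funTS.
rewrite -[X in _ = c%:E * \int[_]_(x in X) _]E.
have := @ge0_integral_pushforward _ _ (measurableTypeR R) (measurableTypeR R) R (scl c) (measurable_scl c) mu
   `]0%R, +oo[%classic f (measurable_itv _) mfD (fun y _ => f0 y).
rewrite /comp/= => <-.
pose cp := PosNum c0.
have := @ge0_integral_mscale _ (measurableTypeR R) R
  (dilated cp%:num) `]0%R, +oo[%classic (measurable_itv _) (cp%:num%:nng)%R f
   mfD (fun y _ => f0 y).
move=> /= <-.
by apply: eq_measure_integral => A mA _; apply/esym; exact: (lebesgue_measure_scale cp).
Qed.

End scaling.

(** * Powers on the half-line: integrals, and growth against the exponential *)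

Section powers.
Context {R : realType}.
Notation mu := (@lebesgue_measure R).

Lemma ftc2 (f F : R -> R) (a b : R) : a < b ->
  (forall x, a <= x <= b -> is_derive x 1 F (f x)) ->
  (forall x, a <= x <= b -> {for x, continuous f}) ->
  (\int[mu]_(x in `[a, b]) (f x)%:E = (F b)%:E - (F a)%:E)%E.
Proof.
move=> ab dF cf.
have cF x : a <= x <= b -> {for x, continuous F}.
  move=> xab; apply: differentiable_continuous.
  by apply/derivable1_diffP; have [] := dF x xab.
apply: continuous_FTC2 => //.
- apply: continuous_in_subspaceT => x; rewrite inE/= in_itv/= => ?.
  exact: cf.
- split.
  + move=> x; rewrite in_itv/= => /andP[ax xb].
    by have [|] := dF x; first by rewrite !ltW.
  + by apply: cvg_at_right_filter; apply: cF; rewrite lexx ltW.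
  + by apply: cvg_at_left_filter; apply: cF; rewrite lexx ltW.
- move=> x; rewrite in_itv/= => /andP[ax xb].
  by rewrite derive1E; have [|_ ->] := dF x; first by rewrite !ltW.
Qed.

Lemma is_derive_powR (p x : R) : 0 < x ->
  is_derive x 1 (fun y => y `^ p) (p * x `^ (p - 1)).
Proof.
move=> x0; have xi : x \in `]0, +oo[ by rewrite in_itv/= x0.
split; first exact: derivable_powR.
by rewrite -derive1E powR_derive1.
Qed.

Lemma continuous_powR (p x : R) : 0 < x ->
  {for x, continuous (fun y => y `^ p)}.
Proof.
move=> x0; apply: differentiable_continuous; apply/derivable1_diffP.
by have [] := is_derive_powR p x0.
Qed.

(** The segments [1/(n+1), 1] exhaust ]0, 1]; on each of them the fundamental theorem of calculus
    gives at most 1/a, since the primitive u^a / a is nonnegative at the left end. *)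
Lemma integral01_powR (a : R) : 0 < a ->
  (\int[mu]_(u in `]0%R, 1%R]) (u `^ (a - 1))%:E <= (a^-1)%:E)%E.
Proof.
move=> a0.
pose F n := `[(n.+1%:R^-1 : R), 1%R]%classic : set R.
have -> : `]0%R, 1%R]%classic = \bigcup_i F i.
  apply/seteqP; split => x /=; rewrite in_itv/=.
    move=> /andP[x0 x1]; have [n nx] := @ltr_add_invr R 0 x x0.
    by exists n => //; rewrite /F/= in_itv/= x1 ltW//; rewrite add0r in nx.
  move=> [n _]; rewrite /F/= in_itv/= => /andP[nx ->].
  by rewrite (lt_le_trans _ nx).
have ndF : nondecreasing_seq F.
  move=> m n mn; apply/subsetPset => x; rewrite /F/= !in_itv/= => /andP[mx ->].
  by rewrite (le_trans _ mx)// lef_pV2 ?posrE// ler_nat ltnS.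
have mF i : measurable (F i) by exact: measurable_itv.
have mf : measurable_fun setT (fun u : R => (u `^ (a - 1))%:E).
  by apply/measurable_EFinP; exact: (@measurable_powR R _).
have f0 u : (0 <= (u `^ (a - 1))%:E)%E by rewrite lee_fin powR_ge0.
have cvF := @ge0_nondecreasing_set_cvg_integral _ (measurableTypeR R) R F _ mu ndF mF
  (fun i => measurable_funTS mf) (fun i x _ => f0 x).
rewrite -(cvg_lim _ cvF)//; apply: lime_le; first by apply/cvg_ex; eexists; exact: cvF.
apply: nearW => -[|n].
  (* The first segment is the single point 1, where the fundamental theorem does not apply. *)
  rewrite /F invr1 set_itv1 integral_set1 lee_fin invr_ge0 ltW//.
have D (x : R) : n.+2%:R^-1 <= x <= 1 ->
    is_derive x 1 (fun u => u `^ a / a) (x `^ (a - 1)).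
  move=> /andP[x0 _]; have {}x0 : 0 < x by rewrite (lt_le_trans _ x0).
  have := is_derive_powR a x0 => H.
  have -> : x `^ (a - 1) = a^-1 *: (a * x `^ (a - 1)).
    by rewrite /GRing.scale/= mulrA mulVf ?mul1r// gt_eqF.
  have -> : (fun u => u `^ a / a) = a^-1 *: (fun u : R => u `^ a).
    by apply/funext => u; rewrite /GRing.scale/= mulrC.
  exact: is_deriveZ.
rewrite (ftc2 _ D); [|by rewrite invf_lt1// ltr1n|]; last first.
- move=> x /andP[x0 _]; apply: continuous_powR.
  by rewrite (lt_le_trans _ x0).
rewrite -EFinB lee_fin powR1 div1r gerBl.
by rewrite divr_ge0 ?powR_ge0// ltW.
Qed.

Lemma cvgr_powRN (b : R) : 0 < b -> (u : R) `^ (- b) @[u --> +oo] --> (0 : R).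
Proof.
move=> b0; apply/cvgrPdist_le => e e0; near=> x.
have xe : e `^ (- b^-1) <= x by near: x; exact: nbhs_pinfty_ge.
have x0 : 0 < x by rewrite (lt_le_trans _ xe)// powR_gt0.
rewrite sub0r normrN ger0_norm ?powR_ge0// powRN -[leRHS]invrK.
rewrite lef_pV2 ?posrE ?powR_gt0 ?invr_gt0//.
have -> : e^-1 = (e `^ (- b^-1)) `^ b.
  by rewrite -powRrM mulNr mulVf ?gt_eqF// powR_inv1// ltW.
by apply: ge0_ler_powR; rewrite ?nnegrE ?powR_ge0// ltW.
Unshelve. all: end_near. Qed.

Lemma integral1y_powR (b : R) : 0 < b ->
  (\int[mu]_(u in `[1%R, +oo[) (u `^ (- b - 1))%:E = (b^-1)%:E)%E.
Proof.
move=> b0.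
rewrite (@ge0_continuous_FTC2y _ _ (fun u => - b^-1 * u `^ (- b)) _ 0).
- by rewrite powR1 mulr1 EFinN oppeK add0e.
- by move=> x _; exact: powR_ge0.
- apply: continuous_in_subspaceT => x; rewrite inE/= in_itv/= andbT => x1.
  by apply: continuous_powR; rewrite (lt_le_trans _ x1).
- rewrite -[X in _ --> X](mulr0 (- b^-1)).
  apply: cvgM; first exact: cvg_cst.
  exact: cvgr_powRN.
- move=> x x1; have x0 : 0 < x by rewrite (lt_trans _ x1).
  have := is_derive_powR (- b) x0 => H.
  by have /(_ (- b^-1)) := @derivableZ _ _ _ (fun u : R => u `^ (- b)) _ _; apply; case: H.
- apply: cvg_at_right_filter; apply: cvgM; first exact: cvg_cst.
  exact: continuous_powR.
- move=> x; rewrite in_itv/= andbT => x1.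
  have x0 : 0 < x by rewrite (lt_trans _ x1).
  have := is_derive_powR (- b) x0 => H.
  rewrite derive1E.
  rewrite (_ : (fun u => - b^-1 * u `^ (- b)) = - b^-1 *: (fun u : R => u `^ (- b)))//.
  rewrite deriveZ; last by case: H.
  case: H => _ ->.
  by rewrite /GRing.scale/= mulrA mulNr mulrN mulVf ?gt_eqF// opprK mul1r.
Qed.

(** The integrability test behind most concrete half-line integrals below: a power greater than -1
    near 0, a power less than -1 at infinity, with one constant [C] for both ranges. *)
Lemma integrable_oy (f : R -> R) (a b C : R) : 0 < a -> 0 < b ->
  measurable_fun setT f ->
  (forall u, 0 < u <= 1 -> `|f u| <= C * u `^ (a - 1)) ->
  (forall u, 1 <= u -> `|f u| <= C * u `^ (- b - 1)) ->
  mu.-integrable `]0, +oo[ (EFin \o f).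
Proof.
move=> a0 b0 mf f0 f1.
have C0 : 0 <= C.
  have := f1 1 (lexx _); rewrite powR1 mulr1; exact: le_trans.
have E : `]0, +oo[%classic = `]0%R, 1%R] `|` `]1%R, +oo[ :> set R.
  apply/seteqP; split => x /=; rewrite !in_itv/= ?andbT.
    by move=> ->/=; case: (leP x 1) => ?; [left|right].
  by move=> [/andP[]//|/(lt_trans _)]; apply.
have mnf (D : set R) : measurable_fun D (fun x => `|(EFin \o f) x|%E).
  apply: measurable_funTS; apply: measurableT_comp => //.
  exact/measurable_EFinP.
have mp p (D : set R) : measurable_fun D (fun u : R => (C * u `^ p)%:E).
  apply: measurable_funTS; apply/measurable_EFinP.
  apply: measurable_funM; first exact: measurable_cst.
  exact: (@measurable_powR R _).
apply/integrableP; split.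
  by apply/measurable_EFinP; exact: measurable_funTS.
rewrite E ge0_integral_setU//=; last first.
  apply/disj_set2P/seteqP; split => // x [] /=; rewrite !in_itv/= andbT.
  by move=> /andP[_ x1]; rewrite ltNge x1.
- exact: mnf.
apply: lte_add_pinfty.
  apply: (@le_lt_trans _ _ (\int[mu]_(u in `]0%R, 1%R]) (C * u `^ (a - 1))%:E)%E).
    by apply: ge0_le_integral => //=; [exact: mnf|exact: mp].
  under eq_integral do rewrite EFinM.
  rewrite ge0_integralZl_EFin//; last 2 first.
    by move=> x _; rewrite lee_fin powR_ge0.
    by apply/measurable_EFinP/measurable_funTS; exact: (@measurable_powR R _).
  apply: lte_mul_pinfty => //.
  by rewrite (le_lt_trans (integral01_powR a0))// ltry.
apply: (@le_lt_trans _ _ (\int[mu]_(u in `]1%R, +oo[) (C * u `^ (- b - 1))%:E)%E).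
  apply: ge0_le_integral => //=; [exact: mnf|exact: mp|].
  by move=> x; rewrite in_itv/= andbT => /ltW x1; rewrite lee_fin f1.
under eq_integral do rewrite EFinM.
rewrite ge0_integralZl_EFin//; last 2 first.
  by move=> x _; rewrite lee_fin powR_ge0.
  by apply/measurable_EFinP/measurable_funTS; exact: (@measurable_powR R _).
apply: lte_mul_pinfty => //.
rewrite integral_itv_obnd_cbnd; last first.
  by apply/measurable_EFinP/measurable_funTS; exact: (@measurable_powR R _).
by rewrite integral1y_powR// ltry.
Qed.

Lemma powR_le1 (x p : R) : 0 <= x -> x <= 1 -> 0 <= p -> x `^ p <= 1.
Proof.
move=> x0 x1 p0.
have := ge0_ler_powR p0 (_ : x \in Num.nneg) (_ : 1 \in Num.nneg) x1.
by rewrite !nnegrE powR1; apply.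
Qed.

Lemma powR_ge1 (x p : R) : 1 <= x -> 0 <= p -> 1 <= x `^ p.
Proof.
move=> x1 p0; have x0 : 0 <= x by exact: le_trans x1.
have := ge0_ler_powR p0 (_ : 1 \in Num.nneg) (_ : x \in Num.nneg) x1.
by rewrite !nnegrE powR1; apply.
Qed.

(** For v > 1 round p up to an integer n and keep one term (cv)^n / n! of the exponential series;
    the summand 1 of the constant takes care of v <= 1. *)
Lemma powR_le_expR (p c : R) : 0 <= p -> 0 < c ->
  exists2 C : R, 0 < C & forall v, 0 <= v -> v `^ p <= C * expR (c * v).
Proof.
move=> p0 c0; pose n := (Num.trunc p).+1.
have pn : p <= n%:R by rewrite ltW// truncnS_gt.
exists (1 + n`!%:R / c ^+ n).
  by rewrite addr_gt0// divr_gt0 ?exprn_gt0// ltr0n fact_gt0.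
move=> v v0; case: (leP v 1) => v1.
  apply: (@le_trans _ _ 1).
    exact: powR_le1.
  rewrite -[leLHS]mulr1; apply: ler_pM => //.
    by rewrite lerDl divr_ge0 ?ltW ?exprn_gt0// ltr0n fact_gt0.
  by rewrite -expR0 ler_expR mulr_ge0// ltW.
apply: (@le_trans _ _ (v ^+ n)).
  by rewrite -powR_mulrn//; apply: ler_powR => //; exact: ltW.
have cv0 : 0 <= c * v by rewrite mulr_ge0// ltW.
have := @expR_ge1Dxn R (c * v) n.-1 cv0; rewrite prednK// => H.
set f : R := n`!%:R in H *; have f0 : 0 < f by rewrite ltr0n fact_gt0.
have -> : v ^+ n = f / c ^+ n * ((c * v) ^+ n / f).
  by rewrite exprMn; field; rewrite !gt_eqF// exprn_gt0.
apply: ler_pM.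
- by rewrite divr_ge0 ?ltW// exprn_gt0.
- by rewrite divr_ge0 ?exprn_ge0// ltW.
- by rewrite lerDr.
- by apply: le_trans H; rewrite lerDr.
Qed.

End powers.

(** * Derivation rules in lambda form, and measurability of inverses *)

Section derivation_helpers.
Context {R : realType}.

Lemma is_deriveV1 (f : R -> R) (x df : R) : f x != 0 ->
  is_derive x 1 f df -> is_derive x 1 (fun y => (f y)^-1) (- (f x ^- 2 * df)).
Proof.
move=> fx0 [fd <-]; split; first exact: derivableV.
by rewrite deriveV// scaleNr.
Qed.

Lemma is_deriveM1 (f g : R -> R) (x df dg : R) :
  is_derive x 1 f df -> is_derive x 1 g dg ->
  is_derive x 1 (fun y => f y * g y) (f x * dg + g x * df).
Proof. by move=> ? ?; exact: is_deriveM. Qed.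

Lemma is_deriveD1 (f g : R -> R) (x df dg : R) :
  is_derive x 1 f df -> is_derive x 1 g dg ->
  is_derive x 1 (fun y => f y + g y) (df + dg).
Proof. by move=> ? ?; exact: is_deriveD. Qed.

Lemma is_deriveB1 (f g : R -> R) (x df dg : R) :
  is_derive x 1 f df -> is_derive x 1 g dg ->
  is_derive x 1 (fun y => f y - g y) (df - dg).
Proof. by move=> ? ?; exact: is_deriveB. Qed.

Lemma is_deriveN1 (f : R -> R) (x df : R) :
  is_derive x 1 f df -> is_derive x 1 (fun y => - f y) (- df).
Proof. by move=> ?; exact: is_deriveN. Qed.

Lemma is_deriveZ1 (k : R) (f : R -> R) (x df : R) :
  is_derive x 1 f df -> is_derive x 1 (fun y => k * f y) (k * df).
Proof. by move=> ?; exact: is_deriveZ. Qed.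

(** 1/f is f times the power -1 of f^2, and real powers are measurable on the whole line. At a zero
    of f both sides are 0, the inverse of 0 being 0. *)
Lemma measurable_funV d (T : measurableType d) (D : set T) (f : T -> R) :
  measurable_fun D f -> measurable_fun D (fun x => (f x)^-1).
Proof.
move=> mf.
rewrite (_ : (fun _ => _) = fun x => f x * (f x ^+ 2) `^ (-1)).
  apply: measurable_funM => //.
  apply: (measurableT_comp (measurable_powR (-1))).
  exact: measurable_funX.
apply/funext => x; rewrite powR_inv1 ?sqr_ge0//.
have [->|fx0] := eqVneq (f x) 0; first by rewrite invr0 mul0r.
by field.
Qed.

End derivation_helpers.

(** * Holomorphic functions in polar coordinates *)

Section polar.
Context {R : realType}.
Implicit Types (u v p q : R * R -> R) (z : R * R).

(* [u + i v] is a function of the complex variable [r e^(i t)], [(r, t) = z],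
   with complex derivative [e^(- i t) (p + i q)] at that point. *)
Definition polarCR u v p q z : Prop :=
  [/\ is_derive z.1 1 (fun r => u (r, z.2)) (p z),
      is_derive z.1 1 (fun r => v (r, z.2)) (q z),
      is_derive z.2 1 (fun t => u (z.1, t)) (- (z.1 * q z)) &
      is_derive z.2 1 (fun t => v (z.1, t)) (z.1 * p z)].

Definition regular4 u v p q z : Prop :=
  [/\ {for z, continuous u}, {for z, continuous v},
      {for z, continuous p} & {for z, continuous q}].

Definition measurable4 u v p q : Prop :=
  [/\ measurable_fun setT u, measurable_fun setT v,
      measurable_fun setT p & measurable_fun setT q].

(** Measurability is asked on the whole plane, for Fubini; the Cauchy-Riemann equations and
    continuity only on [D]. *)
Definition polar_holo u v p q (D : set (R * R)) : Prop :=
  measurable4 u v p q /\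
  forall z, D z -> polarCR u v p q z /\ regular4 u v p q z.

Lemma polar_holo_cst (c : R) D :
  polar_holo (fun=> c) (fun=> 0) (fun=> 0) (fun=> 0) D.
Proof.
split; first by split; exact: measurable_cst.
move=> z _; split; last by split; exact: cst_continuous.
by split; rewrite ?mulr0 ?oppr0; exact: is_derive_cst.
Qed.

Lemma polar_holoD u v p q u' v' p' q' D :
  polar_holo u v p q D -> polar_holo u' v' p' q' D ->
  polar_holo (fun z => u z + u' z) (fun z => v z + v' z)
    (fun z => p z + p' z) (fun z => q z + q' z) D.
Proof.
move=> [[mu mv mp mq] H] [[mu' mv' mp' mq'] H']; split.
  by split; exact: measurable_funD.
move=> z Dz; have [[h1 h2 h3 h4] [c1 c2 c3 c4]] := H z Dz.
have [[k1 k2 k3 k4] [e1 e2 e3 e4]] := H' z Dz.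
split; last by split; apply: continuousD.
split; [exact: is_deriveD1|exact: is_deriveD1| |].
  by apply: (is_derive_eq (is_deriveD1 h3 k3)); rewrite mulrDr opprD.
by apply: (is_derive_eq (is_deriveD1 h4 k4)); rewrite mulrDr.
Qed.

Lemma polar_holoM u v p q u' v' p' q' D :
  polar_holo u v p q D -> polar_holo u' v' p' q' D ->
  polar_holo (fun z => u z * u' z - v z * v' z) (fun z => u z * v' z + v z * u' z)
    (fun z => (u z * p' z + u' z * p z) - (v z * q' z + v' z * q z))
    (fun z => (u z * q' z + v' z * p z) + (v z * p' z + u' z * q z)) D.
Proof.
move=> [[mu mv mp mq] H] [[mu' mv' mp' mq'] H']; split.
  split.
  - by apply: measurable_funB; apply: measurable_funM.
  - by apply: measurable_funD; apply: measurable_funM.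
  - by apply: measurable_funB; apply: measurable_funD; apply: measurable_funM.
  - by apply: measurable_funD; apply: measurable_funD; apply: measurable_funM.
move=> z Dz; have [[h1 h2 h3 h4] [c1 c2 c3 c4]] := H z Dz.
have [[k1 k2 k3 k4] [e1 e2 e3 e4]] := H' z Dz.
have zE : z = (z.1, z.2) by case: z {Dz h1 h2 h3 h4 c1 c2 c3 c4 k1 k2 k3 k4 e1 e2 e3 e4}.
split; last first.
  split.
  - by apply: continuousB; apply: continuousM.
  - by apply: continuousD; apply: continuousM.
  - by apply: continuousB; apply: continuousD; apply: continuousM.
  - by apply: continuousD; apply: continuousD; apply: continuousM.
split.
- by refine (is_derive_eq (is_deriveB1 (is_deriveM1 h1 k1) (is_deriveM1 h2 k2)) _); rewrite -zE.
- by refine (is_derive_eq (is_deriveD1 (is_deriveM1 h1 k2) (is_deriveM1 h2 k1)) _); rewrite -zE.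
- by refine (is_derive_eq (is_deriveB1 (is_deriveM1 h3 k3) (is_deriveM1 h4 k4)) _); rewrite -zE; ring.
- by refine (is_derive_eq (is_deriveD1 (is_deriveM1 h3 k4) (is_deriveM1 h4 k3)) _); rewrite -zE; ring.
Qed.

(** The formulas are the real and imaginary parts of (u - iv)/|u + iv|^2 and of -(p + iq)/(u +
    iv)^2, with denominators made real. *)
Lemma polar_holoV u v p q D :
  polar_holo u v p q D -> (forall z, D z -> u z ^+ 2 + v z ^+ 2 != 0) ->
  polar_holo (fun z => u z * (u z ^+ 2 + v z ^+ 2)^-1)
    (fun z => - (v z * (u z ^+ 2 + v z ^+ 2)^-1))
    (fun z => - ((p z * (u z ^+ 2 - v z ^+ 2) + 2 * q z * u z * v z) *
      ((u z ^+ 2 + v z ^+ 2) ^+ 2)^-1))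
    (fun z => - ((q z * (u z ^+ 2 - v z ^+ 2) - 2 * p z * u z * v z) *
      ((u z ^+ 2 + v z ^+ 2) ^+ 2)^-1)) D.
Proof.
move=> [[mu mv mp mq] H] N0.
have mN : measurable_fun setT (fun z => u z ^+ 2 + v z ^+ 2).
  by apply: measurable_funD; exact: measurable_funX.
have mN1 := measurable_funV mN.
have mN2 : measurable_fun setT (fun z => ((u z ^+ 2 + v z ^+ 2) ^+ 2)^-1).
  by apply: measurable_funV; exact: measurable_funX.
have mB : measurable_fun setT (fun z => u z ^+ 2 - v z ^+ 2).
  by apply: measurable_funB; exact: measurable_funX.
split.
  split.
  - exact: measurable_funM.
  - by apply: measurableT_comp => //; exact: measurable_funM.
  - apply: measurableT_comp => //; apply: measurable_funM => //.
    apply: measurable_funD; apply: measurable_funM => //.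
    by apply: measurable_funM => //; exact: measurable_funM.
  - apply: measurableT_comp => //; apply: measurable_funM => //.
    apply: measurable_funB; apply: measurable_funM => //.
    by apply: measurable_funM => //; exact: measurable_funM.
move=> z Dz; have [[h1 h2 h3 h4] [c1 c2 c3 c4]] := H z Dz.
have zE : z = (z.1, z.2) by case: z {Dz h1 h2 h3 h4 c1 c2 c3 c4}.
have n0 := N0 z Dz.
have sq (w : R * R -> R) : {for z, continuous w} ->
    {for z, continuous (fun z => w z ^+ 2)}.
  by move=> cw; exact: (continuousM cw cw).
have cN : {for z, continuous (fun z => u z ^+ 2 + v z ^+ 2)}.
  by apply: continuousD; exact: sq.
have cN1 : {for z, continuous (fun z => (u z ^+ 2 + v z ^+ 2)^-1)}.
  exact: continuousV.
have cN2 : {for z, continuous (fun z => ((u z ^+ 2 + v z ^+ 2) ^+ 2)^-1)}.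
  by apply: continuousV; [exact: expf_neq0|exact: sq].
have cB : {for z, continuous (fun z => u z ^+ 2 - v z ^+ 2)}.
  by apply: continuousB; exact: sq.
have cm2 (w : R * R -> R) : {for z, continuous w} -> {for z, continuous (fun z => (2 : R) * w z)}.
  by move=> cw; apply: continuousM => //; exact: cst_continuous.
split; last first.
  split.
  - exact: continuousM.
  - by apply: continuousN; exact: continuousM.
  - apply: continuousN; apply: continuousM => //.
    by apply: continuousD; apply: continuousM => //; apply: continuousM => //; exact: cm2.
  - apply: continuousN; apply: continuousM => //.
    by apply: continuousB; apply: continuousM => //; apply: continuousM => //; exact: cm2.
have dN (f g : R -> R) (x df dg : R) : f x ^+ 2 + g x ^+ 2 != 0 ->
    is_derive x 1 f df -> is_derive x 1 g dg ->
    is_derive x 1 (fun y => (f y ^+ 2 + g y ^+ 2)^-1)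
    (- ((f x ^+ 2 + g x ^+ 2) ^- 2 * (f x * df + f x * df + (g x * dg + g x * dg)))).
  move=> fg0 Hf Hg.
  have H2 : is_derive x 1 (fun y => f y ^+ 2 + g y ^+ 2)
      (f x * df + f x * df + (g x * dg + g x * dg)).
    exact: (is_deriveD1 (is_deriveM1 Hf Hf) (is_deriveM1 Hg Hg)).
  exact: (@is_deriveV1 _ (fun y => f y ^+ 2 + g y ^+ 2) x _ fg0 H2).
have n0' : u (z.1, z.2) ^+ 2 + v (z.1, z.2) ^+ 2 != 0 by rewrite -zE.
split.
- refine (is_derive_eq (is_deriveM1 h1 (dN (fun r => u (r, z.2)) (fun r => v (r, z.2)) _ _ _ n0' h1 h2)) _).
  by rewrite -zE; field.
- refine (is_derive_eq (is_deriveN1 (is_deriveM1 h2 (dN (fun r => u (r, z.2)) (fun r => v (r, z.2)) _ _ _ n0' h1 h2))) _).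
  by rewrite -zE; field.
- refine (is_derive_eq (is_deriveM1 h3 (dN (fun t => u (z.1, t)) (fun t => v (z.1, t)) _ _ _ n0' h3 h4)) _).
  by rewrite -zE; field.
- refine (is_derive_eq (is_deriveN1 (is_deriveM1 h4 (dN (fun t => u (z.1, t)) (fun t => v (z.1, t)) _ _ _ n0' h3 h4))) _).
  by rewrite -zE; field.
Qed.

(** In the coordinates (r, t) the power z^c is r^c e^(ict) for every angle t, so no branch cut has
    to be avoided and the angle pi is an ordinary point. *)
Lemma polar_holo_pow (c : R) (D : set (R * R)) : (forall z, D z -> 0 < z.1) ->
  polar_holo (fun z => z.1 `^ c * cos (c * z.2)) (fun z => z.1 `^ c * sin (c * z.2))
    (fun z => c * z.1 `^ (c - 1) * cos (c * z.2))
    (fun z => c * z.1 `^ (c - 1) * sin (c * z.2)) D.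
Proof.
move=> D0.
have mc : measurable_fun setT (fun z : R * R => cos (c * z.2)).
  apply: measurableT_comp; first exact: (continuous_measurable_fun (@continuous_cos R)).
  by apply: measurable_funM => //; exact: measurable_snd.
have ms : measurable_fun setT (fun z : R * R => sin (c * z.2)).
  apply: measurableT_comp; first exact: (continuous_measurable_fun (@continuous_sin R)).
  by apply: measurable_funM => //; exact: measurable_snd.
have mp (e : R) : measurable_fun setT (fun z : R * R => z.1 `^ e).
  by apply: (measurableT_comp (measurable_powR e)); exact: measurable_fst.
split.
  split; try exact: measurable_funM.
    by apply: measurable_funM => //; apply: measurable_funM.
  by apply: measurable_funM => //; apply: measurable_funM.
move=> z Dz; have z0 := D0 z Dz.
have cm : {for z, continuous (fun z : R * R => c * z.2)}.
  by apply: continuousM; [exact: cst_continuous|exact: cvg_snd].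
have cc : {for z, continuous (fun z : R * R => cos (c * z.2))}.
  by apply: (continuous_comp cm); exact: continuous_cos.
have cs : {for z, continuous (fun z : R * R => sin (c * z.2))}.
  by apply: (continuous_comp cm); exact: continuous_sin.
have cp (e : R) : {for z, continuous (fun z : R * R => z.1 `^ e)}.
  apply: (@continuous_comp _ _ _ (fun z : R * R => z.1) (fun x => x `^ e)).
    exact: cvg_fst.
  exact: continuous_powR.
have cpc : {for z, continuous (fun z : R * R => c * z.1 `^ (c - 1))}.
  by apply: continuousM => //; exact: cst_continuous.
split; last by split; exact: continuousM.
have dm : is_derive z.2 1 (fun t => c * t) c.
  by apply: (is_derive_eq (is_deriveZ1 c (is_derive_id z.2 1))); rewrite mulr1.
have dc : is_derive z.2 1 (fun t => cos (c * t)) (- (c * sin (c * z.2))).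
  refine (is_derive_eq (@is_derive1_comp _ cos (fun t => c * t) _ _ _ (is_derive_cos _) dm) _).
  by rewrite /=; ring.
have ds : is_derive z.2 1 (fun t => sin (c * t)) (c * cos (c * z.2)).
  refine (is_derive_eq (@is_derive1_comp _ sin (fun t => c * t) _ _ _ (is_derive_sin _) dm) _).
  by rewrite /=; ring.
have dp := is_derive_powR c z0.
have pE : z.1 * z.1 `^ (c - 1) = z.1 `^ c.
  have [c0|c0] := eqVneq c 0.
    by rewrite c0 sub0r powRr0 powR_inv1 ?divff ?gt_eqF// ltW.
  rewrite -{1}(powRr1 (ltW z0)) -powRD; last by rewrite (gt_eqF z0) implybT.
  by rewrite addrC subrK.
split => /=.
- refine (is_derive_eq (is_deriveM1 dp (is_derive_cst _ _ _)) _).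
  by rewrite /=; ring.
- refine (is_derive_eq (is_deriveM1 dp (is_derive_cst _ _ _)) _).
  by rewrite /=; ring.
- refine (is_derive_eq (is_deriveZ1 _ dc) _).
  by rewrite -pE; ring.
- refine (is_derive_eq (is_deriveZ1 _ ds) _).
  by rewrite -pE; ring.
Qed.

End polar.

(** * Cauchy's theorem on an annular sector *)

Section polar_rectangle.
Context {R : realType}.
Notation mu := (@lebesgue_measure R).
Implicit Types (u v p q : R * R -> R) (z : R * R).

Lemma continuous_pairl (f : R * R -> R) (x y : R) :
  {for (x, y), continuous f} -> {for y, continuous (fun t => f (x, t))}.
Proof.
move=> cf; apply: (@continuous_comp _ _ _ (fun t => (x, t)) f y) => //.
exact: (cvg_pair (cvg_cst x) cvg_id).
Qed.

Lemma continuous_pairr (f : R * R -> R) (x y : R) :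
  {for (x, y), continuous f} -> {for x, continuous (fun t => f (t, y))}.
Proof.
move=> cf; apply: (@continuous_comp _ _ _ (fun t => (t, y)) f x) => //.
exact: (cvg_pair cvg_id (cvg_cst y)).
Qed.

Lemma rectangle_bounded (f : R * R -> R) (a b c d : R) :
  (forall x y, a <= x <= b -> c <= y <= d -> {for (x, y), continuous f}) ->
  exists M, forall x y, a <= x <= b -> c <= y <= d -> `|f (x, y)| <= M.
Proof.
move=> cf.
have cK : compact (`[a, b]%classic `*` `[c, d]%classic : set (R * R)).
  by apply: compact_setX; exact: segment_compact.
have cfK : {within `[a, b]%classic `*` `[c, d]%classic, continuous f}.
  apply: continuous_in_subspaceT => -[x y]; rewrite inE/= !in_itv/= => -[? ?].
  exact: cf.
have /compact_bounded/pinfty_ex_gt0[M _ HM] := continuous_compact cfK cK.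
by exists M => x y xab ycd; apply: HM; exists (x, y).
Qed.

(** Both sides are the integral of [p] over the rectangle, since v has angular derivative r p and u
    has radial derivative p. This is the imaginary part of Cauchy's theorem for f(z) dz/z along the
    boundary of the sector. *)
Lemma polar_rectangle u v p q (D : set (R * R)) (a b c d : R) :
  polar_holo u v p q D -> 0 < a < b -> c < d ->
  (forall x y, a <= x <= b -> c <= y <= d -> D (x, y)) ->
  (\int[mu]_(r in `[a, b]) ((v (r, d) - v (r, c)) / r)%:E =
   \int[mu]_(t in `[c, d]) (u (b, t) - u (a, t))%:E)%E.
Proof.
move=> [[_ _ mp _] H] /andP[a0 ab] cd sub.
have cp x y : a <= x <= b -> c <= y <= d -> {for (x, y), continuous p}.
  by move=> xab ycd; have [_ []] := H _ (sub x y xab ycd).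
have [M HM] := rectangle_bounded cp.
transitivity (\int[mu]_(r in `[a, b]) \int[mu]_(t in `[c, d]) (p (r, t))%:E)%E.
  apply: eq_integral => r; rewrite inE/= in_itv/= => rab.
  have r0 : 0 < r by case/andP: rab => ? _; exact: lt_le_trans a0 _.
  have dv t : c <= t <= d -> is_derive t 1 (fun t => r^-1 * v (r, t)) (p (r, t)).
    move=> tcd; have [[_ _ _ h4] _] := H _ (sub r t rab tcd).
    refine (is_derive_eq (is_deriveZ1 r^-1 h4) _).
    by rewrite /= mulrA mulVf ?mul1r// gt_eqF.
  rewrite (ftc2 cd dv); first by rewrite -EFinB -mulrBr mulrC.
  by move=> t tcd; apply: continuous_pairl; exact: cp.
transitivity (\int[mu]_(t in `[c, d]) \int[mu]_(r in `[a, b]) (p (r, t))%:E)%E;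
    last first.
  apply: eq_integral => t; rewrite inE/= in_itv/= => tcd.
  have du r : a <= r <= b -> is_derive r 1 (fun r => u (r, t)) (p (r, t)).
    by move=> rab; have [[h1 _ _ _] _] := H _ (sub r t rab tcd).
  rewrite (ftc2 ab du) ?EFinB//.
  by move=> r rab; apply: continuous_pairr; exact: cp.
apply: fubini_on => //.
apply: (@le_lt_trans _ _
  (\int[mu]_(r in `[a, b]) \int[mu]_(t in `[c, d]) M%:E)%E).
  have mnp : measurable_fun setT (fun z => (`|p z|)%:E : \bar R).
    by apply/measurable_EFinP; exact: measurableT_comp.
  apply: ge0_le_integral => //.
  - by move=> r _; apply: integral_ge0 => t _; rewrite lee_fin.
  - rewrite (_ : (fun x => _) = fun x => \int[mu]_t (`|p (x, t)| * \1_`[c, d] t)%:E)%E.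
      apply: measurable_funTS.
      apply: (@measurable_fun_fubini_tonelli_F _ _ _ _ _ mu
        (fun z => (`|p z| * \1_`[c, d] z.2)%:E)).
        apply/measurable_EFinP; apply: measurable_funM.
          exact: measurableT_comp.
        have mi : measurable_fun [set: R] (\1_`[c, d] : R -> R).
          exact: measurable_indic.
        exact: (measurableT_comp mi measurable_snd).
      by move=> z; rewrite lee_fin mulr_ge0.
    apply/funext => x; rewrite integral_mkcond.
    by under eq_integral do rewrite (patch_mul_indic `[c, d]%classic (fun t => `|p (x, t)|)).
  - move=> r; rewrite /= in_itv/= => rab.
    apply: ge0_le_integral => //.
    + apply: measurable_funTS.
      by apply: (measurableT_comp mnp); exact: measurable_pair1.
    + by move=> t; rewrite /= in_itv/= => tcd; rewrite lee_fin HM.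
rewrite (integral_cst mu (measurable_itv `[a, b]) (\int[mu]_(t in `[c, d]) M%:E)%E).
rewrite (integral_cst mu (measurable_itv `[c, d]) M%:E) /= !lebesgue_measure_itv/= !lte_fin ab cd.
by rewrite -!EFinB -!EFinM ltry.
Qed.

End polar_rectangle.

(** * Rotating the positive half-line onto the negative one *)

Section rotation.
Context {R : realType}.
Notation mu := (@lebesgue_measure R).

(** The offset 2 keeps the segment nondegenerate at n = 0. *)
Definition inv_segment (n : nat) : set R := `[n.+2%:R^-1, n.+2%:R]%classic.

Lemma subset_inv_segment (n : nat) : inv_segment n `<=` `]0, +oo[%classic.
Proof.
move=> x; rewrite /inv_segment; rewrite /= !in_itv/= andbT => /andP[nx _].
by apply: lt_le_trans nx; rewrite invr_gt0 ltr0n.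
Qed.

Lemma integrable_segments_cvg (w : R -> R) :
  mu.-integrable `]0, +oo[ (EFin \o w) ->
  (\int[mu]_(r in inv_segment n) (w r)%:E @[n --> \oo] -->
   \int[mu]_(r in `]0%R, +oo[) (w r)%:E)%E.
Proof.
move=> iw.
have mw : measurable_fun (`]0, +oo[%classic : set R) (EFin \o w).
  by case/integrableP: iw.
have -> : (fun n => \int[mu]_(r in inv_segment n) (w r)%:E)%E =
    (fun n => \int[mu]_(r in `]0%R, +oo[) (w r * \1_(inv_segment n) r)%:E)%E.
  apply/funext => n; rewrite -[in LHS](setIidr (@subset_inv_segment n)).
  rewrite integral_mkcondr; apply: eq_integral => r _.
  by rewrite (patch_mul_indic (inv_segment n) w).
apply: (@dominated_cvg _ (measurableTypeR R) R mu `]0%R, +oo[%classic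
  (measurable_itv _) _ _ (fun r => (`|w r|)%:E)).
- move=> n; apply/measurable_EFinP; apply: measurable_funM.
    exact/measurable_EFinP.
  by apply: measurable_indic; exact: measurable_itv.
- move=> r; rewrite /= in_itv/= andbT => r0.
  apply: cvg_near_cst; near=> n; rewrite indicE mem_set ?mulr1//.
  rewrite /inv_segment /= in_itv/=; apply/andP; split.
    rewrite -[leRHS]invrK lef_pV2 ?posrE ?invr_gt0 ?ltr0n//.
    rewrite (@le_trans _ _ n%:R)// ?ler_nat//; last by rewrite ltnW.
    by near: n; exact: nbhs_infty_ger.
  rewrite (@le_trans _ _ n%:R)// ?ler_nat//; last by rewrite ltnW.
  by near: n; exact: nbhs_infty_ger.
- by [].
- exact: integrable_norm.
- by move=> n r _; rewrite lee_fin normrM ler_piMr// ger0_norm.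
Unshelve. all: end_near. Qed.

(** A two-sided power majorant: for positive exponents it is integrable against dr/r, and it tends
    to 0 at both ends, which makes the arcs of the contour negligible. *)
Definition tail_dom (C a b r : R) : R :=
  C * (if r <= 1 then r `^ a else r `^ (- b)).

Lemma tail_dom_ge0 (C a b r : R) : 0 <= C -> 0 <= tail_dom C a b r.
Proof. by move=> C0; rewrite mulr_ge0//; case: ifP => _; exact: powR_ge0. Qed.

Lemma measurable_tail_dom (C a b : R) : measurable_fun setT (tail_dom C a b).
Proof.
apply: measurable_funM => //.
by apply: measurable_fun_ifT => //; exact: measurable_fun_ler.
Qed.

Lemma tail_dom_cvg (C a b : R) : 0 < a -> 0 < b ->
  tail_dom C a b n.+2%:R @[n --> \oo] --> (0 : R) /\
  tail_dom C a b n.+2%:R^-1 @[n --> \oo] --> (0 : R).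
Proof.
move=> a0 b0.
have cv (c : R) : 0 < c -> (n.+2%:R : R) `^ (- c) @[n --> \oo] --> (0 : R).
  move=> c0; apply: (@cvg_comp _ _ _ (fun n : nat => (n.+2%:R : R)) (fun x => x `^ (- c))
     \oo (pinfty_nbhs R) (nbhs 0)); last exact: cvgr_powRN.
  apply/cvgryPge => A; near=> n.
  rewrite (@le_trans _ _ n%:R)// ?ler_nat//; last by rewrite ltnW.
  by near: n; exact: nbhs_infty_ger.
split; rewrite -[X in _ --> X](mulr0 C).
  have -> : (fun n : nat => tail_dom C a b n.+2%:R) =
      (fun n : nat => C * n.+2%:R `^ (- b)).
    by apply/funext => n; rewrite /tail_dom leNgt ltr1n.
  by apply: cvgM; [exact: cvg_cst|exact: cv].
have -> : (fun n : nat => tail_dom C a b n.+2%:R^-1) =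
    (fun n : nat => C * n.+2%:R `^ (- a)).
  apply/funext => n; rewrite /tail_dom invf_le1 ?ltr0n// ler1n/=.
  by rewrite -powR_inv1// -powRrM mulN1r.
by apply: cvgM; [exact: cvg_cst|exact: cv].
Unshelve. all: end_near. Qed.

Lemma tail_dom_integrable (C a b : R) (w : R -> R) : 0 < a -> 0 < b -> 0 <= C ->
  measurable_fun setT w -> (forall r, 0 < r -> `|w r| <= tail_dom C a b r) ->
  mu.-integrable `]0, +oo[ (EFin \o (fun r => w r / r)).
Proof.
move=> a0 b0 C0 mw wC; apply: (@integrable_oy R _ a b C) => //.
- apply: measurable_funM => //; exact: (measurable_funV (@measurable_id _ _ _)).
- move=> r /andP[r0 r1]; rewrite normrM normfV (ger0_norm (ltW r0)).
  rewrite ler_pdivrMr// (le_trans (wC r r0))// /tail_dom r1 -mulrA ler_wpM2l//.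
  by rewrite mulrC mulr_powRB1// ltW.
- move=> r r1; have r0 : 0 < r by exact: lt_le_trans r1.
  rewrite normrM normfV (ger0_norm (ltW r0)).
  rewrite ler_pdivrMr// (le_trans (wC r r0))// /tail_dom -mulrA ler_wpM2l//.
  have E : r `^ (- b - 1) * r = r `^ (- b).
    rewrite -{2}(powRr1 (ltW r0)) -powRD ?subrK//.
    by rewrite (gt_eqF r0) implybT.
  rewrite E; case: ifP => // rle1.
  have -> : r = 1 by apply/eqP; rewrite eq_le rle1 r1.
  by rewrite !powR1.
Qed.

(** The integral of v(r, t) dr/r does not depend on t in ]0, pi], because the arcs at radii 1/(n+2)
    and n+2 contribute nothing in the limit. Letting t tend to 0 along 1/(n+1), dominated
    convergence makes it 0. The radius 1 is exempted so that the point 1 of the real axis may be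
    singular. *)
Lemma polar_rotation (u v p q : R * R -> R) (a b C : R) :
  0 < a -> 0 < b -> 0 <= C ->
  polar_holo u v p q [set z | 0 < z.1 /\ 0 < z.2 <= pi] ->
  (forall r t, 0 < r -> 0 < t <= pi ->
     `|u (r, t)| <= tail_dom C a b r /\ `|v (r, t)| <= tail_dom C a b r) ->
  (forall r, 0 < r -> r != 1 -> v (r, n.+1%:R^-1) @[n --> \oo] --> (0 : R)) ->
  (\int[mu]_(r in `]0%R, +oo[) (v (r, pi) / r)%:E = 0)%E.
Proof.
move=> a0 b0 C0 H bd lim0.
have [[mu' mv _ _] _] := H.
have mvt t : measurable_fun setT (fun r => v (r, t)).
  by apply: (measurableT_comp mv); exact: measurable_pair2.
have ti n : 0 < (n.+1%:R^-1 : R) <= pi.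
  rewrite invr_gt0 ltr0n/= (@le_trans _ _ 1)// ?invf_le1 ?ltr0n ?ler1n//.
  by rewrite (le_trans _ (@pi_ge2 R))// ler1n.
have pipi : 0 < (pi : R) <= pi by rewrite pi_gt0 lexx.
have iv t : 0 < t <= pi ->
    mu.-integrable `]0, +oo[ (EFin \o (fun r => v (r, t) / r)).
  by move=> t0; apply: (@tail_dom_integrable C a b) => // r r0; have [] := bd r t r0 t0.
(* By Cauchy's theorem the difference of the two truncated integrals is an integral over two arcs,
   bounded by [e n], which tends to 0. *)
have const t : 0 < t < pi -> (\int[mu]_(r in `]0%R, +oo[) (v (r, pi) / r)%:E =
   \int[mu]_(r in `]0%R, +oo[) (v (r, t) / r)%:E)%E.
  move=> /andP[t0 tpi]; have t0' : 0 < t <= pi by rewrite t0 ltW.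
  pose w r := (v (r, pi) - v (r, t)) / r.
  have wE : w = (fun r => v (r, pi) / r - v (r, t) / r).
    by apply/funext => r; rewrite /w mulrBl.
  have iw : mu.-integrable `]0, +oo[ (EFin \o w).
    by rewrite wE; apply: (integrableB _ (iv _ pipi) (iv _ t0')).
  suff w0 : (\int[mu]_(r in `]0%R, +oo[) (w r)%:E = 0)%E.
    move: w0; rewrite wE.
    rewrite (@integralB_EFin _ _ _ _ _ _ _ _ (iv _ pipi) (iv _ t0'))//.
    move/eqP; rewrite sube_eq ?add0e; first by move/eqP.
      exact: integrable_fin_num (iv _ pipi).
    rewrite fin_num_adde_defl//.
    exact: integrable_fin_num (iv _ t0').
  have cvw := integrable_segments_cvg iw.
  have [cv1 cv2] := tail_dom_cvg C a0 b0.
  pose e n := (pi - t) * (tail_dom C a b n.+2%:R + tail_dom C a b n.+2%:R^-1).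
  have cve : e n @[n --> \oo] --> (0 : R).
    rewrite -[X in _ --> X](mulr0 (pi - t)); apply: cvgM; first exact: cvg_cst.
    by rewrite -[X in _ --> X](addr0 0); apply: cvgD.
  have le n : (`|\int[mu]_(r in inv_segment n) (w r)%:E| <= (e n)%:E)%E.
    have n0 : (0 : R) < n.+2%:R^-1 by rewrite invr_gt0 ltr0n.
    have nn : (n.+2%:R^-1 : R) < n.+2%:R.
      by rewrite (@lt_trans _ _ 1)// ?ltr1n// invf_lt1 ?ltr0n// ltr1n.
    have n0' : (0 : R) < n.+2%:R by rewrite ltr0n.
    rewrite (polar_rectangle H _ tpi); last 2 first.
      by rewrite n0 nn.
      move=> x y /andP[x0 _] /andP[y0 y1] /=; split; first exact: lt_le_trans x0.
      by rewrite y1 (lt_le_trans t0 y0).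
    have mut r : measurable_fun setT (fun t => u (r, t)).
      by apply: (measurableT_comp mu'); exact: measurable_pair1.
    apply: (le_trans (le_abse_integral _ _ _)) => //.
      by apply/measurable_EFinP/measurable_funTS/measurable_funB; exact: mut.
    apply: (@le_trans _ _ (\int[mu]_(x in `[t, pi]) (tail_dom C a b n.+2%:R +
       tail_dom C a b n.+2%:R^-1)%:E)%E).
      apply: ge0_le_integral => //.
      - apply: measurable_funTS; apply: measurableT_comp => //.
        by apply/measurable_EFinP/measurable_funB; exact: mut.
      - move=> x; rewrite /= in_itv/= => /andP[tx xpi].
        have x0 : 0 < x <= pi by rewrite xpi (lt_le_trans t0).
        rewrite lee_fin (le_trans (ler_normB _ _))// lerD//.
          by have [] := bd n.+2%:R x n0' x0.
        by have [] := bd n.+2%:R^-1 x n0 x0.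
    rewrite (integral_cst mu (measurable_itv `[t, pi]) (_%:E)) /= lebesgue_measure_itv/=.
    by rewrite lte_fin tpi -EFinB -EFinM lee_fin /e mulrC.
  apply/eqP; rewrite -abse_eq0 eq_le abse_ge0 andbT.
  have cvaw : (`|\int[mu]_(r in inv_segment n) (w r)%:E| @[n --> \oo] -->
      `|\int[mu]_(r in `]0%R, +oo[) (w r)%:E|)%E by apply: cvg_abse.
  have cvee : ((e n)%:E @[n --> \oo] --> 0%:E)%E by apply: cvg_EFin => //; exact: nearW.
  rewrite -(cvg_lim _ cvaw)// -[leRHS](cvg_lim _ cvee)//.
  apply: lee_lim; [by apply/cvg_ex; eexists; exact: cvaw|
    by apply/cvg_ex; eexists; exact: cvee|exact: nearW].
have constn n : (\int[mu]_(r in `]0%R, +oo[) (v (r, n.+1%:R^-1) / r)%:E =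
   \int[mu]_(r in `]0%R, +oo[) (v (r, pi) / r)%:E)%E.
  rewrite -const// invr_gt0 ltr0n/= (@le_lt_trans _ _ 1)// ?invf_le1 ?ltr0n ?ler1n//.
  by rewrite (lt_le_trans _ (@pi_ge2 R))// ltr1n.
have cv := @dominated_convergence _ (measurableTypeR R) R mu `]0%R, +oo[%classic
  (measurable_itv _) (fun n r => (v (r, n.+1%:R^-1) / r)%:E) (cst 0%E)
  (fun r => (tail_dom C a b r / r)%:E)
  (fun n => measurable_int mu (iv _ (ti n))) (measurable_cst _).
have {cv}[] := cv.
(* Pointwise convergence holds off the null set {1} only. *)
- exists [set 1]; split; [exact: measurable_set1|exact: lebesgue_measure_set1|].
  move=> r /= /not_implyP[]; rewrite in_itv/= andbT => r0.
  apply: contra_notP => /eqP r1; apply: cvg_EFin; first exact: nearW.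
  rewrite -[X in _ --> X](mul0r r^-1); apply: cvgM; last exact: cvg_cst.
  exact: lim0.
- apply: (@tail_dom_integrable C a b) => //; first exact: measurable_tail_dom.
  by move=> r r0; rewrite ger0_norm// tail_dom_ge0.
- apply: aeW => r /= n; rewrite in_itv/= andbT => r0; rewrite lee_fin.
  rewrite normrM normfV (ger0_norm (ltW r0)) ler_wpM2r ?invr_ge0 ?(ltW r0)//.
  by have [] := bd r _ r0 (ti n).
move=> _ _; rewrite integral0.
under eq_fun do rewrite constn.
by move=> /(cvg_lim _) <-//; rewrite lim_cst.
Qed.

End rotation.

(** * The boundary values of 1/(m + z^b) on the negative half-line *)

Section stieltjes.
Context {R : realType}.
Notation mu := (@lebesgue_measure R).

Lemma integral_oy_ge (f : R -> \bar R) (a b c : R) : 0 < a < b -> 0 <= c ->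
  measurable_fun setT f -> (forall x, 0 < x -> (0 <= f x)%E) ->
  (forall x, a <= x <= b -> (c%:E <= f x)%E) ->
  ((c * (b - a))%:E <= \int[mu]_(x in `]0%R, +oo[) f x)%E.
Proof.
move=> /andP[a0 ab] c0 mf f0 fc.
apply: (@le_trans _ _ (\int[mu]_(x in `[a, b]) c%:E)%E).
  rewrite (integral_cst mu (measurable_itv `[a, b]) c%:E) /= lebesgue_measure_itv/=.
  by rewrite lte_fin ab -EFinB -EFinM.
have sub : `[a, b]%classic `<=` (`]0, +oo[%classic : set R).
  by move=> x; rewrite /= !in_itv/= andbT => /andP[ax _]; exact: lt_le_trans ax.
apply: (@le_trans _ _ (\int[mu]_(x in `[a, b]) f x)%E).
  by apply: ge0_le_integral => //; exact: measurable_funTS.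
apply: ge0_subset_integral => //.
- exact: measurable_funTS.
- by move=> x; rewrite /= in_itv/= andbT; exact: f0.
Qed.

Variable b : R.
Hypothesis b01 : 0 < b < 1.

Let b0 : 0 < b. Proof. by case/andP: b01. Qed.
Let b1 : b < 1. Proof. by case/andP: b01. Qed.

(** Minus the imaginary part of 1/(m + z^b) at z = r e^(i pi): the denominator is |m + r^b e^(i b
    pi)|^2. *)
Definition stieltjes_density (m r : R) : R :=
  r `^ b * sin (b * pi) /
  (m ^+ 2 + 2 * m * (r `^ b * cos (b * pi)) + (r `^ b) ^+ 2).

Let gap : R := 1 - `|cos (b * pi)|.

Let bpi : 0 < b * pi < pi.
Proof. by rewrite mulr_gt0 ?pi_gt0//= -[ltRHS]mul1r ltr_pM2r ?pi_gt0. Qed.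

Lemma sin_bpi_gt0 : 0 < sin (b * pi). Proof. exact: sin_gt0_pi. Qed.

Let gap_gt0 : 0 < gap.
Proof.
rewrite subr_gt0 lt_neqAle cos_max andbT norm_cos_eq1 gt_eqF//.
exact: sin_bpi_gt0.
Qed.

Let cos_b (t : R) : 0 <= t <= pi -> cos (b * pi) <= cos (b * t).
Proof.
move=> /andP[t0 tpi]; have /andP[bp0 bp1] := bpi.
rewrite le_eqVlt; have [->|tN] := eqVneq t pi; first by rewrite eqxx.
have I1 : b * pi \in `[0, pi] by rewrite in_itv/= (ltW bp0) (ltW bp1).
have I2 : b * t \in `[0, pi].
  rewrite in_itv/= mulr_ge0 ?(ltW b0)//= (le_trans _ (ltW bp1))//.
  by rewrite ler_pM2l.
apply/orP; right; rewrite (ltr_cos I2 I1).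
by rewrite ltr_pM2l// lt_neqAle tN.
Qed.

(** The argument bt stays in [0, b pi] with b < 1, so m + A e^(ibt) cannot cancel: cos(bt) >=
    -|cos(b pi)|, and 2mA <= m^2 + A^2. *)
Let den_ge (m A t : R) : 0 < m -> 0 <= A -> 0 <= t <= pi ->
  gap * (m ^+ 2 + A ^+ 2) <= (m + A * cos (b * t)) ^+ 2 + (A * sin (b * t)) ^+ 2.
Proof.
move=> m0 A0 tpi; have := cos_b tpi; set c := cos _; set c' := cos _ => cc.
have -> : (A * sin (b * t)) ^+ 2 = A ^+ 2 * (1 - c' ^+ 2).
  by rewrite exprMn sin2cos2.
rewrite /gap -/c; have cN : - `|c| <= c' by rewrite (le_trans _ cc)// lerNl ler_normr lexx orbT.
have H : - `|c| * (m ^+ 2 + A ^+ 2) <= 2 * m * A * c'.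
  apply: (@le_trans _ _ (2 * m * A * - `|c|)).
    have := mulr_ge0 (normr_ge0 c) (sqr_ge0 (m - A)); nra.
  by rewrite ler_wpM2l// !mulr_ge0// ltW.
nra.
Qed.

Lemma stieltjes_density_bounds (m : R) : 0 < m ->
  exists2 C : R, 0 < C & forall r, 0 < r ->
    C^-1 * (r `^ b / (m ^+ 2 + (r `^ b) ^+ 2)) <= stieltjes_density m r /\
    stieltjes_density m r <= C * (r `^ b / (m ^+ 2 + (r `^ b) ^+ 2)).
Proof.
move=> m0; have s0 := sin_bpi_gt0.
(* The first summand serves the upper bound, where sin <= 1; the second serves the lower one, since
   the inverse of the sum is at most sin(b pi)/2. *)
exists (gap^-1 + 2 / sin (b * pi)); first by rewrite addr_gt0 ?invr_gt0// divr_gt0.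
move=> r r0; rewrite /stieltjes_density.
have := powR_gt0 b r0; set A := r `^ b => A0.
have pipi : 0 <= (pi : R) <= pi by rewrite pi_ge0 lexx.
have := den_ge m0 (ltW A0) pipi.
have -> : (m + A * cos (b * pi)) ^+ 2 + (A * sin (b * pi)) ^+ 2 =
    m ^+ 2 + 2 * m * (A * cos (b * pi)) + A ^+ 2.
  by rewrite [(A * sin _) ^+ 2]exprMn sin2cos2; ring.
have : m ^+ 2 + 2 * m * (A * cos (b * pi)) + A ^+ 2 <= 2 * (m ^+ 2 + A ^+ 2).
  have := cos_le1 (b * pi); set c := cos _ => c1.
  have : m * A * c <= m * A by rewrite ler_piMr// ltW// mulr_gt0.
  have := sqr_ge0 (m - A); nra.
set Z := _ + _ + _ => Z2 gZ.
have Q0 : 0 < m ^+ 2 + A ^+ 2 by rewrite addr_gt0// exprn_gt0.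
have Z0 : 0 < Z by apply: lt_le_trans gZ; rewrite mulr_gt0.
set Q := m ^+ 2 + A ^+ 2 in Q0 Z2 gZ *; set s := sin _ in s0 *.
have QV0 : 0 < Q^-1 by rewrite invr_gt0.
have ZV0 : 0 < Z^-1 by rewrite invr_gt0.
have lo : Q^-1 <= 2 * Z^-1.
  by rewrite -ler_pdivrMl// -invfM lef_pV2 ?posrE ?mulr_gt0.
have hi : Z^-1 <= gap^-1 * Q^-1.
  by rewrite -invfM lef_pV2 ?posrE ?mulr_gt0.
have C2 : (gap^-1 + 2 / s)^-1 <= s / 2.
  rewrite -[leRHS]invrK lef_pV2 ?posrE ?invr_gt0 ?divr_gt0 ?addr_gt0 ?invr_gt0 ?divr_gt0//.
  by rewrite invf_div lerDr invr_ge0 ltW.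
have C1 : s * gap^-1 <= gap^-1 + 2 / s.
  apply: (@le_trans _ _ gap^-1).
    by rewrite ler_piMl ?invr_ge0 ?(ltW gap_gt0)// sin_le1.
  by rewrite lerDl divr_ge0// ltW.
split.
  apply: (@le_trans _ _ (s / 2 * (A / Q))).
    by rewrite ler_wpM2r// divr_ge0// ltW.
  have -> : s / 2 * (A / Q) = (A * s / 2) * Q^-1 by ring.
  have -> : A * s / Z = (A * s / 2) * (2 * Z^-1) by field; rewrite gt_eqF.
  by rewrite ler_wpM2l// divr_ge0// mulr_ge0// ltW.
apply: (@le_trans _ _ ((s * gap^-1) * (A / Q))).
  have -> : s * gap^-1 * (A / Q) = A * s * (gap^-1 * Q^-1) by ring.
  by rewrite ler_wpM2l// mulr_ge0// ltW.
by rewrite ler_wpM2r// divr_ge0// ltW.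
Qed.


Lemma polar_holo_ext (u v u' v' p q : R * R -> R) D :
  (forall z, u' z = u z) -> (forall z, v' z = v z) ->
  polar_holo u v p q D -> polar_holo u' v' p q D.
Proof. by move=> /funext -> /funext ->. Qed.

Section kernel.
Variable m : R.
Hypothesis m0 : 0 < m.

(** In complex terms [X c] + i [Y c] is z^c, [d1] is |z - 1|^2, [d2] is |m + z^b|^2, and [g1] + i
    [g2] is m(z - z^(1-b)) times the conjugate of z - 1. *)
Let X c (z : R * R) := z.1 `^ c * cos (c * z.2).
Let Y c (z : R * R) := z.1 `^ c * sin (c * z.2).
Let d1 z := (X 1 z + -1) ^+ 2 + (Y 1 z + 0) ^+ 2.
Let d2 z := (m + X b z) ^+ 2 + (0 + Y b z) ^+ 2.
Let g1 z := m * (X 1 z - X (1 - b) z) * (X 1 z - 1) +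
  m * (Y 1 z - Y (1 - b) z) * Y 1 z.
Let g2 z := m * (Y 1 z - Y (1 - b) z) * (X 1 z - 1) -
  m * (X 1 z - X (1 - b) z) * Y 1 z.
(* [m (z - z^(1-b)) / ((z - 1) (m + z^b))], which has no pole at [1]; at the
   angle [pi] its imaginary part is a difference of two Stieltjes densities *)
Let U z := (g1 z * (m + X b z) + g2 z * Y b z) * ((d1 z)^-1 * (d2 z)^-1).
Let V z := (g2 z * (m + X b z) - g1 z * Y b z) * ((d1 z)^-1 * (d2 z)^-1).

Let UV_holo : exists p q, forall E : set (R * R),
  (forall z, E z -> [/\ 0 < z.1, d1 z != 0 & d2 z != 0]) ->
  polar_holo U V p q E.
Proof.
eexists; eexists => E EP.
have E0 z : E z -> 0 < z.1 by case/EP.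
have h1 := polar_holo_pow 1 E0.
have h2 := polar_holo_pow (1 - b) E0.
have h3 := polar_holo_pow b E0.
have hn := polar_holoM (polar_holo_cst m E)
  (polar_holoD h1 (polar_holoM (polar_holo_cst (-1) E) h2)).
have hd1 := polar_holoV (polar_holoD h1 (polar_holo_cst (-1) E))
  (fun z Ez => let: And3 _ H _ := EP z Ez in H).
have hd2 := polar_holoV (polar_holoD (polar_holo_cst m E) h3)
  (fun z Ez => let: And3 _ _ H := EP z Ez in H).
have h := polar_holoM (polar_holoM hn hd1) hd2.
by apply: (polar_holo_ext _ _ h) => z;
  rewrite /U /V /g1 /g2 -/(d1 z) -/(d2 z) /X /Y;
  move: (d1 z)^-1 (d2 z)^-1 => i1 i2; ring.
Qed.

Let UV_norm z : U z ^+ 2 + V z ^+ 2 =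
  m ^+ 2 * ((X 1 z - X (1 - b) z) ^+ 2 + (Y 1 z - Y (1 - b) z) ^+ 2) *
  ((d1 z)^-1 * (d2 z)^-1).
Proof.
rewrite /U /V /g1 /g2.
have [d10|d10] := eqVneq (d1 z) 0; first by rewrite d10 invr0 !(mul0r, mulr0) expr0n addr0.
have [d20|d20] := eqVneq (d2 z) 0; first by rewrite d20 invr0 !(mul0r, mulr0) expr0n addr0.
have iE : (d1 z)^-1 * (d2 z)^-1 = (d1 z * d2 z) * ((d1 z)^-1 * (d2 z)^-1) ^+ 2.
  by field; rewrite d10 d20.
rewrite [X in _ = _ * X]iE; move: ((d1 z)^-1 * (d2 z)^-1) => i.
by rewrite /d1 /d2 !exprMn; ring.
Qed.

Let XY2 c z : X c z ^+ 2 + Y c z ^+ 2 = (z.1 `^ c) ^+ 2.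
Proof. by rewrite /X /Y !exprMn -mulrDr cos2Dsin2 mulr1. Qed.

Let d2_ge z : 0 < z.1 -> 0 <= z.2 <= pi ->
  gap * (m ^+ 2 + (z.1 `^ b) ^+ 2) <= d2 z.
Proof. by move=> z1 z2; rewrite /d2 /X /Y add0r; apply: den_ge => //; exact: powR_ge0. Qed.

Let d2_gt0 z : 0 < z.1 -> 0 <= z.2 <= pi -> 0 < d2 z.
Proof.
move=> z1 z2; apply: lt_le_trans (d2_ge z1 z2).
by rewrite mulr_gt0// addr_gt0// exprn_gt0// powR_gt0.
Qed.

Let d1E z : 0 < z.1 -> d1 z = (z.1 - 1) ^+ 2 + 2 * z.1 * (1 - cos z.2).
Proof.
move=> z1; rewrite /d1 /X /Y mul1r powRr1 ?(ltW z1)// addr0 [(_ * sin _) ^+ 2]exprMn.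
by rewrite sin2cos2; ring.
Qed.

(** z - z^(1-b) = z^(1-b) (z^b - 1), and the modulus of z^b - 1 is expanded around the circle. *)
Let numE z : 0 < z.1 -> (X 1 z - X (1 - b) z) ^+ 2 + (Y 1 z - Y (1 - b) z) ^+ 2 =
  (z.1 / z.1 `^ b) ^+ 2 *
    ((z.1 `^ b - 1) ^+ 2 + 2 * z.1 `^ b * (1 - cos (b * z.2))).
Proof.
move=> z1; have A0 := powR_gt0 b z1.
have -> : (X 1 z - X (1 - b) z) ^+ 2 + (Y 1 z - Y (1 - b) z) ^+ 2 =
   (X 1 z ^+ 2 + Y 1 z ^+ 2) + (X (1 - b) z ^+ 2 + Y (1 - b) z ^+ 2)
   - 2 * (X 1 z * X (1 - b) z + Y 1 z * Y (1 - b) z) by ring.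
rewrite !XY2.
have -> : X 1 z * X (1 - b) z + Y 1 z * Y (1 - b) z =
    z.1 `^ 1 * z.1 `^ (1 - b) * cos (b * z.2).
  rewrite /X /Y (_ : b * z.2 = 1 * z.2 - (1 - b) * z.2); last by ring.
  by rewrite cosB; ring.
have -> : z.1 `^ (1 - b) = z.1 / z.1 `^ b.
  by rewrite powRB ?(gt_eqF z1) ?implybT// powRr1// ltW.
by rewrite powRr1 ?(ltW z1)//; field; rewrite gt_eqF.
Qed.

Let cos_le (t : R) : 0 <= t <= pi -> cos t <= cos (b * t).
Proof.
move=> /andP[t0 tpi].
have [->|tN0] := eqVneq t 0; first by rewrite mulr0.
have tp : 0 < t by rewrite lt_neqAle eq_sym tN0.
have bt : b * t < t by rewrite -[ltRHS]mul1r ltr_pM2r.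
have I1 : t \in `[0, pi] by rewrite in_itv/= t0.
have I2 : b * t \in `[0, pi].
  by rewrite in_itv/= mulr_ge0 ?(ltW b0)//= (le_trans (ltW bt)).
by apply: ltW; rewrite (ltr_cos I2 I1).
Qed.

(** The zero of z^b - 1 at the point 1 compensates that of z - 1. The radial parts are compared
    through the position of r^b between r and 1, the angular parts through cos t <= cos(bt). *)
Let num_le z : 0 < z.1 -> 0 <= z.2 <= pi ->
  ((z.1 `^ b - 1) ^+ 2 + 2 * z.1 `^ b * (1 - cos (b * z.2))) <=
  (if z.1 <= 1 then z.1 `^ b / z.1 else 1) * d1 z.
Proof.
move=> z1 z2; rewrite d1E//; have := cos_le z2; have := cos_le1 (b * z.2).
move: (cos (b * z.2)) (cos z.2) => c' c cle1 cc'.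
have A0 := powR_gt0 b z1.
case: (leP z.1 1) => z11.
  have zA : z.1 <= z.1 `^ b by apply: ger1_powR; rewrite ?z1// ltW.
  have A1 : z.1 `^ b <= 1 by apply: powR_le1; rewrite // ltW.
  move: (z.1 `^ b) A0 zA A1 => A A0 zA A1.
  have -> : A / z.1 * ((z.1 - 1) ^+ 2 + 2 * z.1 * (1 - c)) =
     A / z.1 * (z.1 - 1) ^+ 2 + 2 * A * (1 - c) by field; rewrite gt_eqF.
  apply: lerD; last by rewrite ler_wpM2l ?lerB// mulr_ge0// ltW.
  apply: (@le_trans _ _ ((z.1 - 1) ^+ 2)).
    rewrite -[leLHS]sqrrN -[leRHS]sqrrN ler_sqr ?nnegrE ?opprB ?subr_ge0//.
    by rewrite lerB.
  rewrite -[leLHS]mul1r ler_wpM2r ?sqr_ge0//.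
  by rewrite ler_pdivlMr ?mul1r.
rewrite mul1r.
have zA : z.1 `^ b <= z.1 by apply: ler1_powR => //; rewrite ltW.
have A1 : 1 <= z.1 `^ b by apply: powR_ge1; rewrite ltW.
move: (z.1 `^ b) A0 zA A1 => A A0 zA A1.
apply: lerD; last by nra.
rewrite ler_sqr ?nnegrE ?subr_ge0//; last exact: ltW.
by rewrite lerD2r.
Qed.

Let d1_gt0 z : 0 < z.1 -> 0 <= z.2 <= pi -> z.1 != 1 \/ 0 < z.2 -> 0 < d1 z.
Proof.
move=> z1 z2 H; rewrite d1E//.
have [z10|z10] := eqVneq z.1 1; last first.
  rewrite ltr_wpDr//; first by rewrite mulr_ge0 ?subr_ge0 ?cos_le1// mulr_ge0// ltW.
  by rewrite lt_neqAle eq_sym sqr_ge0 andbT sqrf_eq0 subr_eq0.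
case: H => [|t0]; first by rewrite z10 eqxx.
rewrite ltr_wpDl ?sqr_ge0// mulr_gt0 ?mulr_gt0// subr_gt0 -cos0.
have I1 : z.2 \in `[0, pi] by rewrite in_itv/= z2.
have I2 : (0 : R) \in `[0, pi] by rewrite in_itv/= lexx pi_ge0.
by rewrite (ltr_cos I2 I1).
Qed.

(** Three ranges of the modulus r. For r <= 1 and for 1 < r <= 2, [num_le] controls |z^b - 1|/|z -
    1|. For r > 2 the point 1 is far away: |z - 1| >= r/2 and |z^b - 1| <= 2 r^b. The last two
    ranges give the 4 and the 16 m^2 of the constant. *)
Let UV_bound z : 0 < z.1 -> 0 < z.2 <= pi ->
  U z ^+ 2 + V z ^+ 2 <=
  (tail_dom (Num.sqrt ((4 + 16 * m ^+ 2) / gap)) ((1 - b) / 2) b z.1) ^+ 2.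
Proof.
move=> z1 z2; have z2' : 0 <= z.2 <= pi by case/andP: z2 => /ltW -> ->.
have P1 : 0 < d1 z by apply: d1_gt0 => //; right; case/andP: z2.
have P2 := d2_gt0 z1 z2'.
have dg := d2_ge z1 z2'; have nle := num_le z1 z2'.
rewrite UV_norm numE//; have A0 := powR_gt0 b z1.
have cg0 : 0 <= (4 + 16 * m ^+ 2) / gap.
  by rewrite divr_ge0 ?(ltW gap_gt0)// addr_ge0// mulr_ge0// sqr_ge0.
rewrite /tail_dom [leRHS]exprMn sqr_sqrtr//.
have Num4 : (z.1 `^ b - 1) ^+ 2 + 2 * z.1 `^ b * (1 - cos (b * z.2)) <=
    (z.1 `^ b + 1) ^+ 2.
  have := cos_geN1 (b * z.2); move: (cos _) => c cN; nra.
have numge0 : 0 <= (z.1 `^ b - 1) ^+ 2 + 2 * z.1 `^ b * (1 - cos (b * z.2)).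
  by rewrite addr_ge0 ?sqr_ge0// mulr_ge0 ?subr_ge0 ?cos_le1// mulr_ge0// ltW.
have d1r : (z.1 - 1) ^+ 2 <= d1 z.
  by rewrite d1E// lerDl mulr_ge0 ?subr_ge0 ?cos_le1// mulr_ge0// ltW.
have E1 : z.1 <= 1 -> (z.1 `^ ((1 - b) / 2)) ^+ 2 = z.1 / z.1 `^ b.
  move=> _; rewrite -powR_mulrn ?powR_ge0// -powRrM divfK//.
  by rewrite powRB ?(gt_eqF z1) ?implybT// powRr1// ltW.
have E2 : (z.1 `^ (- b)) ^+ 2 = (z.1 `^ b) ^- 2 by rewrite powRN exprVn.
have A1 : 1 < z.1 -> 1 <= z.1 `^ b by move=> h; apply: powR_ge1; rewrite ltW.
move: (_ + _ * (1 - cos _)) numge0 Num4 nle => N N0 N4 nle.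
move: (d1 z) (d2 z) P1 P2 dg d1r nle => x y x0 y0 yg xr nle.
move: (z.1 `^ b) A0 E1 E2 A1 N4 nle yg => A A0 E1 E2 A1 N4 nle yg.
move: gap gap_gt0 yg {cg0} => g g0 yg.
have yV : y^-1 <= (g * (m ^+ 2 + A ^+ 2))^-1.
  by rewrite lef_pV2 ?posrE// mulr_gt0// addr_gt0// exprn_gt0.
have yV1 : y^-1 <= (g * m ^+ 2)^-1.
  apply: (le_trans yV); rewrite lef_pV2 ?posrE ?mulr_gt0 ?addr_gt0 ?exprn_gt0//.
  by rewrite ler_wpM2l ?(ltW g0)// lerDl sqr_ge0.
have yV2 : y^-1 <= (g * A ^+ 2)^-1.
  apply: (le_trans yV); rewrite lef_pV2 ?posrE ?mulr_gt0 ?addr_gt0 ?exprn_gt0//.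
  by rewrite ler_wpM2l ?(ltW g0)// lerDr sqr_ge0.
have Vy0 : 0 <= y^-1 by rewrite invr_ge0 ltW.
have m2 : 0 <= m ^+ 2 by exact: sqr_ge0.
move: nle; case: (leP z.1 1) => z11.
  rewrite E1// => nle.
  have Nx : N / x <= A / z.1 by rewrite ler_pdivrMr.
  apply: (@le_trans _ _ (m ^+ 2 * (z.1 / A) ^+ 2 * (A / z.1) * (g * m ^+ 2)^-1)).
    have -> : m ^+ 2 * ((z.1 / A) ^+ 2 * N) * (x^-1 * y^-1) =
      m ^+ 2 * (z.1 / A) ^+ 2 * (N / x) * y^-1 by ring.
    apply: ler_pM => //; first by rewrite !mulr_ge0 ?invr_ge0// ?sqr_ge0// ltW.
    by rewrite ler_wpM2l// mulr_ge0// sqr_ge0.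
  have -> : m ^+ 2 * (z.1 / A) ^+ 2 * (A / z.1) * (g * m ^+ 2)^-1 =
    g^-1 * (z.1 / A) by field; rewrite !gt_eqF.
  rewrite ler_wpM2r ?divr_ge0 ?(ltW A0) ?(ltW z1)//.
  by rewrite ler_pdivlMr// mulVf ?gt_eqF//; nra.
rewrite mul1r E2 => nle; have {}A1 := A1 z11.
have [z12|z12] := leP z.1 2.
  have Nx : N / x <= 1 by rewrite ler_pdivrMr// mul1r.
  apply: (@le_trans _ _ (m ^+ 2 * (4 * A ^- 2) * 1 * (g * m ^+ 2)^-1)).
    have -> : m ^+ 2 * ((z.1 / A) ^+ 2 * N) * (x^-1 * y^-1) =
      m ^+ 2 * (z.1 ^+ 2 * A ^- 2) * (N / x) * y^-1 by field; rewrite !gt_eqF.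
    have V2 : 0 <= A ^- 2 by rewrite invr_ge0 sqr_ge0.
    have h1 : m ^+ 2 * (z.1 ^+ 2 * A ^- 2) <= m ^+ 2 * (4 * A ^- 2).
      rewrite ler_wpM2l// ler_wpM2r//; nra.
    have h2 : 0 <= m ^+ 2 * (z.1 ^+ 2 * A ^- 2).
      by rewrite mulr_ge0// mulr_ge0// sqr_ge0.
    have h3 : 0 <= N / x by rewrite divr_ge0// ltW.
    by apply: ler_pM => //; [exact: mulr_ge0|exact: ler_pM].
  have -> : m ^+ 2 * (4 * A ^- 2) * 1 * (g * m ^+ 2)^-1 = 4 / g * A ^- 2.
    by field; rewrite !gt_eqF.
  rewrite ler_wpM2r ?invr_ge0 ?sqr_ge0//.
  by rewrite ler_wpM2r ?invr_ge0 ?(ltW g0)// lerDl mulr_ge0.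
have N4' : N <= 4 * A ^+ 2 by apply: (le_trans N4); nra.
have xV : x^-1 <= 4 / z.1 ^+ 2.
  rewrite -[leRHS]invrK lef_pV2 ?posrE ?invr_gt0 ?divr_gt0 ?exprn_gt0//.
  by rewrite invf_div; apply: le_trans xr; rewrite ler_pdivrMr//; nra.
apply: (@le_trans _ _ (m ^+ 2 * (z.1 / A) ^+ 2 * (4 * A ^+ 2) *
    ((4 / z.1 ^+ 2) * (g * A ^+ 2)^-1))).
  have -> : m ^+ 2 * ((z.1 / A) ^+ 2 * N) * (x^-1 * y^-1) =
    m ^+ 2 * (z.1 / A) ^+ 2 * N * (x^-1 * y^-1) by ring.
  have h1 : 0 <= m ^+ 2 * (z.1 / A) ^+ 2 by rewrite mulr_ge0// sqr_ge0.
  have h2 : 0 <= x^-1 by rewrite invr_ge0 ltW.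
  by apply: ler_pM; [exact: mulr_ge0|exact: mulr_ge0|exact: ler_wpM2l|exact: ler_pM].
have -> : m ^+ 2 * (z.1 / A) ^+ 2 * (4 * A ^+ 2) *
    ((4 / z.1 ^+ 2) * (g * A ^+ 2)^-1) = 16 * m ^+ 2 / g * A ^- 2.
  by field; rewrite !gt_eqF.
rewrite ler_wpM2r ?invr_ge0 ?sqr_ge0//.
by rewrite ler_wpM2r ?invr_ge0 ?(ltW g0)// lerDr.
Qed.

Let V_pi r : 0 < r -> V (r, pi) / r =
  r `^ (- b) * sin (b * pi) / (r + 1) -
  (m + 1) * (stieltjes_density m r / (r + 1)).
Proof.
move=> r0; have A0 := powR_gt0 b r0.
rewrite /V /g1 /g2 /d1 /d2 /X /Y /stieltjes_density /= mul1r cospi sinpi.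
rewrite powRr1 ?(ltW r0)//.
have -> : r `^ (1 - b) = r / r `^ b.
  by rewrite powRB ?(gt_eqF r0) ?implybT// powRr1// ltW.
have -> : (1 - b) * pi = pi - b * pi by ring.
rewrite cosB sinB cospi sinpi powRN.
have : 0 < m ^+ 2 + 2 * m * (r `^ b * cos (b * pi)) + (r `^ b) ^+ 2.
  have -> : m ^+ 2 + 2 * m * (r `^ b * cos (b * pi)) + (r `^ b) ^+ 2 = d2 (r, pi).
    by rewrite /d2 /X /Y /= add0r [(_ * sin _) ^+ 2]exprMn sin2cos2; ring.
  by apply: d2_gt0 => //=; rewrite pi_ge0 lexx.
have -> : (m + r `^ b * cos (b * pi)) ^+ 2 + (0 + r `^ b * sin (b * pi)) ^+ 2 =
    m ^+ 2 + 2 * m * (r `^ b * cos (b * pi)) + (r `^ b) ^+ 2.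
  by rewrite add0r [(_ * sin _) ^+ 2]exprMn sin2cos2; ring.
move: (r `^ b) A0 (cos _) (sin _) => A A0 c s Z0.
field; rewrite (gt_eqF A0) (gt_eqF r0) (gt_eqF Z0) gt_eqF ?addr_gt0//=.
by rewrite lt_eqF//; lra.
Qed.

(** Rotation applied to the function with parts [U], [V]. On the positive axis off the point 1 it is
    real, so [V] tends to 0 there; at the angle pi, [V]/r is the integrand of the statement by
    [V_pi]. *)
Lemma integral_stieltjes_density1 :
  (\int[mu]_(r in `]0%R, +oo[)
     (r `^ (- b) * sin (b * pi) / (r + 1) -
      (m + 1) * (stieltjes_density m r / (r + 1)))%:E = 0)%E.
Proof.
have [p [q H]] := UV_holo.
have a0 : 0 < (1 - b) / 2 by rewrite divr_gt0// subr_gt0.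
have bd r t : 0 < r -> 0 < t <= pi ->
   `|U (r, t)| <= tail_dom (Num.sqrt ((4 + 16 * m ^+ 2) / gap)) ((1 - b) / 2) b r /\
   `|V (r, t)| <= tail_dom (Num.sqrt ((4 + 16 * m ^+ 2) / gap)) ((1 - b) / 2) b r.
  move=> r0 t0; have := @UV_bound (r, t) r0 t0.
  have := @tail_dom_ge0 R (Num.sqrt ((4 + 16 * m ^+ 2) / gap)) ((1 - b) / 2) b r
    (sqrtr_ge0 _).
  rewrite /=; move: (tail_dom _ _ _ _) => T T0 UV.
  by split; rewrite -ler_sqr ?nnegrE// real_normK ?num_real//;
    apply: le_trans UV; rewrite ?lerDl ?lerDr sqr_ge0.
have HD : polar_holo U V p q [set z | 0 < z.1 /\ 0 < z.2 <= pi].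
  apply: H => z [z1 /andP[z2 zpi]]; have zz : 0 <= z.2 <= pi by rewrite ltW.
  split => //; first by rewrite gt_eqF// d1_gt0//; right.
  by rewrite gt_eqF// d2_gt0.
have HE : polar_holo U V p q [set z | [/\ 0 < z.1, z.1 != 1 & 0 <= z.2 <= pi]].
  apply: H => z [z1 z11 zz]; split => //; first by rewrite gt_eqF// d1_gt0//; left.
  by rewrite gt_eqF// d2_gt0.
have cv r : 0 < r -> r != 1 -> V (r, n.+1%:R^-1) @[n --> \oo] --> (0 : R).
  move=> r0 r1; have z0 : [set z | [/\ 0 < z.1, z.1 != 1 & 0 <= z.2 <= pi]] (r, (0 : R)).
    by split => //=; rewrite lexx pi_ge0.
  have [_ [_ cV _ _]] := HE.2 _ z0.
  have V0 : V (r, 0) = 0.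
    by rewrite /V /g1 /g2 /X /Y /= !mulr0 sin0 !mulr0 subrr !mulr0 mul0r subrr !(mul0r, addr0, subr0, mulr0).
  have := continuous_pairl cV; rewrite /prop_for /continuous_at V0 => cV0.
  apply: (@cvg_comp _ _ _ (fun n : nat => (n.+1%:R^-1 : R)) (fun t => V (r, t)) _ _ _ _ cV0).
  exact: cvg_harmonic.
have := polar_rotation a0 b0 (sqrtr_ge0 _) HD bd cv.
move=> E; rewrite -[RHS]E; apply: eq_integral => r; rewrite inE/= in_itv/= andbT => r0.
by rewrite V_pi.
Qed.

End kernel.
End stieltjes.

(** * Gamma integrals and Laplace transforms of powers *)

Section gamma.
Context {R : realType}.
Notation mu := (@lebesgue_measure R).

Lemma measurable_gammaf (a s : R) :
  measurable_fun setT (fun u : R => u `^ (a - 1) * expR (- (s * u))).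
Proof.
apply: measurable_funM; first exact: measurable_powR.
by apply: measurableT_comp => //; apply: measurableT_comp => //; exact: measurable_funM.
Qed.

Lemma integrable_gammaf (a : R) : 0 < a ->
  mu.-integrable `]0, +oo[ (EFin \o (fun t : R => t `^ (a - 1) * expR (- t))).
Proof.
move=> a0.
have mf : measurable_fun setT (fun u : R => u `^ (a - 1) * expR (- u)).
  by have := measurable_gammaf a 1; under eq_fun do rewrite mul1r.
have p0 : 0 <= a + 1 by rewrite addr_ge0// ltW.
have [C C0 HC] := powR_le_expR p0 (@ltr01 R).
apply: (@integrable_oy R _ a 1 (1 + C)) => //.
- move=> u /andP[u0 u1]; rewrite ger0_norm ?mulr_ge0 ?powR_ge0 ?expR_ge0//.
  rewrite mulrC ler_wpM2r ?powR_ge0// (@le_trans _ _ 1)//.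
    by rewrite expR_le1 oppr_le0 ltW.
  by rewrite lerDl ltW.
- move=> u u1; have u0 : 0 < u by exact: lt_le_trans u1.
  rewrite ger0_norm ?mulr_ge0 ?powR_ge0 ?expR_ge0//.
  have -> : u `^ (a - 1) = u `^ (a + 1) * u `^ (-1 - 1).
    rewrite -powRD; last by rewrite (gt_eqF u0) implybT.
    by congr (_ `^ _); ring.
  rewrite mulrAC ler_wpM2r ?powR_ge0//.
  rewrite expRN ler_pdivrMr ?expR_gt0//.
  apply: le_trans (HC u (ltW u0)) _; rewrite mul1r.
  by rewrite ler_wpM2r ?expR_ge0// lerDr.
Qed.

Lemma integral_gammaf (a : R) : 0 < a ->
  (\int[mu]_(t in `]0%R, +oo[) (t `^ (a - 1) * expR (- t))%:E = (Gamma a)%:E)%E.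
Proof.
move=> a0; rewrite /Gamma /Rintegral fineK//.
exact: integrable_fin_num (integrable_gammaf a0).
Qed.

Lemma Gamma_gt0 (a : R) : 0 < a -> 0 < Gamma a.
Proof.
move=> a0; rewrite -lte_fin -integral_gammaf//.
have c0 : 0 < Num.min 1 (2 `^ (a - 1)) * expR (- 2 : R).
  by rewrite mulr_gt0 ?expR_gt0// lt_min ltr01/= powR_gt0.
apply: (@lt_le_trans _ _ (Num.min 1 (2 `^ (a - 1)) * expR (- 2) * (2 - 1))%:E).
  by rewrite lte_fin mulr_gt0// subr_gt0 ltr1n.
apply: integral_oy_ge.
- by rewrite ltr01 ltr1n.
- exact: ltW.
- apply/measurable_EFinP.
  by have := measurable_gammaf a 1; under eq_fun do rewrite mul1r.
- by move=> x _; rewrite lee_fin mulr_ge0 ?powR_ge0 ?expR_ge0.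
- move=> x /andP[x1 x2]; rewrite lee_fin; apply: ler_pM.
  + by rewrite le_min ler01 powR_ge0.
  + exact: expR_ge0.
  + have [a1|a1] := leP 1 a.
      by rewrite ge_min powR_ge1// subr_ge0.
    rewrite ge_min; apply/orP; right.
    have x0 : 0 < x by exact: lt_le_trans x1.
    rewrite -[leLHS]invrK -[leRHS]invrK lef_pV2 ?posrE ?invr_gt0 ?powR_gt0//.
    rewrite -!powRN opprB; apply: ge0_ler_powR => //; rewrite ?nnegrE ?subr_ge0 ?ltW//.
  + by rewrite ler_expR lerN2.
Qed.

Lemma integral_gamma_scale (a s : R) : 0 < a -> 0 < s ->
  (\int[mu]_(u in `]0%R, +oo[) (u `^ (a - 1) * expR (- (s * u)))%:E =
   (Gamma a / s `^ a)%:E)%E.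
Proof.
move=> a0 s0; have sV : 0 < s^-1 by rewrite invr_gt0.
rewrite (@ge0_integral_scale R s^-1)//; last 2 first.
- by apply/measurable_EFinP; exact: measurable_gammaf.
- by move=> u; rewrite lee_fin mulr_ge0 ?powR_ge0 ?expR_ge0.
have -> : (\int[mu]_(x in `]0%R, +oo[) ((s^-1 * x) `^ (a - 1) * expR (- (s * (s^-1 * x))))%:E =
    \int[mu]_(x in `]0%R, +oo[) ((s^-1 `^ (a - 1))%:E * (x `^ (a - 1) * expR (- x))%:E))%E.
  apply: eq_integral => x; rewrite inE/= in_itv/= andbT => x0.
  by rewrite -EFinM powRM ?(ltW sV) ?(ltW x0)// mulVKf ?gt_eqF// mulrA.
rewrite ge0_integralZl_EFin//; last 3 first.
- by move=> x _; rewrite lee_fin mulr_ge0 ?powR_ge0 ?expR_ge0.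
- apply/measurable_EFinP/measurable_funTS.
  by have := measurable_gammaf a 1; under eq_fun do rewrite mul1r.
- exact: powR_ge0.
rewrite integral_gammaf// -!EFinM; congr EFin.
rewrite mulrA mulrC; congr (_ * _).
rewrite mulr_powRB1 ?(ltW sV)//.
by rewrite -[s^-1](powR_inv1 (ltW s0)) -powRrM mulN1r powRN.
Qed.

Lemma integral_expRN (s : R) : 0 < s ->
  (\int[mu]_(u in `]0%R, +oo[) (expR (- (s * u)))%:E = (s^-1)%:E)%E.
Proof.
move=> s0.
have G1 : Gamma 1 = 1 :> R.
  rewrite /Gamma /Rintegral.
  have -> : (\int[mu]_(t in `]0%R, +oo[) (t `^ (1 - 1) * expR (- t))%:E =
      \int[mu]_(t in `[0%R, +oo[) (expR (- t))%:E)%E.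
    rewrite -integral_itv_obnd_cbnd//.
      by apply: eq_integral => t _; rewrite subrr powRr0 mul1r.
    apply/measurable_EFinP/measurable_funTS.
    by apply: measurableT_comp => //; exact: measurableT_comp.
  rewrite (@ge0_continuous_FTC2y _ _ (fun x => - expR (- x)) _ 0).
  - by rewrite oppr0 expR0 EFinN oppeK add0e.
  - by move=> x _; exact: expR_ge0.
  - apply: continuous_subspaceT => x; apply: (@continuous_comp _ _ _ (fun x => - x) expR).
      exact: continuousN.
    exact: continuous_expR.
  - by rewrite -[X in _ --> X]oppr0; apply: cvgN; exact: cvgr_expR.
  - move=> x _; exact: derivableN.
  - apply: cvg_at_right_filter; apply: cvgN.
    apply: (@continuous_comp _ _ _ (fun x => - x) expR); first exact: continuousN.
    exact: continuous_expR.
  - move=> x _; rewrite derive1E.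
    have d : is_derive x 1 (fun x : R => - expR (- x)) (expR (- x)).
      refine (is_derive_eq (is_deriveN1 (@is_derive1_comp _ expR -%R x _ _ (is_derive_expR _) (is_deriveNid _ _))) _).
      by rewrite mulrN1 opprK.
    by case: d.
have := integral_gamma_scale (@ltr01 R) s0.
rewrite G1 powRr1 ?(ltW s0)// mul1r => <-.
by apply: eq_integral => u _; rewrite subrr powRr0 mul1r.
Qed.

End gamma.

(** * The Stieltjes representation of 1/(m + s^b) *)

Section stieltjes_transform.
Context {R : realType}.
Notation mu := (@lebesgue_measure R).
Variable b : R.
Hypothesis b01 : 0 < b < 1.

Let b0 : 0 < b. Proof. by case/andP: b01. Qed.
Let b1 : b < 1. Proof. by case/andP: b01. Qed.

Lemma measurable_stieltjes_density (m : R) :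
  measurable_fun setT (stieltjes_density b m).
Proof.
apply: measurable_funM; first by apply: measurable_funM => //.
apply: measurable_funV; apply: measurable_funD; last exact: measurable_funX.
by apply: measurable_funD => //; apply: measurable_funM => //; apply: measurable_funM.
Qed.

Lemma stieltjes_density_le (m : R) : 0 < m ->
  exists2 C : R, 0 < C & forall r, 0 < r ->
    [/\ 0 <= stieltjes_density b m r, stieltjes_density b m r <= C * r `^ b &
        stieltjes_density b m r <= C * r `^ (- b)].
Proof.
move=> m0; have [C C0 HC] := stieltjes_density_bounds b01 m0.
exists (C * (1 + m ^- 2)).
  by rewrite mulr_gt0// addr_gt0// invr_gt0 exprn_gt0.
move=> r r0; have [lo hi] := HC r r0; have A0 := powR_gt0 b r0.
rewrite powRN; move: (r `^ b) A0 lo hi => A A0 lo hi.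
have m20 : 0 < m ^+ 2 by rewrite exprn_gt0.
have Q0 : 0 < m ^+ 2 + A ^+ 2 by rewrite addr_gt0// exprn_gt0.
split.
- by apply: le_trans lo; rewrite mulr_ge0 ?invr_ge0 ?divr_ge0// ltW.
- apply: (le_trans hi); rewrite -mulrA ler_wpM2l ?(ltW C0)//.
  rewrite mulrC ler_wpM2r ?(ltW A0)//.
  apply: (@le_trans _ _ (m ^- 2)); last by rewrite lerDr.
  by rewrite lef_pV2 ?posrE// lerDl sqr_ge0.
- apply: (le_trans hi); rewrite -mulrA ler_wpM2l ?(ltW C0)//.
  apply: (@le_trans _ _ A^-1).
    rewrite ler_pdivrMr//; have -> : A^-1 * (m ^+ 2 + A ^+ 2) = m ^+ 2 / A + A.
      by field; rewrite gt_eqF.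
    by rewrite lerDr divr_ge0// ltW.
  rewrite ler_peMl ?invr_ge0 ?(ltW A0)//.
  by rewrite lerDl invr_ge0 ltW.
Qed.

Let c0 : \bar R :=
  (\int[mu]_(r in `]0%R, +oo[) (r `^ (- b) * sin (b * pi) / (r + 1))%:E)%E.

Let s0 := sin_bpi_gt0 b01.

Let mV1 : measurable_fun setT (fun r : R => (r + 1)^-1).
Proof. by apply: measurable_funV; exact: measurable_funD. Qed.

Let mc0 : measurable_fun setT (fun r : R => r `^ (- b) * sin (b * pi) / (r + 1)).
Proof. by apply: measurable_funM => //; exact: measurable_funM. Qed.

Let inv1 (r : R) : 0 < r -> 0 < (r + 1)^-1 /\ (r + 1)^-1 <= 1 /\ (r + 1)^-1 <= r^-1.
Proof.
move=> r0; rewrite invr_gt0 addr_gt0//; split => //; split.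
  by rewrite invf_le1 ?addr_gt0// lerDr ltW.
by rewrite lef_pV2 ?posrE ?addr_gt0// lerDl.
Qed.

Let powRV (r : R) : 0 < r -> r `^ (- b) * r^-1 = r `^ (- b - 1).
Proof. by move=> r0; rewrite -[r^-1]powR_inv1 ?(ltW r0)// -powRD// (gt_eqF r0) implybT. Qed.

Let ic0 : mu.-integrable `]0, +oo[
  (EFin \o (fun r : R => r `^ (- b) * sin (b * pi) / (r + 1))).
Proof.
apply: (@integrable_oy R _ (1 - b) b 1) => //; first by rewrite subr_gt0.
- move=> r /andP[r0 r1]; have [i0 [i1 ir]] := inv1 r0.
  rewrite ger0_norm; last by rewrite mulr_ge0 ?(ltW i0)// mulr_ge0 ?powR_ge0// ltW.
  rewrite mul1r (_ : 1 - b - 1 = - b); last by ring.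
  rewrite -mulrA ler_piMr ?powR_ge0// mulr_ile1 ?(ltW i0) ?(ltW s0)// sin_le1.
- move=> r r1; have r0 : 0 < r by exact: lt_le_trans r1.
  have [i0 [i1 ir]] := inv1 r0.
  rewrite ger0_norm; last by rewrite mulr_ge0 ?(ltW i0)// mulr_ge0 ?powR_ge0// ltW.
  rewrite mul1r -powRV// -mulrA ler_wpM2l ?powR_ge0//.
  by apply: le_trans ir; rewrite ler_piMl ?(ltW i0)// sin_le1.
Qed.

Let id0 (m : R) : 0 < m -> mu.-integrable `]0, +oo[
  (EFin \o (fun r : R => stieltjes_density b m r / (r + 1))).
Proof.
move=> m0; have [C C0 HC] := stieltjes_density_le m0.
apply: (@integrable_oy R _ (1 - b) b C) => //; first by rewrite subr_gt0.
- by apply: measurable_funM => //; exact: measurable_stieltjes_density.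
- move=> r /andP[r0 r1]; have [i0 [i1 ir]] := inv1 r0.
  have [h0 h1 h2] := HC r r0.
  rewrite ger0_norm; last by rewrite mulr_ge0 ?(ltW i0).
  rewrite (_ : 1 - b - 1 = - b); last by ring.
  by apply: le_trans h2; rewrite ler_piMr.
- move=> r r1; have r0 : 0 < r by exact: lt_le_trans r1.
  have [i0 [i1 ir]] := inv1 r0.
  have [h0 h1 h2] := HC r r0.
  rewrite ger0_norm; last by rewrite mulr_ge0 ?(ltW i0).
  by rewrite -powRV// mulrA; apply: ler_pM => //; rewrite ltW.
Qed.

Let c0_gt0 : 0 < fine c0.
Proof.
rewrite -lte_fin fineK; last exact: integrable_fin_num ic0.
have h0 : 0 < 2 `^ (- b) * sin (b * pi) / (2 + 1).
  by rewrite divr_gt0 ?addr_gt0// mulr_gt0// powR_gt0.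
apply: (@lt_le_trans _ _ (2 `^ (- b) * sin (b * pi) / (2 + 1) * (2 - 1))%:E).
  by rewrite lte_fin mulr_gt0// subr_gt0 ltr1n.
apply: integral_oy_ge.
- by rewrite ltr01 ltr1n.
- exact: ltW.
- exact/measurable_EFinP.
- move=> r r0; have [i0 _] := inv1 r0.
  by rewrite lee_fin mulr_ge0 ?(ltW i0)// mulr_ge0 ?powR_ge0// ltW.
- move=> r /andP[r1 r2]; have r0 : 0 < r by exact: lt_le_trans r1.
  rewrite lee_fin; apply: ler_pM.
  + by rewrite mulr_ge0 ?powR_ge0// ltW.
  + by rewrite invr_ge0.
  + rewrite ler_wpM2r ?(ltW s0)// !powRN lef_pV2 ?posrE ?powR_gt0//.
    by apply: ge0_ler_powR => //; rewrite ?nnegrE ltW.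
  + by rewrite lef_pV2 ?posrE ?addr_gt0// lerD2r.
Qed.

(** The vanishing of the integral of a difference says that (m+1) times the left side is [c0], an
    integral in which m does not occur. *)
Let stieltjes1 (m : R) : 0 < m ->
  (\int[mu]_(r in `]0%R, +oo[) (stieltjes_density b m r / (r + 1))%:E =
   (fine c0 / (m + 1))%:E)%E.
Proof.
move=> m0; have := integral_stieltjes_density1 b01 m0.
have m1 : 0 < m + 1 by rewrite addr_gt0.
have iz : mu.-integrable `]0, +oo[
    (EFin \o (fun r => (m + 1) * (stieltjes_density b m r / (r + 1)))).
  by apply: integrableZl_EFin => //; exact: id0.
rewrite (@integralB_EFin _ _ _ _ _ _ _ _ ic0 iz)// -/c0.
under [X in (_ - X)%E]eq_integral do rewrite EFinM.
rewrite integralZl//; last exact: id0.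
have fi : ((\int[mu]_(r in `]0%R, +oo[) (stieltjes_density b m r / (r + 1))%:E)
  \is a fin_num)%E by exact: integrable_fin_num (id0 m0).
have f0 : c0 \is a fin_num by exact: integrable_fin_num ic0.
rewrite -(fineK fi) -[in X in X -> _](fineK f0).
move: (fine (integral _ _ _)) => I.
rewrite -EFinM -EFinB => /eqP; rewrite eqe subr_eq0 => /eqP ->.
by rewrite mulrAC divff ?mul1r// gt_eqF.
Qed.

(** The substitution r = s x reduces the case of s to s = 1 with m replaced by m/s^b. The constant
    is that of [stieltjes1], common to all m and s. *)
Lemma stieltjes_transform : exists2 c : R, 0 < c & forall m s : R,
  0 < m -> 0 < s ->
  (\int[mu]_(r in `]0%R, +oo[) (stieltjes_density b m r / (r + s))%:E =
   (c / (m + s `^ b))%:E)%E.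
Proof.
exists (fine c0) => // m s m0 s0'.
have [C C0 HC] := stieltjes_density_le m0.
pose f r := `|stieltjes_density b m r / (r + s)|.
have mf : measurable_fun setT f.
  apply: measurableT_comp => //; apply: measurable_funM.
    exact: measurable_stieltjes_density.
  by apply: measurable_funV; exact: measurable_funD.
have B0 := powR_gt0 b s0'; set B := s `^ b in B0 *.
have mB0 : 0 < m / B by rewrite divr_gt0.
have -> : (\int[mu]_(r in `]0%R, +oo[) (stieltjes_density b m r / (r + s))%:E =
   \int[mu]_(r in `]0%R, +oo[) (f r)%:E)%E.
  apply: eq_integral => r; rewrite inE/= in_itv/= andbT => r0.
  have [h0 _ _] := HC r r0.
  by rewrite /f ger0_norm// divr_ge0// addr_ge0// ltW.
rewrite (ge0_integral_scale s0'); [|exact/measurable_EFinP|by move=> r; rewrite lee_fin normr_ge0].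
have -> : (\int[mu]_(x in `]0%R, +oo[) (f (s * x))%:E =
    \int[mu]_(x in `]0%R, +oo[) ((s^-1 * B^-1)%:E * (stieltjes_density b (m / B) x / (x + 1))%:E))%E.
  apply: eq_integral => r; rewrite inE/= in_itv/= andbT => r0.
  have [h0 _ _] := HC (s * r) (mulr_gt0 s0' r0).
  have sr : 0 < s * r + s by rewrite addr_gt0// mulr_gt0.
  rewrite /f ger0_norm; last by rewrite divr_ge0// ltW.
  rewrite -EFinM; congr EFin.
  rewrite /stieltjes_density powRM ?(ltW s0') ?(ltW r0)// -/B.
  have A0 := powR_gt0 b r0; set A := r `^ b in A0 *.
  have -> : m ^+ 2 + 2 * m * (B * A * cos (b * pi)) + (B * A) ^+ 2 =
    B ^+ 2 * ((m / B) ^+ 2 + 2 * (m / B) * (A * cos (b * pi)) + A ^+ 2).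
    by field; rewrite gt_eqF.
  have -> : s * r + s = s * (r + 1) by ring.
  move: (_ + A ^+ 2) => Z.
  have [->|Z0] := eqVneq Z 0; first by rewrite mulr0 invr0 !(mulr0, mul0r).
  by field; rewrite Z0 !gt_eqF// addr_gt0.
have [C' C'0 HC'] := stieltjes_density_le mB0.
rewrite ge0_integralZl_EFin//; last 3 first.
- move=> r; rewrite /= in_itv/= andbT => r0; have [h0 _ _] := HC' r r0.
  by rewrite lee_fin divr_ge0// addr_ge0// ltW.
- apply/measurable_EFinP/measurable_funTS; apply: measurable_funM => //.
  exact: measurable_stieltjes_density.
- by rewrite mulr_ge0// invr_ge0 ltW.
rewrite stieltjes1// -!EFinM; congr EFin.
by field; rewrite !gt_eqF// ?addr_gt0.
Qed.

End stieltjes_transform.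

(** * The potential density for lambda > m *)

Section kappa.
Context {R : realType}.
Notation mu := (@lebesgue_measure R).

(* comparable with [u `^ (b - 1) * min 1 (u `^ (- 2 * b))] *)
Definition kappa (b u : R) : R :=
  if u <= 1 then u `^ (b - 1) else u `^ (- b - 1).

Lemma kappa_ge0 (b u : R) : 0 <= kappa b u.
Proof. by rewrite /kappa; case: ifP => _; exact: powR_ge0. Qed.

Lemma measurable_kappa (b : R) : measurable_fun setT (kappa b).
Proof. by apply: measurable_fun_ifT => //; exact: measurable_fun_ler. Qed.

Lemma measurable_section_integral (f : R * R -> R) (D : set R) : measurable D ->
  measurable_fun setT f -> (forall z, 0 <= f z) ->
  measurable_fun setT (fun x => (\int[mu]_(y in D) (f (x, y))%:E)%E).
Proof.
move=> mD mf f0.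
rewrite (_ : (fun x => _) = (fun x => \int[mu]_y (f (x, y) * \1_D y)%:E)%E).
  apply: (@measurable_fun_fubini_tonelli_F _ _ _ _ _ mu
    (fun z => (f z * \1_D z.2)%:E)).
    apply/measurable_EFinP; apply: measurable_funM => //.
    have mi : measurable_fun [set: R] (\1_D : R -> R) by exact: measurable_indic.
    exact: (measurableT_comp mi measurable_snd).
  by move=> z; rewrite lee_fin mulr_ge0.
apply/funext => x; rewrite integral_mkcond.
by under eq_integral do rewrite (patch_mul_indic D (fun t => f (x, t))).
Qed.

(** With n = l - m, 1/(n + (s+M)^b) is a superposition of the functions 1/(r + s + M), each of which
    is the integral of e^(-u(r+s+M)) in u. Tonelli then gives g(u) = e^(-Mu) L(u)/c with L the
    Laplace transform of the Stieltjes density. That density is of order r^b near 0 and r^(-b) at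
    infinity, whence the two powers in [kappa]. *)
Lemma resolvent_density_gt (b m l : R) : 0 < b < 1 -> 0 <= m -> m < l ->
  exists g : R -> R, [/\ measurable_fun setT g, forall u, 0 <= g u,
    forall s, 0 < s -> (\int[mu]_(u in `]0%R, +oo[) (g u * expR (- (s * u)))%:E =
      ((l + ((s + m `^ b^-1) `^ b - m))^-1)%:E)%E,
    exists2 c, 0 < c & forall u, 0 < u ->
      c * expR (- (m `^ b^-1 * u)) * kappa b u <= g u &
    exists2 C, 0 < C & forall u, 0 < u ->
      g u <= C * expR (- (m `^ b^-1 * u)) * kappa b u].
Proof.
move=> b01 m0 ml; have /andP[b0 b1] := b01.
set M := m `^ _; have M0 : 0 <= M by exact: powR_ge0.
have m'0 : 0 < l - m by rewrite subr_gt0.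
move: (l - m) m'0 (esym (subrK m l)) => n n0 ->.
have [c c0 Hc] := stieltjes_transform b01.
have [C C0 HC] := stieltjes_density_le b01 n0.
have [D D0 HD] := stieltjes_density_bounds b01 n0.
(* The absolute value changes nothing for r > 0 and makes [w] nonnegative everywhere, as Tonelli
   requires. *)
pose w r := `|stieltjes_density b n r|.
have mw : measurable_fun setT w.
  by apply: measurableT_comp => //; exact: measurable_stieltjes_density.
have w0 r : 0 <= w r by exact: normr_ge0.
have wE r : 0 < r -> w r = stieltjes_density b n r.
  by move=> r0; rewrite /w ger0_norm//; have [] := HC r r0.
pose L u := (\int[mu]_(r in `]0%R, +oo[) (w r * expR (- (u * r)))%:E)%E.
have mk2 : measurable_fun setT (fun z : R * R => w z.2 * expR (- (z.1 * z.2))).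
  apply: measurable_funM; first exact: (measurableT_comp mw measurable_snd).
  by apply: measurableT_comp => //; apply: measurableT_comp => //; exact: measurable_funM.
have mk2s u : measurable_fun setT (fun r => w r * expR (- (u * r))).
  exact: (measurableT_comp mk2 (measurable_pair1 u)).
have mL : measurable_fun setT L.
  apply: (@measurable_section_integral (fun z => w z.2 * expR (- (z.1 * z.2)))) => //.
  by move=> z; rewrite mulr_ge0 ?expR_ge0.
have L0 u : (0 <= L u)%E by apply: integral_ge0 => r _; rewrite lee_fin mulr_ge0 ?expR_ge0.
(* A power bound on the density turns L into a Gamma integral; it is used with p = -b, sharp for
   small u, and p = b, sharp for large u. *)
have gam (p u : R) : -1 < p -> 0 < u ->
   (forall r, 0 < r -> w r <= C * r `^ p) ->
   (L u <= (C * (Gamma (p + 1) / u `^ (p + 1)))%:E)%E.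
  move=> p1 u0 wp.
  have mg0 : measurable_fun setT (fun r : R => r `^ p * expR (- (u * r))).
    by have := measurable_gammaf (p + 1) u; rewrite addrK.
  have mg : measurable_fun setT (fun r : R => C * (r `^ p * expR (- (u * r)))).
    exact: measurable_funM.
  rewrite EFinM -integral_gamma_scale//; last by rewrite -ltrBlDr sub0r.
  rewrite addrK -ge0_integralZl_EFin//; last 3 first.
  - by move=> r _; rewrite lee_fin mulr_ge0 ?powR_ge0 ?expR_ge0.
  - apply/measurable_EFinP/measurable_funTS.
    exact: mg0.
  - exact: ltW.
  under [leRHS]eq_integral do rewrite -EFinM.
  apply: ge0_le_integral_EFin; [by []|exact: mk2s|exact: mg| |].
  - by move=> r _; rewrite mulr_ge0 ?expR_ge0.
  - move=> r; rewrite /= in_itv/= andbT => r0.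
    by rewrite mulrA ler_wpM2r ?expR_ge0// wp.
have Lup1 u : 0 < u -> (L u <= (C * (Gamma (1 - b) * u `^ (b - 1)))%:E)%E.
  move=> u0; have := @gam (- b) u.
  rewrite (_ : - b + 1 = 1 - b); last by ring.
  rewrite -powRN opprB; apply => //; first by rewrite ltrN2.
  by move=> r r0; rewrite wE//; have [] := HC r r0.
have Lup2 u : 0 < u -> (L u <= (C * (Gamma (b + 1) * u `^ (- b - 1)))%:E)%E.
  move=> u0; have := @gam b u.
  rewrite -powRN opprD; apply => //; first by rewrite (lt_trans _ b0)// ltrN10.
  by move=> r r0; rewrite wE//; have [] := HC r r0.
have Lfin u : 0 < u -> L u \is a fin_num.
  by move=> u0; rewrite ge0_fin_numE// (le_lt_trans (Lup1 u u0))// ltry.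
pose k u := c^-1 * fine (L u).
have k0 u : 0 <= k u by rewrite mulr_ge0 ?invr_ge0 ?(ltW c0)// fine_ge0.
exists (fun u => expR (- (M * u)) * k u); split.
- apply: measurable_funM.
    by apply: measurableT_comp => //; apply: measurableT_comp => //; exact: measurable_funM.
  by apply: measurable_funM => //; apply: (measurableT_comp _ mL); exact: fine_measurable.
- by move=> u; rewrite mulr_ge0 ?expR_ge0.
- move=> s s0; have sM : 0 < s + M by rewrite ltr_wpDr.
  transitivity (\int[mu]_(u in `]0%R, +oo[) ((c^-1)%:E *
     \int[mu]_(r in `]0%R, +oo[) (w r * expR (- (u * (r + (s + M)))))%:E))%E.
    apply: eq_integral => u; rewrite inE/= in_itv/= andbT => u0.
    have -> : (\int[mu]_(r in `]0%R, +oo[) (w r * expR (- (u * (r + (s + M)))))%:E =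
        (expR (- ((s + M) * u)))%:E * L u)%E.
      rewrite -ge0_integralZl_EFin//.
      - apply: eq_integral => r _; rewrite -EFinM; congr EFin.
        by rewrite mulrCA -expRD; congr (_ * expR _); ring.
      - by move=> r _; rewrite lee_fin mulr_ge0 ?expR_ge0.
      - by apply/measurable_EFinP/measurable_funTS; exact: mk2s.
    rewrite -(fineK (Lfin u u0)) -!EFinM /k; congr EFin.
    have -> : expR (- ((s + M) * u)) = expR (- (M * u)) * expR (- (s * u)).
      by rewrite -expRD; congr expR; ring.
    by ring.
  have mk3 : measurable_fun setT (fun z : R * R => w z.2 * expR (- (z.1 * (z.2 + (s + M))))).
    apply: measurable_funM; first exact: (measurableT_comp mw measurable_snd).
    apply: measurableT_comp => //; apply: measurableT_comp => //; apply: measurable_funM => //.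
    exact: measurable_funD.
  rewrite ge0_integralZl_EFin//; last 3 first.
  - by move=> u _; apply: integral_ge0 => r _; rewrite lee_fin mulr_ge0 ?expR_ge0.
  - apply: measurable_funTS.
    apply: (@measurable_section_integral (fun z => w z.2 * expR (- (z.1 * (z.2 + (s + M)))))) => //.
    by move=> z; rewrite mulr_ge0 ?expR_ge0.
  - by rewrite invr_ge0 ltW.
  rewrite (tonelli_on mu mu (measurable_itv _) (measurable_itv _)
    (f := fun z => w z.2 * expR (- (z.1 * (z.2 + (s + M))))))//=; last first.
    by move=> z; rewrite mulr_ge0 ?expR_ge0.
  transitivity ((c^-1)%:E * \int[mu]_(r in `]0%R, +oo[)
      (stieltjes_density b n r / (r + (s + M)))%:E)%E.
    congr (_ * _)%E; apply: eq_integral => r; rewrite inE/= in_itv/= andbT => r0.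
    under eq_integral do rewrite EFinM.
    have rs : 0 < r + (s + M) by rewrite addr_gt0.
    rewrite ge0_integralZl_EFin//.
    + under eq_integral do rewrite mulrC.
      by rewrite integral_expRN// -EFinM wE.
    + apply/measurable_EFinP/measurable_funTS.
      by apply: measurableT_comp => //; apply: measurableT_comp => //; exact: measurable_funM.
  rewrite Hc// -EFinM mulrA mulVf ?gt_eqF// mul1r; congr (_^-1)%:E.
  by ring.
(* The lower bound keeps only r in [1/(2u), 1/u]: there e^(-ur) >= e^(-1), and the density is at
   least a constant times [t], where [kappa b u] = [t]/u. *)
- pose q := 2 `^ (- b) / (4 * n ^+ 2 + 1).
  have n20 : 0 < n ^+ 2 by rewrite exprn_gt0.
  have q0 : 0 < q by rewrite divr_gt0 ?powR_gt0// addr_gt0// mulr_gt0.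
  pose K := D^-1 * q * expR (- 1).
  have K0 : 0 < K.
    by apply: mulr_gt0; [apply: mulr_gt0 => //; rewrite invr_gt0|exact: expR_gt0].
  exists (c^-1 * (K / 2)) => [|u u0].
    by apply: mulr_gt0; [rewrite invr_gt0|exact: divr_gt0].
  rewrite mulrAC [leRHS]mulrC ler_wpM2r ?expR_ge0// /k -mulrA ler_wpM2l ?invr_ge0 ?(ltW c0)//.
  rewrite -lee_fin fineK ?Lfin//.
  pose t := if u <= 1 then u `^ b else u `^ (- b).
  have t0 : 0 < t by rewrite /t; case: ifP => _; exact: powR_gt0.
  have uV : 0 < u^-1 by rewrite invr_gt0.
  have -> : K / 2 * kappa b u = K * t * (u^-1 - u^-1 / 2).
    have -> : kappa b u = t / u.
      rewrite /kappa /t -[u^-1]powR_inv1 ?(ltW u0)//.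
      by case: ifP => _; rewrite -powRD// (gt_eqF u0) implybT.
    by field; rewrite gt_eqF.
  apply: integral_oy_ge.
  - by rewrite divr_gt0//= ltr_pdivrMr// ltr_pMr// ltr1n.
  - by rewrite ltW// mulr_gt0.
  - by apply/measurable_EFinP; exact: mk2s.
  - by move=> r r0; rewrite lee_fin mulr_ge0 ?expR_ge0.
  - move=> r /andP[r1 r2]; have r0 : 0 < r by apply: lt_le_trans r1; rewrite divr_gt0.
    rewrite lee_fin (wE _ r0) (_ : K * t = D^-1 * (q * t) * expR (- 1)); last by rewrite /K; ring.
    apply: ler_pM.
    + by rewrite mulr_ge0 ?invr_ge0 ?(ltW D0)// mulr_ge0// ltW.
    + exact: expR_ge0.
    + have [lo _] := HD r r0; apply: le_trans lo.
      rewrite ler_wpM2l ?invr_ge0 ?(ltW D0)//.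
      have A0 := powR_gt0 b r0; have Q0 : 0 < n ^+ 2 + (r `^ b) ^+ 2.
        by rewrite addr_gt0// exprn_gt0.
      have E : 2 `^ (- b) = 2^-1 `^ b :> R.
        by rewrite -[2^-1]powR_inv1// -powRrM mulN1r.
      have T0 : 0 < 2 `^ (- b) :> R by exact: powR_gt0.
      have T1 : 2 `^ (- b) <= 1 :> R.
        by rewrite E; apply: powR_le1; rewrite ?invr_ge0 ?invf_le1 ?(ltW b0)// ler1n.
      rewrite ler_pdivlMr// (_ : q * t * _ = 2 `^ (- b) * t *
        (n ^+ 2 + (r `^ b) ^+ 2) / (4 * n ^+ 2 + 1)); last by rewrite /q; ring.
      rewrite ler_pdivrMr; last by rewrite addr_gt0// mulr_gt0.
      rewrite /t; case: (leP u 1) => u1.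
      * have Au : r `^ b * u `^ b <= 1.
          rewrite -powRM ?(ltW r0) ?(ltW u0)//.
          apply: powR_le1; rewrite ?mulr_ge0 ?(ltW r0) ?(ltW u0) ?(ltW b0)//.
          by rewrite -ler_pdivlMr// mul1r.
        have TA : 2 `^ (- b) <= r `^ b.
          rewrite E; apply: ge0_ler_powR; rewrite ?nnegrE ?invr_ge0 ?(ltW r0) ?(ltW b0)//.
          by apply: le_trans r1; rewrite ler_peMl ?invr_ge0// invf_ge1.
        have T2 : 2^-1 <= 2 `^ (- b) :> R.
          rewrite powRN lef_pV2 ?posrE ?powR_gt0//.
          by apply: ler1_powR; rewrite ?ler1n// ltW.
        have B0 := powR_gt0 b u0.
        move: (r `^ b) (u `^ b) (2 `^ (- b)) Au TA T2 A0 B0 T0 T1 {Q0 E} => A B T AB TA T2 A0 B0 T0 T1.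
        have TB : T * B <= 4 * A.
          rewrite -(ler_pM2r A0); apply: (@le_trans _ _ T); last by nra.
          by rewrite -mulrA ler_piMr ?(ltW T0)// mulrC.
        have h1 : T * B * n ^+ 2 <= 4 * A * n ^+ 2 by rewrite ler_wpM2r// ltW.
        have h2 : T * B * A ^+ 2 <= A.
          have -> : T * B * A ^+ 2 = T * (A * B) * A by ring.
          rewrite ler_piMl ?(ltW A0)// mulr_ile1 ?(ltW T0) ?mulr_ge0 ?(ltW A0) ?(ltW B0)//.
        by rewrite mulrDr; lra.
      * have B0 := powR_gt0 (- b) u0.
        have B1 : u `^ (- b) <= 1.
          by rewrite powRN invf_le1 ?powR_gt0//; apply: powR_ge1; rewrite ltW.
        have EB : u `^ (- b) = u^-1 `^ b by rewrite -[u^-1](powR_inv1 (ltW u0)) -powRrM mulN1r.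
        have AB : r `^ b <= u `^ (- b).
          by rewrite EB; apply: ge0_ler_powR; rewrite ?nnegrE ?(ltW r0) ?(ltW b0) ?(ltW uV).
        have TA : 2 `^ (- b) * u `^ (- b) <= r `^ b.
          rewrite E EB -powRM ?invr_ge0 ?(ltW u0)//.
          apply: ge0_ler_powR; rewrite ?nnegrE ?mulr_ge0 ?invr_ge0 ?(ltW r0) ?(ltW b0) ?(ltW u0)//.
          by rewrite mulrC.
        move: (r `^ b) (u `^ (- b)) (2 `^ (- b)) AB TA A0 B0 T0 T1 B1 {Q0 E EB} => A B T AB TA A0 B0 T0 T1 B1.
        have h1 : T * B * (n ^+ 2 + A ^+ 2) <= A * (n ^+ 2 + A ^+ 2).
          by rewrite ler_wpM2r// addr_ge0 ?sqr_ge0.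
        apply: (le_trans h1); rewrite ler_wpM2l ?(ltW A0)//; nra.
    + rewrite ler_expR lerN2.
      by rewrite mulrC -ler_pdivlMr// div1r.
- exists (c^-1 * (C * (Gamma (1 - b) + Gamma (b + 1)))) => [|u u0].
    by rewrite !mulr_gt0 ?invr_gt0// addr_gt0// Gamma_gt0// ?subr_gt0// addr_gt0.
  rewrite mulrAC [leLHS]mulrC ler_wpM2r ?expR_ge0// /k -mulrA ler_wpM2l ?invr_ge0 ?(ltW c0)//.
  rewrite -lee_fin fineK ?Lfin// /kappa.
  have G1 : 0 <= Gamma (1 - b) by rewrite ltW// Gamma_gt0// subr_gt0.
  have G2 : 0 <= Gamma (b + 1) by rewrite ltW// Gamma_gt0// addr_gt0.
  case: ifP => _.
    apply: (le_trans (Lup1 u u0)); rewrite lee_fin -mulrA ler_wpM2l ?(ltW C0)//.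
    by rewrite ler_wpM2r ?powR_ge0// lerDl.
  apply: (le_trans (Lup2 u u0)); rewrite lee_fin -mulrA ler_wpM2l ?(ltW C0)//.
  by rewrite ler_wpM2r ?powR_ge0// lerDr.
Qed.

End kappa.

(** * The potential density for lambda <= m, and both cases together *)

Section resolvent_density.
Context {R : realType}.
Notation mu := (@lebesgue_measure R).

(** Keep only [z, z+1] in the Gamma integral: the power there is at least the smaller of its two end
    values, and each of these is at least z^a/(z+1). The bound is uniform in a, which makes a series
    with a = b(n+1) geometric. *)
Lemma powR_div_Gamma_le (a z : R) : 0 < a -> 0 < z ->
  z `^ a / Gamma a <= (z + 1) * expR (z + 1).
Proof.
move=> a0 z0; have z10 : 0 < z + 1 by rewrite addr_gt0.
rewrite ler_pdivrMr ?Gamma_gt0//.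
pose c := Num.min (z `^ (a - 1)) ((z + 1) `^ (a - 1)) * expR (- (z + 1)).
have c0 : 0 < c by rewrite mulr_gt0 ?expR_gt0// lt_min !powR_gt0.
have cG : c <= Gamma a.
  rewrite -lee_fin -integral_gammaf//.
  rewrite (_ : c = c * (z + 1 - z)); last by ring.
  apply: integral_oy_ge.
  - by rewrite z0 ltrDl ltr01.
  - exact: ltW.
  - apply/measurable_EFinP.
    by have := measurable_gammaf a 1; under eq_fun do rewrite mul1r.
  - by move=> x _; rewrite lee_fin mulr_ge0 ?powR_ge0 ?expR_ge0.
  - move=> x /andP[x1 x2]; have x0 : 0 < x by exact: lt_le_trans x1.
    rewrite lee_fin; apply: ler_pM.
    + by rewrite le_min !powR_ge0.
    + exact: expR_ge0.
    + rewrite ge_min; have [a1|a1] := leP 1 a.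
        apply/orP; left; apply: ge0_ler_powR; rewrite ?nnegrE ?subr_ge0//; exact: ltW.
      apply/orP; right.
      rewrite -[leLHS]invrK -[leRHS]invrK lef_pV2 ?posrE ?invr_gt0 ?powR_gt0//.
      rewrite -!powRN opprB; apply: ge0_ler_powR; rewrite ?nnegrE ?subr_ge0//; exact: ltW.
    + by rewrite ler_expR lerN2.
apply: (@le_trans _ _ ((z + 1) * expR (z + 1) * c)); last first.
  by rewrite ler_wpM2l// mulr_ge0 ?expR_ge0// ltW.
have -> : (z + 1) * expR (z + 1) * c =
    (z + 1) * Num.min (z `^ (a - 1)) ((z + 1) `^ (a - 1)) * (expR (z + 1) * expR (- (z + 1))).
  by rewrite /c; ring.
rewrite expRxMexpNx_1 mulr1 mulrC -ler_pdivrMr// le_min; apply/andP; split.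
  rewrite ler_pdivrMr// -(mulr_powRB1 (ltW z0) a0) mulrC.
  by rewrite ler_wpM2l ?powR_ge0// lerDl.
rewrite ler_pdivrMr// mulrC mulr_powRB1 ?(ltW z10)//.
apply: ge0_ler_powR; rewrite ?nnegrE ?lerDl//; exact: ltW.
Qed.

Lemma nneseries_geometric (a q : R) : 0 <= a -> 0 <= q < 1 ->
  (\sum_(n <oo) (a * q ^+ n)%:E = (a / (1 - q))%:E)%E.
Proof.
move=> a0 /andP[q0 q1]; apply/cvg_lim => //.
have -> : (fun n => \sum_(0 <= i < n) (a * q ^+ i)%:E)%E =
    EFin \o series (geometric a q).
  by apply/funext => n /=; rewrite /series/= sumEFin.
apply: cvg_EFin; first exact: nearW.
by apply: cvg_geometric_series; rewrite ger0_norm.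
Qed.

Lemma kappa_le (b u : R) : 0 < b -> kappa b u <= u `^ (b - 1).
Proof.
move=> b0; rewrite /kappa; case: (leP u 1) => // u1.
by apply: (ler_powR (ltW u1)); lra.
Qed.

(** With n' = m - l in [0, m[, expand 1/((s+M)^b - n') as the series of n'^k (s+M)^(-b(k+1)) and
    write each negative power as a Gamma integral. Summing under the integral gives g(u) = e^(-Mu)
    times the series of n'^k u^(b(k+1)-1)/Gamma(b(k+1)). It grows more slowly than e^(Mu), because
    n' < M^b. *)
Lemma resolvent_density_le (b m l : R) : 0 < b < 1 -> 0 < l <= m ->
  exists g : R -> R, [/\ measurable_fun setT g, forall u, 0 <= g u,
    forall s, 0 < s -> (\int[mu]_(u in `]0%R, +oo[) (g u * expR (- (s * u)))%:E =
      ((l + ((s + m `^ b^-1) `^ b - m))^-1)%:E)%E,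
    exists2 c, 0 < c & forall u, 0 < u ->
      c * expR (- (m `^ b^-1 * u)) * kappa b u <= g u &
    exists2 C, 0 < C & forall u, 0 < u -> g u <= C * kappa b u].
Proof.
move=> /andP[b0 b1] /andP[l0 lm]; have m0 : 0 < m by exact: lt_le_trans lm.
have Mb : (m `^ b^-1) `^ b = m by rewrite -powRrM mulVf ?gt_eqF// powRr1// ltW.
have M0 : 0 < m `^ b^-1 by exact: powR_gt0.
move: (m `^ b^-1) M0 Mb => M M0 Mb.
pose n' := m - l; have n0 : 0 <= n' by rewrite subr_ge0.
have nm : n' < m by rewrite ltrBlDr ltrDl.
pose e n := b * n.+1%:R.
have e0 n : 0 < e n by rewrite mulr_gt0.
have G0 n := Gamma_gt0 (e0 n).
pose T n u := n' ^+ n * (u `^ (e n - 1) / Gamma (e n)).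
have T0 n u : 0 <= T n u.
  by rewrite mulr_ge0 ?exprn_ge0// divr_ge0 ?powR_ge0// ltW.
have mT n : measurable_fun setT (T n).
  by apply: measurable_funM => //; exact: measurable_funM.
pose S u := (\sum_(n <oo) (T n u)%:E)%E.
have S0 u : (0 <= S u)%E by apply: nneseries_ge0 => n _ _; rewrite lee_fin.
have mS : measurable_fun setT S.
  by apply: ge0_emeasurable_sum => [k x _ _|k _]; [rewrite lee_fin|exact/measurable_EFinP].
(* an exponential rate strictly between those of the series and of [exp (- M u)] *)
pose N := ((n' + m) / 2) `^ b^-1.
have nm0 : 0 < (n' + m) / 2 by rewrite divr_gt0// ltr_wpDl.
have N0 : 0 < N by exact: powR_gt0.
have Nb : N `^ b = (n' + m) / 2.
  by rewrite -powRrM mulVf ?gt_eqF// powRr1// ltW.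
have NM : N < M.
  rewrite ltNge; apply/negP => MN.
  have h : N `^ b < m by rewrite Nb; lra.
  have : M `^ b <= N `^ b.
    by apply: ge0_ler_powR; rewrite ?nnegrE ?(ltW M0) ?(ltW N0) ?(ltW b0).
  by rewrite Mb leNgt h.
pose q := n' / N `^ b.
have q01 : 0 <= q < 1.
  by rewrite divr_ge0 ?powR_ge0//= ltr_pdivrMr ?powR_gt0// mul1r Nb ltr_pdivlMr//; lra.
(* [powR_div_Gamma_le] at z = Nu bounds the n-th term by [B u] times q^n; here q < 1 since N^b is
   the midpoint of n' and m. *)
pose B u := u^-1 * ((N * u + 1) * expR (N * u + 1)) / N `^ b.
have TB n u : 0 < u -> T n u <= B u * q ^+ n.
  move=> u0; have Nu : 0 < N * u by rewrite mulr_gt0.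
  have := powR_div_Gamma_le (e0 n) Nu.
  rewrite powRM ?(ltW N0) ?(ltW u0)// {1}/e powRrM powR_mulrn ?powR_ge0// => H.
  have -> : T n u = q ^+ n * u^-1 / N `^ b * ((N `^ b) ^+ n.+1 * u `^ (e n) / Gamma (e n)).
    rewrite /T /q expr_div_n -(mulr_powRB1 (ltW u0) (e0 n)) exprS.
    by field; rewrite !gt_eqF ?exprn_gt0 ?powR_gt0// Gamma_gt0.
  have -> : B u * q ^+ n = q ^+ n * u^-1 / N `^ b * ((N * u + 1) * expR (N * u + 1)).
    by rewrite /B; ring.
  rewrite ler_wpM2l//; case/andP: q01 => q0 _.
  by rewrite !mulr_ge0 ?invr_ge0 ?exprn_ge0 ?powR_ge0// ltW.
have B0 u : 0 < u -> 0 <= B u.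
  move=> u0; rewrite !mulr_ge0 ?invr_ge0 ?expR_ge0 ?powR_ge0//; first exact: ltW.
  by rewrite addr_ge0// mulr_ge0// ltW.
have SB u : 0 < u -> (S u <= (B u / (1 - q))%:E)%E.
  move=> u0; rewrite -nneseries_geometric ?B0//.
  by apply: lee_nneseries => [n _ _|n _]; rewrite lee_fin ?TB.
have Sfin u : 0 < u -> S u \is a fin_num.
  by move=> u0; rewrite ge0_fin_numE// (le_lt_trans (SB u u0))// ltry.
exists (fun u => expR (- (M * u)) * fine (S u)); split.
- apply: measurable_funM.
    by apply: measurableT_comp => //; apply: measurableT_comp => //; exact: measurable_funM.
  by apply: (measurableT_comp _ mS); exact: fine_measurable.
- by move=> u; rewrite mulr_ge0 ?expR_ge0// fine_ge0.
- move=> s s0; have sM : 0 < s + M by rewrite addr_gt0.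
  have mE : measurable_fun setT (fun u : R => expR (- ((s + M) * u))).
    by apply: measurableT_comp => //; apply: measurableT_comp => //; exact: measurable_funM.
  transitivity (\int[mu]_(u in `]0%R, +oo[)
      (\sum_(n <oo) (expR (- ((s + M) * u)) * T n u)%:E))%E.
    apply: eq_integral => u; rewrite inE/= in_itv/= andbT => u0.
    have -> : (\sum_(n <oo) (expR (- ((s + M) * u)) * T n u)%:E =
        (expR (- ((s + M) * u)))%:E * S u)%E.
      rewrite /S -nneseriesZl; last by move=> i _; rewrite lee_fin.
      by apply: eq_eseriesr => i _; rewrite EFinM.
    rewrite -(fineK (Sfin u u0)) -EFinM; congr EFin.
    have -> : expR (- ((s + M) * u)) = expR (- (M * u)) * expR (- (s * u)).
      by rewrite -expRD; congr expR; ring.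
    by ring.
  rewrite integral_nneseries//; last 2 first.
  - move=> n; apply/measurable_EFinP/measurable_funTS.
    by apply: measurable_funM; [exact: mE|exact: mT].
  - by move=> n u _; rewrite lee_fin mulr_ge0 ?expR_ge0.
  have P0 := powR_gt0 b sM.
  have nP : n' < (s + M) `^ b.
    apply: (lt_le_trans nm); rewrite -Mb.
    by apply: ge0_ler_powR; rewrite ?nnegrE ?lerDr ?ltW.
  have -> : (l + ((s + M) `^ b - m))^-1 = ((s + M) `^ b)^-1 / (1 - n' / (s + M) `^ b).
    rewrite -invfM; congr (_^-1); rewrite mulrBr mulr1 mulrCA divff ?gt_eqF// /n'.
    by ring.
  rewrite -nneseries_geometric; last 2 first.
  - by rewrite invr_ge0 ltW.
  - by rewrite divr_ge0 ?(ltW P0)//= ltr_pdivrMr// mul1r.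
  apply: eq_eseriesr => n _.
  transitivity (\int[mu]_(u in `]0%R, +oo[) ((n' ^+ n / Gamma (e n))%:E *
      (u `^ (e n - 1) * expR (- ((s + M) * u)))%:E))%E.
    by apply: eq_integral => u _; rewrite -EFinM /T; congr EFin; ring.
  rewrite ge0_integralZl_EFin//; last 3 first.
  - by move=> u _; rewrite lee_fin mulr_ge0 ?powR_ge0 ?expR_ge0.
  - by apply/measurable_EFinP/measurable_funTS; exact: measurable_gammaf.
  - by rewrite divr_ge0 ?exprn_ge0// ltW.
  rewrite integral_gamma_scale// -EFinM; congr EFin.
  rewrite {2}/e powRrM powR_mulrn ?powR_ge0// expr_div_n exprS.
  by field; rewrite !gt_eqF ?exprn_gt0.
(* The first term of the series alone is u^(b-1)/Gamma(b), which already dominates [kappa]. *)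
- exists (Gamma b)^-1 => [|u u0]; first by rewrite invr_gt0 Gamma_gt0.
  rewrite mulrAC [leRHS]mulrC ler_wpM2r ?expR_ge0//.
  rewrite -lee_fin fineK ?Sfin//.
  have : ((T 0 u)%:E <= S u)%E.
    have := @nneseries_lim_ge R (fun n => (T n u)%:E) xpredT 0 1%N.
    by rewrite big_nat1; apply => n _ _; rewrite lee_fin.
  apply: le_trans; rewrite lee_fin /T expr0 mul1r /e mulr1 mulrC.
  by rewrite ler_wpM2r ?kappa_le// invr_ge0 ltW// Gamma_gt0.
- have dN : 0 < M - N by rewrite subr_gt0.
  have p0 : 0 <= b + 1 by rewrite addr_ge0// ltW.
  have [C2 C20 HC2] := powR_le_expR p0 dN.
  have q1 : 0 < 1 - q by rewrite subr_gt0; case/andP: q01.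
  have Nb0 : 0 < N `^ b by exact: powR_gt0.
  pose K := (N + 1) * expR 1 / N `^ b / (1 - q) * C2.
  have K0 : 0 < K.
    by rewrite mulr_gt0// divr_gt0// divr_gt0// mulr_gt0 ?expR_gt0// addr_gt0.
  exists (K + fine (S 1)) => [|u u0]; first by rewrite ltr_wpDr ?fine_ge0.
  (* For u <= 1 every exponent b(k+1)-1 is at least b-1, so S(u) <= u^(b-1) S(1). For u > 1 the
     remaining factor e^(-(M-N)u) beats the power u^(-b-1). *)
  rewrite /kappa; case: (leP u 1) => u1.
    apply: (@le_trans _ _ (fine (S 1) * u `^ (b - 1))); last first.
      by rewrite ler_wpM2r ?powR_ge0// lerDr ltW.
    apply: (@le_trans _ _ (fine (S u))).
      rewrite ler_piMl ?fine_ge0// expR_le1 oppr_le0 mulr_ge0// ltW//.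
    rewrite -lee_fin EFinM !fineK ?Sfin// muleC -nneseriesZl; last first.
      by move=> i _; rewrite lee_fin.
    apply: lee_nneseries => [n _ _|n _]; rewrite -?EFinM lee_fin//.
    have -> : u `^ (b - 1) * T n 1 = n' ^+ n * (u `^ (b - 1) / Gamma (e n)).
      by rewrite /T powR1; ring.
    rewrite /T ler_wpM2l ?exprn_ge0//.
    rewrite ler_wpM2r ?invr_ge0 ?(ltW (G0 n))//.
    apply: ger_powR; first by rewrite u0.
    by rewrite lerD2r /e ler_peMr ?(ltW b0)// ler1n.
  apply: (@le_trans _ _ (K * u `^ (- b - 1))); last first.
    by rewrite ler_wpM2r ?powR_ge0// lerDl fine_ge0.
  apply: (@le_trans _ _ (expR (- (M * u)) * (B u / (1 - q)))).
    by rewrite ler_wpM2l ?expR_ge0// -lee_fin fineK ?Sfin// SB.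
  have E : expR (- (M * u)) * (B u / (1 - q)) =
      (u^-1 * (N * u + 1)) * (expR 1 / N `^ b / (1 - q)) * expR (- ((M - N) * u)).
    have -> : expR (- ((M - N) * u)) = expR (- (M * u)) * expR (N * u).
      by rewrite -expRD; congr expR; ring.
    by rewrite /B expRD; ring.
  have -> : K * u `^ (- b - 1) =
      (N + 1) * (expR 1 / N `^ b / (1 - q)) * (C2 * u `^ (- b - 1)) by rewrite /K; ring.
  rewrite E; apply: ler_pM.
  - by rewrite !mulr_ge0 ?invr_ge0 ?expR_ge0 ?(ltW u0) ?(ltW Nb0) ?(ltW q1)// addr_ge0 ?mulr_ge0 ?(ltW N0) ?(ltW u0).
  - exact: expR_ge0.
  - rewrite ler_wpM2r ?mulr_ge0 ?invr_ge0 ?expR_ge0 ?(ltW Nb0) ?(ltW q1)//.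
    rewrite mulrC ler_pdivrMr// mulrDl mul1r lerD2l ltW//.
  - rewrite -opprD powRN expRN -ler_pdivrMr ?invr_gt0 ?powR_gt0// invrK.
    rewrite mulrC ler_pdivrMr ?expR_gt0//; exact: (HC2 u (ltW u0)).
Qed.

(* The density of the [l]-potential measure of the relativistic
   [b]-stable subordinator. *)
Lemma resolvent_density (b m l : R) : 0 < b < 1 -> 0 <= m -> 0 < l ->
  exists g : R -> R, [/\ measurable_fun setT g /\ (forall u, 0 <= g u),
    forall s, 0 < s -> (\int[mu]_(u in `]0%R, +oo[) (g u * expR (- (s * u)))%:E =
      ((l + ((s + m `^ b^-1) `^ b - m))^-1)%:E)%E,
    exists2 c, 0 < c & forall u, 0 < u ->
      c * expR (- (m `^ b^-1 * u)) * kappa b u <= g u,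
    exists2 C, 0 < C & forall u, 0 < u -> g u <= C * kappa b u &
    m < l -> exists2 C, 0 < C & forall u, 0 < u ->
      g u <= C * expR (- (m `^ b^-1 * u)) * kappa b u].
Proof.
move=> b01 m0 l0; have [ml|lm] := ltP m l.
  have [g [mg g0 Lg lo hi]] := resolvent_density_gt b01 m0 ml.
  exists g; split => //; have [C C0 HC] := hi; exists C => // u u0.
  apply: (le_trans (HC u u0)); rewrite ler_wpM2r ?kappa_ge0// ler_piMr ?(ltW C0)//.
  by rewrite expR_le1 oppr_le0 mulr_ge0 ?powR_ge0// ltW.
have lm' : 0 < l <= m by rewrite l0.
have [g [mg g0 Lg lo hi]] := resolvent_density_le b01 lm'.
by exists g; split.
Qed.

End resolvent_density.

(** * Folding the line onto the half-line *)

Section fold.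
Context {R : realType}.
Notation mu := (@lebesgue_measure R).
Local Open Scope ereal_scope.

Lemma ge0_integral_fold (f : R -> \bar R) : measurable_fun setT f ->
  (forall x, 0 <= f x) ->
  \int[mu]_x f x = \int[mu]_(x in `]0%R, +oo[) (f x + f (- x)%R).
Proof.
move=> mf f0.
have mfN : measurable_fun setT (fun x : R => f (- x)%R) by exact: measurableT_comp.
rewrite ge0_integralD//; last 2 first.
- exact: measurable_funTS.
- exact: measurable_funTS.
have -> : [set: R] = `]0%R, +oo[%classic `|` `]-oo, 0%R]%classic :> set R.
  apply/seteqP; split => x //= _; rewrite !in_itv/= andbT.
  by case: (ltP 0%R x) => ?; [left|right].
rewrite ge0_integral_setU//=; last 2 first.
- exact: measurable_funTS.
- apply/disj_set2P/seteqP; split => // x [] /=; rewrite !in_itv/= andbT.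
  by move=> x0; rewrite leNgt x0.
congr (_ + _); have := ge0_integration_by_substitution0 mfN (fun x => f0 (- x)%R).
under [X in _ = X]eq_integral do rewrite opprK.
move=> <-; rewrite integral_itv_obnd_cbnd//.
exact: measurable_funTS.
Qed.

Lemma integrable_fold (f : R -> R) : mu.-integrable setT (EFin \o f) ->
  mu.-integrable `]0%R, +oo[ (EFin \o (fun x => f x + f (- x))%R).
Proof.
move=> iF; have mf : measurable_fun setT f by apply/measurable_EFinP; case/integrableP: iF.
have mfN : measurable_fun setT (fun x : R => f (- x)%R) by exact: measurableT_comp.
have ma : measurable_fun setT (fun x : R => `|f x|)%R by exact: measurableT_comp.
apply: (@le_integrable_EFin R _ (measurableTypeR R) mu _ _ (fun x => `|f x| + `|f (- x)|)%R) => //.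
- by apply: measurable_funTS; exact: measurable_funD.
- by move=> x _; exact: ler_normD.
apply: ge0_integrable_EFin => //.
- apply: measurable_funTS; apply: measurable_funD => //.
  exact: measurableT_comp.
under eq_integral do rewrite EFinD.
rewrite -(@ge0_integral_fold (fun x => (`|f x|)%:E)).
- by case/integrableP: iF.
- exact/measurable_EFinP.
- by move=> x; rewrite lee_fin.
Qed.

Lemma integral_fold (f : R -> R) : mu.-integrable setT (EFin \o f) ->
  \int[mu]_x (f x)%:E = \int[mu]_(x in `]0%R, +oo[) (f x + f (- x))%:E.
Proof.
move=> iF; have mf : measurable_fun setT f by apply/measurable_EFinP; case/integrableP: iF.
have ma : measurable_fun setT (fun x : R => `|f x|)%R by exact: measurableT_comp.
have ia : mu.-integrable setT (EFin \o (fun x => `|f x|)%R) by exact: integrable_norm.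
have if2 : mu.-integrable setT (EFin \o (fun x => f x + `|f x|)%R).
  exact: integrableD_EFin.
have f20 x : (0 <= f x + `|f x|)%R by have := ler_norm (- f x)%R; rewrite normrN; lra.
(* f is the difference of the nonnegative integrable functions f + |f| and |f|, to which the
   nonnegative case applies. *)
have E : \int[mu]_x (f x)%:E = \int[mu]_x ((f x + `|f x|)%:E) - \int[mu]_x (`|f x|)%:E.
  rewrite -(integralB_EFin measurableT if2 ia).
  by apply: eq_integral => x _; rewrite -EFinB addrK.
rewrite E (@ge0_integral_fold (fun x => (f x + `|f x|)%:E)); last 2 first.
- by apply/measurable_EFinP; exact: measurable_funD.
- by move=> x; rewrite lee_fin.
rewrite (@ge0_integral_fold (fun x => (`|f x|)%:E)); last 2 first.
- exact/measurable_EFinP.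
- by move=> x; rewrite lee_fin.
have h1 := integrable_fold if2; have h2 := integrable_fold ia.
have mI : measurable (`]0%R, +oo[%classic : set (measurableTypeR R)).
  exact: measurable_itv.
have := integralB_EFin mI h1 h2.
rewrite /= => <-.
by apply: eq_integral => x _; rewrite -!EFinD -?EFinB; congr EFin; ring.
Qed.

End fold.

(** * Peeling off one coordinate of the Lebesgue measure *)

Section euclid_integrals.
Context {R : realType}.
Notation mu := (@lebesgue_measure R).
Local Open Scope ereal_scope.

Lemma ge0_integral_lebesgueES n (f : euclid R n.+1 -> \bar R) :
  measurable_fun setT f -> (forall x, 0 <= f x) ->
  \int[lebesgueE n.+1]_x f x =
  \int[mu]_a \int[lebesgueE n]_x f (cons_euclid (a, x)).
Proof.
move=> mf f0.
transitivity (\int[(mu \x lebesgueE n)%E]_z f (cons_euclid z)).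
  exact: (@ge0_integral_pushforward _ _ _ _ R _ (@measurable_cons_euclid R n)
    [the measure _ _ of (mu \x lebesgueE n)%E] setT f).
rewrite (fubini_tonelli1 (fun z => f (cons_euclid z)))//.
by apply: measurableT_comp => //; exact: measurable_cons_euclid.
Qed.

Lemma integrable_lebesgueES n (f : euclid R n.+1 -> \bar R) :
  (lebesgueE n.+1).-integrable setT f <->
  measurable_fun setT f /\ (mu \x lebesgueE n).-integrable setT (f \o @cons_euclid R n).
Proof.
have pf (g : euclid R n.+1 -> \bar R) : measurable_fun setT g -> (forall x, 0 <= g x) ->
    \int[lebesgueE n.+1]_x g x = \int[(mu \x lebesgueE n)%E]_z g (cons_euclid z).
  move=> mg g0.
  exact: (@ge0_integral_pushforward _ _ _ _ R _ (@measurable_cons_euclid R n)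
    [the measure _ _ of (mu \x lebesgueE n)%E] setT g).
split.
  move=> /integrableP[mf foo]; split => //; apply/integrableP; split.
    by apply: measurableT_comp => //; exact: measurable_cons_euclid.
  rewrite -(pf (fun x => `|f x|))//.
  exact: measurableT_comp.
move=> [mf /integrableP[_ foo]]; apply/integrableP; split => //.
rewrite pf//.
exact: measurableT_comp.
Qed.

Lemma integral_lebesgueES n (f : euclid R n.+1 -> \bar R) :
  (lebesgueE n.+1).-integrable setT f ->
  \int[lebesgueE n.+1]_x f x =
  \int[mu]_a \int[lebesgueE n]_x f (cons_euclid (a, x)).
Proof.
move=> /integrable_lebesgueES[mf foo].
rewrite (integral12_prod_meas1 foo).
exact: (@integral_pushforward _ _ _ _ R _ (@measurable_cons_euclid R n)
    [the measure _ _ of (mu \x lebesgueE n)%E] setT f mf foo measurableT).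
Qed.

End euclid_integrals.

(** * Fourier transforms of radial functions as iterated cosine transforms *)

Section radial.
Context {R : realType}.
Notation mu := (@lebesgue_measure R).

(** The argument stands for |y|^2. Decay faster than every power makes phi(|y|^2) integrable in all
    dimensions, and it survives the shifts by y_1^2 that arise when a coordinate is split off. *)
Definition rapid (phi : R -> R) : Prop := measurable_fun setT phi /\
  forall N : nat, exists C : R, forall s, 0 <= s -> `|phi s| <= C * (1 + s) ^- N.

Lemma dotE_cons n (a b : R) (x y : euclid R n) :
  dotE (cons_euclid (a, x)) (cons_euclid (b, y)) = a * b + dotE x y.
Proof.
rewrite /dotE big_ord_recl !tnth0; congr (_ + _).
by apply: eq_bigr => i _; rewrite !tnthS.
Qed.

Lemma dotE0 (x y : euclid R 0) : dotE x y = 0.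
Proof. by rewrite /dotE big_ord0. Qed.

Lemma dotEE_ge0 n (x : euclid R n) : 0 <= dotE x x.
Proof. by apply: sumr_ge0 => i _; rewrite -expr2 sqr_ge0. Qed.

Lemma integral_lebesgueE0 (f : euclid R 0 -> \bar R) : measurable_fun setT f ->
  (\int[lebesgueE 0]_x f x = f [tuple])%E.
Proof.
move=> mf; have := integral_dirac ([tuple] : euclid R 0) measurableT mf.
by rewrite diracT mul1e.
Qed.

Lemma measurable_dotE n (x : euclid R n) : measurable_fun setT (dotE x).
Proof.
apply: measurable_sum => i; apply: measurable_funM => //.
exact: measurable_tnth.
Qed.

Lemma measurable_dotEE n : measurable_fun setT (fun x : euclid R n => dotE x x).
Proof.
by apply: measurable_sum => i; apply: measurable_funM => //; exact: measurable_tnth.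
Qed.

(** A product majorant, integrable one coordinate at a time; it dominates (1 + |y|^2)^(-n) because
    each 1 + y_i^2 is at most 1 + |y|^2. *)
Let weight n (y : euclid R n) : R := \prod_(i < n) (1 + tnth y i ^+ 2)^-1.

Let weight_cons n a (y : euclid R n) :
  weight (cons_euclid (a, y)) = (1 + a ^+ 2)^-1 * weight y.
Proof.
rewrite /weight big_ord_recl tnth0; congr (_ * _).
by apply: eq_bigr => i _; rewrite tnthS.
Qed.

Let weight_ge0 n (y : euclid R n) : 0 <= weight y.
Proof. by apply: prodr_ge0 => i _; rewrite invr_ge0 addr_ge0// sqr_ge0. Qed.

Let measurable_weight n : measurable_fun setT (@weight n).
Proof.
apply: measurable_prod => i _; apply: measurable_funV; apply: measurable_funD => //.
by apply: measurable_funX; exact: measurable_tnth.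
Qed.

Lemma integrable_oneDsqrV :
  mu.-integrable setT (EFin \o (fun y : R => (1 + y ^+ 2)^-1)).
Proof.
have mf : measurable_fun setT (fun y : R => (1 + y ^+ 2)^-1).
  by apply: measurable_funV; apply: measurable_funD => //; exact: measurable_funX.
have f0 (y : R) : 0 <= (1 + y ^+ 2)^-1 by rewrite invr_ge0 addr_ge0// sqr_ge0.
apply: ge0_integrable_EFin => //.
rewrite (@ge0_integral_fold R (fun y => ((1 + y ^+ 2)^-1)%:E)); last 2 first.
- exact/measurable_EFinP.
- by move=> y; rewrite lee_fin.
under eq_integral do rewrite sqrrN.
under eq_integral do rewrite -EFinD -mulr2n -mulr_natl EFinM.
rewrite ge0_integralZl_EFin//; last 2 first.
- by move=> y _; rewrite lee_fin.
- by apply/measurable_EFinP; exact: measurable_funTS.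
have -> : (\int[mu]_(y in `]0%R, +oo[) ((1 + y ^+ 2)^-1)%:E = (pi / 2)%:E)%E.
  rewrite -integral0y_oneDsqr -integral_itv_obnd_cbnd//.
  by apply/measurable_EFinP; exact: measurable_funTS.
by rewrite -EFinM ltry.
Qed.

Let integrable_weight n : (lebesgueE n).-integrable setT (EFin \o @weight n).
Proof.
apply: ge0_integrable_EFin => //; first exact: measurable_weight.
elim: n => [|n IH].
  by rewrite integral_lebesgueE0 ?ltry//; apply/measurable_EFinP; exact: measurable_weight.
rewrite ge0_integral_lebesgueES; last 2 first.
- by apply/measurable_EFinP; exact: measurable_weight.
- by move=> x; rewrite lee_fin.
under eq_integral do under eq_integral do rewrite weight_cons EFinM.
under eq_integral.
  move=> a _; rewrite ge0_integralZl_EFin//; last 3 first.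
  - by move=> x _; rewrite lee_fin.
  - by apply/measurable_EFinP; exact: measurable_weight.
  - by rewrite invr_ge0 addr_ge0// sqr_ge0.
  over.
have h1 : (0 <= \int[lebesgueE n]_x (weight x)%:E)%E.
  by apply: integral_ge0 => x _; rewrite lee_fin.
have h2 : (\int[lebesgueE n]_x (weight x)%:E \is a fin_num)%E by rewrite ge0_fin_numE.
have [mI foo] := integrableP _ _ _ integrable_oneDsqrV.
rewrite -(fineK h2) ge0_integralZr//; last 2 first.
- by move=> y _; rewrite lee_fin invr_ge0 addr_ge0// sqr_ge0.
- by rewrite lee_fin fine_ge0.
apply: lte_mul_pinfty.
- by apply: integral_ge0 => y _; rewrite lee_fin invr_ge0 addr_ge0// sqr_ge0.
- rewrite ge0_fin_numE; last first.
    by apply: integral_ge0 => y _; rewrite lee_fin invr_ge0 addr_ge0// sqr_ge0.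
  apply: le_lt_trans foo; apply: ge0_le_integral => //.
  + by move=> y _; rewrite lee_fin invr_ge0 addr_ge0// sqr_ge0.
  + exact: measurableT_comp.
  + by move=> y _; rewrite /= lee_fin ler_norm.
- by rewrite ltry.
Qed.

Let weight_le n (y : euclid R n) : (1 + dotE y y) ^- n <= weight y.
Proof.
have d0 := dotEE_ge0 y.
rewrite /weight -exprVn -[X in _ ^+ X]card_ord -prodr_const.
apply: ler_prod => i _; rewrite invr_ge0 addr_ge0//=.
rewrite lef_pV2 ?posrE ?ltr_pwDl ?sqr_ge0// lerD2l /dotE (bigD1 i)//= -expr2 lerDl.
by apply: sumr_ge0 => j _; rewrite -expr2 sqr_ge0.
Qed.

Lemma rapid_integrable n (phi : R -> R) (g : euclid R n -> R) : rapid phi ->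
  measurable_fun setT g -> (forall y, `|g y| <= 1) ->
  (lebesgueE n).-integrable setT (EFin \o (fun y => g y * phi (dotE y y))).
Proof.
move=> [mphi rphi] mg g1; have [C HC] := rphi n.
apply: (@le_integrable_EFin R _ _ _ _ _ (fun y => C * weight y)) => //.
- apply: measurable_funM => //.
  exact: (measurableT_comp mphi (@measurable_dotEE n)).
- move=> y _; rewrite normrM; apply: (@le_trans _ _ (`|phi (dotE y y)|)).
    by rewrite ler_piMl.
  have d0 := dotEE_ge0 y.
  have C0 : 0 <= C.
    have := HC 0 (lexx 0); rewrite addr0 expr1n invr1 mulr1; exact: le_trans.
  by apply: (le_trans (HC _ d0)); rewrite ler_wpM2l// weight_le.
- by apply: integrableZl_EFin => //; exact: integrable_weight.
Qed.

Lemma rapid_shift (phi : R -> R) (c : R) : 0 <= c -> rapid phi ->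
  rapid (fun t => phi (c + t)).
Proof.
move=> c0 [mphi rphi]; split.
  by apply: measurableT_comp => //; exact: measurable_funD.
move=> N; have [C HC] := rphi N; exists C => s s0.
have C0 : 0 <= C.
  have := HC 0 (lexx 0); rewrite addr0 expr1n invr1 mulr1; exact: le_trans.
apply: (le_trans (HC (c + s) _)); first exact: addr_ge0.
rewrite ler_wpM2l// lef_pV2 ?posrE ?exprn_gt0 ?ltr_pwDl ?addr_ge0//.
by rewrite lerXn2r ?nnegrE ?addr_ge0// lerD2l lerDr.
Qed.

(** The integral of cos(x.y) phi(|y|^2) over R^d, taken one coordinate at a time; evenness in each
    coordinate leaves half-lines and a factor 2. *)
Fixpoint radial (x : seq R) (phi : R -> R) : R :=
  if x is a :: x' then
    2 * \int[mu]_(y in `]0, +oo[) (cos (a * y) * radial x' (fun t => phi (y ^+ 2 + t)))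
  else phi 0.

Let measurable_cosD n (c : R) (x : euclid R n) :
  measurable_fun setT (fun y => cos (c + dotE x y)).
Proof.
apply: measurableT_comp; first exact: (continuous_measurable_fun (@continuous_cos R)).
by apply: measurable_funD => //; exact: measurable_dotE.
Qed.

Lemma rapid_integrable_cos n (x : euclid R n) (phi : R -> R) (c : R) : rapid phi ->
  (lebesgueE n).-integrable setT (EFin \o (fun y => cos (c + dotE x y) * phi (dotE y y))).
Proof. by move=> rphi; apply: rapid_integrable => // y; exact: cos_max. Qed.

(** The inner transform is a section integral of an integrable function on R^(n+1), hence integrable
    in the outer variable. The formula in dimension n is a premise because the lemma serves inside
    the induction that proves it. *)
Let radial_ind n : (forall (x : euclid R n) (phi : R -> R) (c : R), rapid phi ->
   (\int[lebesgueE n]_y (cos (c + dotE x y) * phi (dotE y y))%:E =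
    (cos c * radial x phi)%:E)%E) ->
  forall (x : euclid R n) (phi : R -> R) (c a : R), rapid phi ->
    mu.-integrable setT (EFin \o (fun y => cos (c + a * y) *
      radial x (fun t => phi (y ^+ 2 + t)))).
Proof.
move=> IH x phi c a rphi.
have /integrable_lebesgueES[_ H] := rapid_integrable_cos (cons_euclid (a, x)) c rphi.
have H1 := integrable_fubini_F H.
refine (eq_integrable measurableT _ _ _ H1) => y _.
rewrite /fubini_F /= -(IH x (fun t => phi (y ^+ 2 + t)) (c + a * y)); last first.
  by apply: rapid_shift => //; exact: sqr_ge0.
by apply: eq_integral => z _; rewrite !dotE_cons addrA expr2.
Qed.

Let radial_half n : (forall (x : euclid R n) (phi : R -> R) (c : R), rapid phi ->
   (\int[lebesgueE n]_y (cos (c + dotE x y) * phi (dotE y y))%:E =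
    (cos c * radial x phi)%:E)%E) ->
  forall (x : euclid R n) (phi : R -> R) (a : R), rapid phi ->
    mu.-integrable `]0, +oo[ (EFin \o (fun y => cos (a * y) *
      radial x (fun t => phi (y ^+ 2 + t)))).
Proof.
move=> IH x phi a rphi.
have H := integrable_fold (radial_ind IH x 0 a rphi).
have mI : measurable (`]0%R, +oo[%classic : set (measurableTypeR R)).
  exact: measurable_itv.
have := integrableZl_EFin 2^-1 mI H.
apply: eq_integrable => [|y _ /=]; first exact: measurable_itv.
by congr EFin; rewrite sqrrN !add0r mulrN cosN; field.
Qed.

(** The phase c makes the induction go through: it absorbs the coordinates already split off.
    Folding then uses cos(c + ay) + cos(c - ay) = 2 cos c cos(ay). *)
Lemma radial_fourier n (x : euclid R n) (phi : R -> R) (c : R) : rapid phi ->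
  (\int[lebesgueE n]_y (cos (c + dotE x y) * phi (dotE y y))%:E =
   (cos c * radial x phi)%:E)%E.
Proof.
elim: n x phi c => [|n IH] x phi c rphi.
  rewrite integral_lebesgueE0; first by rewrite !dotE0 addr0 tuple0.
  by have /integrableP[] := rapid_integrable_cos x c rphi.
case/tupleP: x => a x; rewrite (_ : [tuple of a :: x] = cons_euclid (a, x))//.
rewrite integral_lebesgueES; last exact: rapid_integrable_cos.
transitivity (\int[mu]_y (cos (c + a * y) * radial x (fun t => phi (y ^+ 2 + t)))%:E)%E.
  apply: eq_integral => y _.
  rewrite -(IH x (fun t => phi (y ^+ 2 + t)) (c + a * y)); last first.
    by apply: rapid_shift => //; exact: sqr_ge0.
  by apply: eq_integral => z _; rewrite !dotE_cons addrA expr2.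
rewrite (integral_fold (radial_ind IH x c a rphi)).
have I0 := radial_half IH x a rphi.
transitivity (\int[mu]_(y in `]0%R, +oo[) ((cos c * 2)%:E * (EFin \o
    (fun y => cos (a * y) * radial x (fun t => phi (y ^+ 2 + t)))%R) y))%E.
  apply: eq_integral => y _; rewrite /= -EFinM; congr EFin.
  by rewrite sqrrN mulrN cosD cosB; ring.
rewrite integralZl// /= mulrA [RHS]EFinM; congr (_ * _)%E.
have mI : measurable (`]0%R, +oo[%classic : set (measurableTypeR R)).
  exact: measurable_itv.
by rewrite /Rintegral fineK//; exact: (integrable_fin_num mI I0).
Qed.

Lemma integrable_radial n (x : euclid R n) (phi : R -> R) (a : R) : rapid phi ->
  mu.-integrable `]0, +oo[ (EFin \o (fun y => cos (a * y) *
    radial x (fun t => phi (y ^+ 2 + t)))).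
Proof. by apply: radial_half => *; exact: radial_fourier. Qed.

End radial.

(** * The Fourier transform of a Gaussian *)

Section gaussian.
Context {R : realType}.
Notation mu := (@lebesgue_measure R).

Lemma is_derive_comp1 (f g : R -> R) (x df dg : R) :
  is_derive (g x) 1 f df -> is_derive x 1 g dg ->
  is_derive x 1 (fun y => f (g y)) (df * dg).
Proof. by move=> ? ?; exact: is_derive1_comp. Qed.

Lemma is_derive_for_continuous (f : R -> R) (x df : R) :
  is_derive x 1 f df -> {for x, continuous f}.
Proof.
by case=> /derivable1_diffP fd _; exact: differentiable_continuous.
Qed.

Let is_derive_linear (a x : R) : is_derive x 1 (fun y : R => a * y) a.
Proof. by refine (is_derive_eq (is_deriveZ1 a (is_derive_id x 1)) _); rewrite mulr1. Qed.

Let gauss (v y : R) : R := expR (- (v * y ^+ 2)).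

Let is_derive_gauss (v x : R) : is_derive x 1 (gauss v) (- (2 * v * x) * gauss v x).
Proof.
have D : is_derive x 1 (fun y : R => - (v * (y * y))) (- (v * (x * 1 + x * 1))).
  exact: (is_deriveN1 (is_deriveZ1 v (is_deriveM1 (is_derive_id x 1) (is_derive_id x 1)))).
have -> : gauss v = (fun y => expR (- (v * (y * y)))).
  by apply/funext => y; rewrite /gauss expr2.
by refine (is_derive_eq (is_derive_comp1 (is_derive_expR _) D) _); ring.
Qed.

Let measurable_gauss (v : R) : measurable_fun setT (gauss v).
Proof.
by apply: measurableT_comp => //; apply: measurableT_comp => //;
  apply: measurable_funM => //; exact: measurable_funX.
Qed.

Let gauss_bound (v y : R) : 0 < v -> 1 <= y -> gauss v y <= 4 / v ^+ 2 * y ^- 3.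
Proof.
move=> v0 y1; have y0 : 0 < y by exact: lt_le_trans y1.
rewrite /gauss expRN -[4 / _]invrK -invfM lef_pV2 ?posrE ?expR_gt0//; last first.
  by rewrite mulr_gt0 ?exprn_gt0// invf_div divr_gt0// exprn_gt0.
have -> : v * y ^+ 2 = v * y ^+ 2 / 2 + v * y ^+ 2 / 2 by field.
rewrite expRD; have E := expR_ge1Dx (v * y ^+ 2 / 2).
have A0 : 0 < v * y ^+ 2 / 2 by rewrite divr_gt0// mulr_gt0// exprn_gt0.
apply: (@le_trans _ _ ((v * y ^+ 2 / 2) * (v * y ^+ 2 / 2))); last first.
  by apply: ler_pM; try exact: ltW; lra.
rewrite invf_div (_ : _ / 2 * _ = v ^+ 2 / 4 * (y ^+ 3 * y)); last by field.
rewrite ler_wpM2l ?divr_ge0 ?sqr_ge0//.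
by rewrite ler_peMr// exprn_ge0// ltW.
Qed.

Lemma integrable_gauss_poly (v : R) (p : R -> R) : 0 < v -> measurable_fun setT p ->
  (forall y, 0 < y -> `|p y| <= 1 + y) ->
  mu.-integrable `]0, +oo[ (EFin \o (fun y => p y * expR (- (v * y ^+ 2)))).
Proof.
move=> v0 mp pB.
have C0 : 0 <= 4 / v ^+ 2 by rewrite divr_ge0// sqr_ge0.
apply: (@integrable_oy R _ 1 1 (2 + 2 * (4 / v ^+ 2))) => //.
- by apply: measurable_funM => //; exact: measurable_gauss.
- move=> y /andP[y0 y1]; rewrite subrr powRr0 mulr1 normrM (ger0_norm (expR_ge0 _)).
  have e1 : expR (- (v * y ^+ 2)) <= 1.
    by rewrite -expR0 ler_expR oppr_le0 mulr_ge0 ?sqr_ge0// ltW.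
  have := pB y y0; have e0 := expR_ge0 (- (v * y ^+ 2)).
  have := normr_ge0 (p y); nra.
- move=> y y1; have y0 : 0 < y by exact: lt_le_trans y1.
  rewrite normrM (ger0_norm (expR_ge0 _)).
  have -> : y `^ (- 1 - 1) = y ^- 2.
    have -> : - 1 - 1 = - 2%:R :> R by ring.
    by rewrite powRN powR_mulrn// ltW.
  apply: (@le_trans _ _ ((2 * y) * (4 / v ^+ 2 * y ^- 3))).
    apply: ler_pM => //; rewrite ?expR_ge0//.
      by apply: (le_trans (pB y y0)); lra.
    exact: gauss_bound.
  have -> : 2 * y * (4 / v ^+ 2 * y ^- 3) = 2 * (4 / v ^+ 2) * y ^- 2.
    by field; rewrite ?gt_eqF.
  by rewrite ler_wpM2r// ?invr_ge0 ?sqr_ge0//; lra.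
Qed.

Let J (v a : R) : R := \int[mu]_(y in `]0, +oo[) (cos (a * y) * gauss v y).

Let measurable_cosM (a : R) : measurable_fun setT (fun y : R => cos (a * y)).
Proof.
apply: measurableT_comp; first exact: (continuous_measurable_fun (@continuous_cos R)).
exact: measurable_funM.
Qed.

Let measurable_sinM (a : R) : measurable_fun setT (fun y : R => sin (a * y)).
Proof.
apply: measurableT_comp; first exact: (continuous_measurable_fun (@continuous_sin R)).
exact: measurable_funM.
Qed.

Let cos_int (v a : R) : 0 < v ->
  mu.-integrable `]0, +oo[ (EFin \o (fun y => cos (a * y) * gauss v y)).
Proof.
move=> v0; apply: (integrable_gauss_poly v0 (measurable_cosM a)) => y y0.
by apply: (le_trans (cos_max _)); rewrite lerDl ltW.
Qed.

Let sin_int (v a : R) : 0 < v ->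
  mu.-integrable `]0, +oo[ (EFin \o (fun y => (y * sin (a * y)) * gauss v y)).
Proof.
move=> v0; apply: (integrable_gauss_poly v0) => [|y y0].
  by apply: measurable_funM => //; exact: measurable_sinM.
rewrite normrM (gtr0_norm y0) (@le_trans _ _ y)//; last by lra.
by rewrite ler_piMr ?sin_max// ltW.
Qed.

(** Integrate the derivative of sin(ay) e^(-vy^2) over the half-line: the boundary terms vanish at 0
    and at infinity. *)
Let J_parts (v a : R) : 0 < v ->
  a * J v a = 2 * v * \int[mu]_(y in `]0, +oo[) ((y * sin (a * y)) * gauss v y).
Proof.
move=> v0.
pose w (y : R) : R := a * (cos (a * y) * gauss v y) -
  2 * v * ((y * sin (a * y)) * gauss v y).
have mI : measurable (`]0%R, +oo[%classic : set (measurableTypeR R)).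
  exact: measurable_itv.
have i1 := integrableZl_EFin a mI (cos_int a v0).
have i2 := integrableZl_EFin (2 * v) mI (sin_int a v0).
have iw : mu.-integrable `]0, +oo[ (EFin \o w).
  by apply: (eq_integrable mI _ _ _ (integrableB mI i1 i2)) => y _.
have W0 : (\int[mu]_(y in `]0%R, +oo[) (w y)%:E = 0)%E.
  have H := integrable_segments_cvg iw.
  have /cvg_lim <- // := H; apply: cvg_lim => //.
  pose F (y : R) : R := sin (a * y) * gauss v y.
  have dF (y : R) : is_derive y 1 F (w y).
    refine (is_derive_eq (is_deriveM1 (is_derive_comp1 (is_derive_sin _)
      (is_derive_linear a y)) (is_derive_gauss v y)) _).
    by rewrite /w; ring.
  have cw (y : R) : {for y, continuous w}.
    apply: (is_derive_for_continuous (is_deriveB1 (is_deriveZ1 _ (is_deriveM1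
      (is_derive_comp1 (is_derive_cos _) (is_derive_linear a y)) (is_derive_gauss v y)))
      (is_deriveZ1 _ (is_deriveM1 (is_deriveM1 (is_derive_id y 1)
      (is_derive_comp1 (is_derive_sin _) (is_derive_linear a y))) (is_derive_gauss v y))))).
  have E (n : nat) : (\int[mu]_(y in inv_segment n) (w y)%:E =
      (F n.+2%:R - F n.+2%:R^-1)%:E)%E.
    rewrite (@ftc2 _ w F)//.
    by rewrite (@lt_trans _ _ 1)// ?ltr1n// invf_lt1 ?ltr0n// ltr1n.
  rewrite (_ : (fun n => _) = fun n : nat => (F n.+2%:R - F n.+2%:R^-1)%:E)%E; last first.
    by apply/funext => n; exact: E.
  apply: cvg_EFin; first by near=> n.
  rewrite -[0]subr0; apply: cvgB.
    have B (y : R) : 1 <= y -> `|F y| <= 4 / v ^+ 2 * y `^ (- 1).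
      move=> y1; have y0 : 0 < y by exact: lt_le_trans y1.
      rewrite normrM (@le_trans _ _ (gauss v y))//.
        by rewrite (ger0_norm (expR_ge0 _)) ler_piMl ?expR_ge0// sin_max.
      apply: (le_trans (gauss_bound v0 y1)).
      rewrite ler_wpM2l ?divr_ge0 ?sqr_ge0// powR_inv1 ?(ltW y0)//.
      by rewrite lef_pV2 ?posrE ?exprn_gt0// -[leLHS]expr1 ler_weXn2l.
    have [T1 _] := @tail_dom_cvg R (4 / v ^+ 2) 1 1 ltr01 ltr01.
    apply/cvgr0Pnorm_le => e e0; have /cvgr0Pnorm_le/(_ e e0) := T1.
    move=> [N _ HN]; exists N => // n Nn.
    apply: le_trans (HN n Nn); rewrite /tail_dom (leNgt n.+2%:R 1) ltr1n/=.
    by apply: le_trans (ler_norm _); apply: B; rewrite ler1n.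
  have c0 := is_derive_for_continuous (dF 0).
  have F0 : F 0 = 0 by rewrite /F mulr0 sin0 mul0r.
  rewrite -[X in _ --> X]F0; apply: continuous_cvg => //.
  have [_ T2] := @tail_dom_cvg R 1 1 1 ltr01 ltr01.
  apply: cvg_trans T2; apply: near_eq_cvg; near=> n.
  rewrite /tail_dom mul1r invf_le1 ?ltr0n// ler1n/= powRr1 ?invr_ge0 ?ler0n//.
have := W0; rewrite /w.
under eq_integral do rewrite EFinB.
rewrite (integralB_EFin mI i1 i2)//=.
under eq_integral do rewrite EFinM.
rewrite integralZl//; last exact: cos_int.
under [X in (_ - X)%E]eq_integral do rewrite EFinM.
rewrite integralZl//; last exact: sin_int.
rewrite /J /Rintegral.
have f1 := integrable_fin_num mI (cos_int a v0).
have f2 := integrable_fin_num mI (sin_int a v0).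
rewrite -(fineK f1) -(fineK f2) -!EFinM -EFinB => -[] /eqP.
by rewrite subr_eq0 => /eqP.
Unshelve. all: end_near. Qed.

(** Differentiation under the integral, dominated by y e^(-vy^2) whatever the frequency. *)
Let is_derive_J (v a : R) : 0 < v ->
  is_derive a 1 (J v) (- \int[mu]_(y in `]0, +oo[) ((y * sin (a * y)) * gauss v y)).
Proof.
move=> v0.
have mI : measurable (`]0%R, +oo[%classic : set (measurableTypeR R)).
  exact: measurable_itv.
pose f (x y : R) : R := cos (x * y) * gauss v y.
pose G (y : R) : R := `|y| * gauss v y.
have dfx (x y : R) : is_derive x 1 (f ^~ y) (- ((y * sin (x * y)) * gauss v y)).
  have D : is_derive x 1 (fun x : R => x * y) y.
    refine (is_derive_eq (is_deriveM1 (is_derive_id x 1) (is_derive_cst y x 1)) _).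
    by rewrite mulr0 mulr1 add0r.
  have D2 := is_deriveM1 (@is_derive_comp1 cos (fun x => x * y) x _ _
    (is_derive_cos _) D) (is_derive_cst (gauss v y) x 1).
  by refine (is_derive_eq D2 _); rewrite /cst /=; ring.
have Ia : (`]a - 1, a + 1[%classic : set R) a.
  by rewrite /= in_itv/=; apply/andP; split; lra.
have intf (x : R) : (`]a - 1, a + 1[%classic : set R) x ->
    mu.-integrable `]0, +oo[ (EFin \o f x) by move=> _; exact: cos_int.
have df1 (x y : R) : (`]a - 1, a + 1[%classic : set R) x -> (`]0, +oo[%classic : set R) y ->
    derivable (f ^~ y) x 1 by move=> _ _; have [] := dfx x y.
have G0 (y : R) : 0 <= G y by rewrite mulr_ge0// expR_ge0.
have iG : mu.-integrable `]0, +oo[ (EFin \o G).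
  have mn : measurable_fun setT (fun y : R => `|y|) by exact: measurableT_comp.
  apply: (integrable_gauss_poly v0 mn) => y y0.
  by rewrite normr_id (gtr0_norm y0); lra.
have p1 (x y : R) : partial1of2 f x y = - ((y * sin (x * y)) * gauss v y).
  by rewrite partial1of2E; have [_ ->] := dfx x y.
have Gub (x y : R) : (`]a - 1, a + 1[%classic : set R) x -> (`]0, +oo[%classic : set R) y ->
    `|partial1of2 f x y| <= G y.
  move=> _ _; rewrite p1 normrN !normrM (ger0_norm (expR_ge0 _)) /G.
  by rewrite ler_wpM2r ?expR_ge0// ler_piMr// sin_max.
split.
  exact: (derivable_under_integral mI Ia intf df1 G0 iG Gub).
rewrite -derive1E.
rewrite (differentiation_under_integral mI Ia intf df1 G0 iG Gub).
have -> : (fun y => partial1of2 f a y) = (fun y => - ((y * sin (a * y)) * gauss v y)).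
  by apply/funext => y; exact: p1.
rewrite /Rintegral; under eq_integral do rewrite EFinN.
rewrite (integralN (integrable_add_def mI (sin_int a v0))) fineN//.
Qed.

Lemma integral_gauss (v : R) : 0 < v ->
  (\int[mu]_(y in `]0%R, +oo[) (expR (- (v * y ^+ 2)))%:E =
   (Num.sqrt (pi / v) / 2)%:E)%E.
Proof.
move=> v0.
have sv0 : 0 < Num.sqrt v by rewrite sqrtr_gt0.
have mg : measurable_fun setT (@gauss_fun R) by exact: measurable_gauss_fun.
have := @integral0y_gauss R.
rewrite -integral_itv_obnd_cbnd; last by apply/measurable_EFinP; exact: measurable_funTS.
rewrite (@ge0_integral_scale R _ (fun y => (gauss_fun y)%:E) sv0); last 2 first.
- exact/measurable_EFinP.
- by move=> y; rewrite lee_fin; exact: gauss_fun_ge0.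
move=> E; rewrite sqrtrM ?pi_ge0// sqrtrV ?(ltW v0)//.
under eq_integral.
  move=> y _; rewrite (_ : expR _ = gauss_fun (Num.sqrt v * y)); last first.
    by rewrite /gauss_fun exprMn sqr_sqrtr// ltW.
  over.
have -> : (Num.sqrt pi * (Num.sqrt v)^-1 / 2)%:E =
    ((Num.sqrt v)^-1%:E * (Num.sqrt pi / 2)%:E)%E :> \bar R.
  by rewrite -EFinM; congr EFin; ring.
by rewrite -E muleA -EFinM mulVf ?gt_eqF// mul1e.
Qed.

(** By [is_derive_J] and [J_parts], J' = -a J/(2v) in the frequency a. Hence J(a) e^(a^2/(4v)) has
    zero derivative and equals J(0), the Gauss integral. *)
Lemma integral_cos_gauss (v a : R) : 0 < v ->
  \int[mu]_(y in `]0, +oo[) (cos (a * y) * expR (- (v * y ^+ 2))) =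
  Num.sqrt (pi / v) / 2 * expR (- (a ^+ 2 / (4 * v))).
Proof.
move=> v0; rewrite -/(gauss v _) -/(J v a).
pose E (x : R) : R := J v x * gauss (- (4 * v)^-1) x.
have dE (x : R) : is_derive x 1 E 0.
  refine (is_derive_eq (is_deriveM1 (is_derive_J x v0) (is_derive_gauss _ x)) _).
  have H := J_parts x v0.
  have -> : \int[mu]_(y in `]0, +oo[) ((y * sin (x * y)) * gauss v y) =
      x * J v x / (2 * v) by rewrite H; field; rewrite gt_eqF.
  by field; rewrite gt_eqF.
have := is_derive_0_is_cst a 0 dE; rewrite /E.
have -> : J v 0 = Num.sqrt (pi / v) / 2.
  rewrite /J /Rintegral; under eq_integral do rewrite mul0r cos0 mul1r.
  by rewrite integral_gauss.
rewrite {2}/gauss expr0n/= mulr0 oppr0 expR0 mulr1 => <-.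
rewrite /gauss mulNr opprK -mulrA -expRD [X in expR X](_ : _ = 0) ?expR0 ?mulr1//.
by field; rewrite gt_eqF.
Qed.

End gaussian.

(** * Translations, and cosine integrals of decreasing functions *)

Section translation.
Context {R : realType}.
Notation mu := (@lebesgue_measure R).

Let trl (h : R) : R -> measurableTypeR R := fun x => x + h.

Let measurable_trl (h : R) : measurable_fun setT (trl h).
Proof. exact: measurable_funD. Qed.

Let translated (h : R) : {measure set (measurableTypeR R) -> \bar R}.
Proof.
refine [the {measure set (measurableTypeR R) -> \bar R} of pushforward mu (trl h)].
exact: measurable_trl.
Defined.

Let lebesgue_measure_translate (h : R) (A : set R) : measurable A -> translated h A = mu A.
Proof.
move=> mA; apply/esym/lebesgue_measure_unique => //= _ [[a b]] _ <-.
rewrite /pushforward.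
rewrite (_ : trl _ @^-1` _ = `](a - h), (b - h)]%classic).
  rewrite !lebesgue_measure_itv/= !lte_fin ltrD2r.
  by case: ifPn => _ //; rewrite -!EFinB; congr EFin; ring.
by apply/seteqP; split => x /=; rewrite !in_itv/= /trl ltrBlDr lerBrDr.
Qed.

Let trl_preimage (h : R) : trl h @^-1` `]h, +oo[%classic = `]0, +oo[%classic :> set R.
Proof. by apply/seteqP; split => x /=; rewrite !in_itv/= !andbT /trl ltrDr. Qed.

Lemma ge0_integral_shift (h : R) (f : R -> \bar R) :
  measurable_fun setT f -> (forall x, (0 <= f x)%E) ->
  (\int[mu]_(x in `]h, +oo[) f x = \int[mu]_(x in `]0%R, +oo[) f (x + h)%R)%E.
Proof.
move=> mf f0.
rewrite -[X in _ = (\int[_]_(x in X) _)%E](trl_preimage h).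
have mfD : measurable_fun (`]h, +oo[ : set R) f by exact: measurable_funTS.
have := @ge0_integral_pushforward _ _ (measurableTypeR R) (measurableTypeR R) R (trl h)
   (measurable_trl h) mu `]h, +oo[%classic f (measurable_itv _) mfD (fun y _ => f0 y).
rewrite /comp/= => <-.
apply: (eq_measure_integral (translated h)) => A mA _.
by rewrite lebesgue_measure_translate.
Qed.

Lemma integrable_shift (h : R) (F : R -> R) : 0 <= h ->
  mu.-integrable `]0, +oo[ (EFin \o F) ->
  mu.-integrable `]0, +oo[ (EFin \o (fun y => F (y + h))) /\
  \int[mu]_(y in `]h, +oo[) F y = \int[mu]_(y in `]0, +oo[) F (y + h).
Proof.
move=> h0 iF.
have mI (k : R) : measurable (`]k, +oo[%classic : set (measurableTypeR R)).
  exact: measurable_itv.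
(* F is known to be measurable on the half-line only; its extension by 0 is measurable
   everywhere. *)
pose G := F \_ `]0, +oo[%classic.
have EG (y : R) : 0 < y -> G y = F y.
  by move=> y0; rewrite /G patchE mem_set//= in_itv/= y0.
have mF : measurable_fun (`]0, +oo[%classic : set R) F.
  by apply/measurable_EFinP; case/integrableP: iF.
have mG : measurable_fun setT G.
  by apply/(measurable_restrictT _ _).1 => //; exact: mI.
have sub : `]h, +oo[%classic `<=` (`]0, +oo[%classic : set R).
  by move=> y /=; rewrite !in_itv/= !andbT; exact: le_lt_trans.
have iFh : mu.-integrable `]h, +oo[ (EFin \o F).
  exact: (integrableS (mI 0) (mI h) sub iF).
have iGs : mu.-integrable `]0, +oo[ (EFin \o (fun y => G (y + h))).
  apply/integrableP; split.
    apply: measurable_funTS; apply/measurable_EFinP; apply: measurableT_comp => //.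
    exact: measurable_funD.
  have := @ge0_integral_shift h (fun y => `|(G y)%:E|)%E.
  move=> <-//; last by apply: measurableT_comp => //; exact/measurable_EFinP.
  case/integrableP: iFh => _; apply: le_lt_trans.
  rewrite le_eqVlt; apply/orP; left; apply/eqP; apply: eq_integral => y /set_mem/= yh.
  by rewrite EG//; move/sub: yh; rewrite /= in_itv/= andbT.
have pos (y : R) : y \in (`]0, +oo[%classic : set R) -> 0 < y + h.
  by move=> /set_mem/=; rewrite in_itv/= andbT => y0; rewrite ltr_wpDr.
split.
  by apply: (eq_integrable (mI 0) _ _ _ iGs) => y yI /=; rewrite EG ?pos.
rewrite (@eq_Rintegral _ _ _ mu _ G F); last first.
  by move=> y /set_mem/sub; rewrite /= in_itv/= andbT => y0; rewrite EG.
rewrite (@eq_Rintegral _ _ _ mu `]0, +oo[%classic (fun y => G (y + h)) (fun y => F (y + h))); last first.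
  by move=> y yI; rewrite EG ?pos.
rewrite /Rintegral; congr fine.
rewrite -[X in _ = (\int[_]_(x in X) _)%E](trl_preimage h).
have mGE : measurable_fun setT (EFin \o G) by exact/measurable_EFinP.
have iGs' : mu.-integrable (trl h @^-1` `]h, +oo[) ((EFin \o G) \o trl h).
  by rewrite trl_preimage.
have := @integral_pushforward _ _ (measurableTypeR R) (measurableTypeR R) R (trl h)
   (measurable_trl h) mu `]h, +oo[%classic (EFin \o G) mGE iGs' (mI h).
rewrite /comp/= => <-.
apply: (eq_measure_integral (translated h)) => A mA _.
by rewrite lebesgue_measure_translate.
Qed.

(* Shifting by the half-period h = pi / a changes the sign of the cosine, whence
   2 I = int_0^h cos(a y) F(y) dy + int_0^oo cos(a y) (F(y) - F(y + h)) dy,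
   and both terms are at most int_0^h F. *)
Lemma cos_integral_bound (F : R -> R) (a F0 : R) : a != 0 ->
  mu.-integrable `]0, +oo[ (EFin \o F) ->
  (forall y, 0 < y -> 0 <= F y <= F0) ->
  (forall y z, 0 < y -> y <= z -> F z <= F y) ->
  `|\int[mu]_(y in `]0, +oo[) (cos (a * y) * F y)| <= pi / `|a| * F0.
Proof.
move=> a0 iF FB dF.
have mI (k : R) : measurable (`]k, +oo[%classic : set (measurableTypeR R)).
  exact: measurable_itv.
wlog ap : a a0 / 0 < a.
  move=> H; have [ap|ap|/esym E] := ltgtP 0 a; last 1 first.
  - by move: a0; rewrite E eqxx.
  - exact: H.
  - have := H (- a); rewrite oppr_eq0 oppr_gt0 normrN => /(_ a0 ap).
    by under eq_Rintegral do rewrite mulNr cosN.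
rewrite (gtr0_norm ap); set h := pi / a.
have h0 : 0 < h by rewrite divr_gt0// pi_gt0.
have ch (y : R) : cos (a * (y + h)) = - cos (a * y).
  by rewrite mulrDr /h mulrCA divff// mulr1 cosDpi.
have icF (G : R -> R) : mu.-integrable `]0, +oo[ (EFin \o G) ->
    mu.-integrable `]0, +oo[ (EFin \o (fun y => cos (a * y) * G y)).
  move=> iG; apply: (@le_integrable_EFin R _ (measurableTypeR R) mu _ _ (fun y => `|G y|)) => //.
  - apply: measurable_funM.
      apply: measurable_funTS.
      apply: measurableT_comp; first exact: (continuous_measurable_fun (@continuous_cos R)).
      exact: measurable_funM.
    by apply/measurable_EFinP; case/integrableP: iG.
  - by move=> y _; rewrite normrM ler_piMl// cos_max.
  - exact: (integrable_norm iG).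
have [iFh EFh] := integrable_shift (ltW h0) iF.
have icF0 := icF _ iF.
have [icFh EcFh] := integrable_shift (ltW h0) icF0.
have mS : measurable (`]0, h]%classic : set (measurableTypeR R)) by exact: measurable_itv.
have split0 (G : R -> R) : mu.-integrable `]0, +oo[ (EFin \o G) ->
    \int[mu]_(y in `]0, +oo[) G y = \int[mu]_(y in `]0, h]) G y +
    \int[mu]_(y in `]h, +oo[) G y.
  move=> iG.
  have E : (`]0, +oo[%classic : set R) = `]0, h]%classic `|` `]h, +oo[%classic.
    by rewrite -itv_bndbnd_setU// bnd_simp ltW.
  rewrite E Rintegral_setU// -?E//.
  apply/disj_set2P/seteqP; split => // y [] /=; rewrite !in_itv/= andbT.
  by move=> /andP[_ yh]; rewrite ltNge yh.
set S := \int[mu]_(y in `]0, h]) F y.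
have subS : `]0, h]%classic `<=` (`]0, +oo[%classic : set R).
  by move=> y /=; rewrite !in_itv/= andbT => /andP[].
have iS := integrableS (mI 0) mS subS iF.
have icS := integrableS (mI 0) mS subS icF0.
have SB : S <= h * F0.
  have muS : mu (`]0, h]%classic : set R) = h%:E.
    by rewrite lebesgue_measure_itv/= lte_fin h0 sube0.
  have -> : h * F0 = \int[mu]_(y in `]0, h]) F0.
    rewrite Rintegral_cst// (_ : fine _ = h) 1?mulrC//.
    exact: (congr1 fine muS).
  apply: le_Rintegral => //.
    have F00 : 0 <= F0 by have /andP[+ +] := FB 1 ltr01; exact: le_trans.
    apply: ge0_integrable_EFin => //.
    rewrite (integral_cst mu mS F0%:E).
    have E : (F0%:E * h%:E < +oo)%E by rewrite -EFinM ltry.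
    by apply: le_lt_trans E; rewrite -muS.
  by move=> y /subS; rewrite /= in_itv/= andbT => /FB/andP[].
have A1 : `|\int[mu]_(y in `]0, h]) (cos (a * y) * F y)| <= S.
  apply: (le_trans (le_normr_Rintegral mS icS)).
  apply: le_Rintegral => //; first exact: (integrable_norm icS).
  move=> y /subS; rewrite /= in_itv/= andbT => /FB/andP[Fy _].
  by rewrite normrM (ger0_norm Fy) ler_piMl// cos_max.
have iD := integrableB (mI 0) iF iFh.
have iD' : mu.-integrable `]0, +oo[ (EFin \o (fun y => F y - F (y + h))).
  by apply: (eq_integrable (mI 0) _ _ _ iD) => y _.
have icD := icF _ iD'.
(* F decreases, so F(y) - F(y + h) is nonnegative and its integral telescopes to [S]. *)
have A2 : `|\int[mu]_(y in `]0, +oo[) (cos (a * y) * (F y - F (y + h)))| <= S.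
  apply: (le_trans (le_normr_Rintegral (mI 0) icD)).
  apply: (@le_trans _ _ (\int[mu]_(y in `]0, +oo[) (F y - F (y + h)))).
    apply: le_Rintegral => //; first exact: (integrable_norm icD).
    move=> y /=; rewrite in_itv/= andbT => y0.
    have d0 : 0 <= F y - F (y + h) by rewrite subr_ge0 dF// lerDl ltW.
    by rewrite normrM (ger0_norm d0) ler_piMl// cos_max.
  by rewrite RintegralB// (split0 F)// EFh /S addrK.
have E2 : \int[mu]_(y in `]0, +oo[) (cos (a * y) * (F y - F (y + h))) =
    \int[mu]_(y in `]0, +oo[) (cos (a * y) * F y) +
    \int[mu]_(y in `]0, +oo[) (cos (a * (y + h)) * F (y + h)).
  rewrite -RintegralD//; apply: eq_Rintegral => y _.
  by rewrite ch; ring.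
have EI := split0 _ icF0; rewrite EcFh in EI.
move: A2; rewrite E2; move: EI A1.
move: (\int[mu]_(y in `]0, +oo[) (cos (a * y) * F y)) => I.
move: (\int[mu]_(y in `]0, +oo[) (cos (a * (y + h)) * F (y + h))) => B.
move: (\int[mu]_(y in `]0, h]) (cos (a * y) * F y)) => A EI A1 A2.
move: A1 A2 SB; rewrite !ler_norml => /andP[? ?] /andP[? ?] ?.
by apply/andP; split; lra.
Qed.

End translation.

(** * Oscillation bounds in dimensions one to three *)

Section radial_bounds.
Context {R : realType}.
Notation mu := (@lebesgue_measure R).

Let mI : measurable (`]0%R, +oo[%classic : set (measurableTypeR R)).
Proof. exact: measurable_itv. Qed.

Lemma radial_gauss (x : seq R) (k v : R) : 0 < v ->
  radial x (fun t => k * expR (- (v * t))) =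
  k * Num.sqrt (pi / v) ^+ size x * expR (- ((\sum_(a <- x) a ^+ 2) / (4 * v))).
Proof.
move=> v0; elim: x k => [|a x IH] k /=.
  by rewrite big_nil mul0r !mulr0 oppr0 expr0 mulr1.
set S := Num.sqrt (pi / v); pose E := expR (- ((\sum_(a <- x) a ^+ 2) / (4 * v))).
have E1 (y : R) : radial x (fun t => k * expR (- (v * (y ^+ 2 + t)))) =
    k * S ^+ size x * E * expR (- (v * y ^+ 2)).
  rewrite mulrAC (mulrAC k) -[RHS]IH; congr radial.
  by apply/funext => t; rewrite mulrDr opprD expRD mulrA.
under eq_Rintegral do rewrite E1 mulrCA.
rewrite RintegralZl//; last first.
  apply: (integrable_gauss_poly v0 (p := fun y => cos (a * y))) => [|y y0].
    apply: measurableT_comp; first exact: (continuous_measurable_fun (@continuous_cos R)).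
    exact: measurable_funM.
  by apply: (le_trans (cos_max _)); rewrite lerDl ltW.
rewrite integral_cos_gauss// big_cons (mulrDl (a ^+ 2)) opprD expRD -/S -/E [S ^+ _.+1]exprS.
by field.
Qed.

(** The third clause is convexity in the form used below: the difference of two shifts of phi is
    itself nonincreasing, so one-dimensional bounds apply to it. *)
Definition convex_decr (phi : R -> R) : Prop :=
  [/\ forall s, 0 <= s -> 0 <= phi s,
      forall s t, 0 <= s -> s <= t -> phi t <= phi s &
      forall p q s t, 0 <= p -> p <= q -> 0 <= s -> s <= t ->
        phi (p + t) - phi (q + t) <= phi (p + s) - phi (q + s)].

Lemma rapidB (phi psi : R -> R) : rapid phi -> rapid psi ->
  rapid (fun t => phi t - psi t).
Proof.
move=> [m1 r1] [m2 r2]; split; first exact: measurable_funB.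
move=> N; have [C1 H1] := r1 N; have [C2 H2] := r2 N; exists (C1 + C2) => s s0.
by rewrite (le_trans (ler_normB _ _))// mulrDl lerD// ?H1 ?H2.
Qed.

Lemma integrable_radial_sq n (x : euclid R n) (phi : R -> R) : rapid phi ->
  mu.-integrable `]0, +oo[ (EFin \o (fun y => radial x (fun t => phi (y ^+ 2 + t)))).
Proof.
move=> rphi; have := integrable_radial x 0 rphi.
by apply: eq_integrable => // y _ /=; rewrite mul0r cos0 mul1r.
Qed.

Lemma integrable_sq (phi : R -> R) : rapid phi ->
  mu.-integrable `]0, +oo[ (EFin \o (fun y => phi (y ^+ 2))).
Proof.
move=> rphi; have := integrable_radial_sq [tuple] rphi.
by apply: eq_integrable => // y _ /=; rewrite addr0.
Qed.

Lemma integrable_cos_sq (a : R) (phi : R -> R) : rapid phi ->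
  mu.-integrable `]0, +oo[ (EFin \o (fun y => cos (a * y) * phi (y ^+ 2))).
Proof.
move=> rphi; have := integrable_radial [tuple] a rphi.
by apply: eq_integrable => // y _ /=; rewrite addr0.
Qed.

Lemma radial1E (a : R) (phi : R -> R) :
  radial [:: a] phi = 2 * \int[mu]_(y in `]0, +oo[) (cos (a * y) * phi (y ^+ 2)).
Proof. by rewrite /=; under eq_Rintegral do rewrite addr0. Qed.

Lemma radial1_bound (a : R) (phi : R -> R) : a != 0 -> rapid phi ->
  (forall s, 0 <= s -> 0 <= phi s) ->
  (forall s t, 0 <= s -> s <= t -> phi t <= phi s) ->
  `|radial [:: a] phi| <= 2 * (pi / `|a|) * phi 0.
Proof.
move=> a0 rphi p0 pd; rewrite radial1E normrM (ger0_norm (ler0n _ _)) -mulrA ler_wpM2l//.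
apply: cos_integral_bound => //.
- exact: integrable_sq.
- by move=> y y0; rewrite p0 ?sqr_ge0// pd// sqr_ge0.
- move=> y z y0 yz; apply: pd; rewrite ?sqr_ge0// lerXn2r// nnegrE ltW//.
  exact: lt_le_trans yz.
Qed.

Lemma radial1B (a : R) (phi psi : R -> R) : rapid phi -> rapid psi ->
  radial [:: a] (fun t => phi t - psi t) = radial [:: a] phi - radial [:: a] psi.
Proof.
move=> r1 r2; rewrite !radial1E -mulrBr; congr (_ * _).
rewrite -RintegralB//; try exact: integrable_cos_sq.
by under [in RHS]eq_Rintegral do rewrite -mulrBr.
Qed.

(* Adding (2 pi / |b|) phi(y^2) to the inner integral makes it a nonnegative
   nonincreasing function of the outer variable y, because phi is convex. *)
Lemma radial2_bound (a b : R) (phi : R -> R) : a != 0 -> b != 0 -> rapid phi ->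
  convex_decr phi ->
  `|radial [:: a; b] phi| <= 6 * (pi / `|a|) * (2 * (pi / `|b|)) * phi 0.
Proof.
move=> a0 b0 rphi [p0 pd pc].
set c := 2 * (pi / `|b|).
have c0 : 0 <= c by rewrite mulr_ge0// divr_ge0// pi_ge0.
have Pa : 0 <= pi / `|a| by rewrite divr_ge0// pi_ge0.
pose K (y : R) : R := radial [:: b] (fun t => phi (y ^+ 2 + t)) + c * phi (y ^+ 2).
have rs (y : R) : rapid (fun t => phi (y ^+ 2 + t)) by apply: rapid_shift => //; exact: sqr_ge0.
have B1 (y : R) : `|radial [:: b] (fun t => phi (y ^+ 2 + t))| <= c * phi (y ^+ 2).
  have := @radial1_bound b (fun t => phi (y ^+ 2 + t)) b0 (rs y).
  rewrite addr0; apply.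
    by move=> s s0; rewrite p0// addr_ge0// sqr_ge0.
  by move=> s t s0 st; rewrite pd// ?lerD2l// addr_ge0// sqr_ge0.
have i1 : mu.-integrable `]0, +oo[ (EFin \o (fun y => radial [:: b] (fun t => phi (y ^+ 2 + t)))).
  exact: (integrable_radial_sq [tuple b] rphi).
have i2 := integrableZl_EFin c mI (integrable_sq rphi).
have iK : mu.-integrable `]0, +oo[ (EFin \o K) by exact: integrableD_EFin.
have sq (y z : R) : 0 < y -> y <= z -> y ^+ 2 <= z ^+ 2.
  by move=> y0 yz; rewrite lerXn2r// nnegrE ltW//; exact: lt_le_trans yz.
have K1 : `|\int[mu]_(y in `]0, +oo[) (cos (a * y) * K y)| <= pi / `|a| * (2 * c * phi 0).
  apply: cos_integral_bound => //.
    move=> y y0; have := B1 y; rewrite ler_norml => /andP[l1 l2].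
    have : phi (y ^+ 2) <= phi 0 by rewrite pd// sqr_ge0.
    move=> /(ler_wpM2l c0) l3; rewrite /K; apply/andP; split; first by lra.
    by rewrite -(mulrA 2); lra.
  move=> y z y0 yz; rewrite /K -subr_ge0.
  have E : radial [:: b] (fun t => phi (y ^+ 2 + t)) -
      radial [:: b] (fun t => phi (z ^+ 2 + t)) =
      radial [:: b] (fun t => phi (y ^+ 2 + t) - phi (z ^+ 2 + t)).
    by rewrite radial1B.
  have := @radial1_bound b (fun t => phi (y ^+ 2 + t) - phi (z ^+ 2 + t)) b0
    (rapidB (rs y) (rs z)) _ _.
  rewrite -E !addr0 => H.
  have : `|radial [:: b] (fun t : R => phi (y ^+ 2 + t)) -
     radial [:: b] (fun t : R => phi (z ^+ 2 + t))| <= c * (phi (y ^+ 2) - phi (z ^+ 2)).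
    apply: H.
      move=> s s0; rewrite subr_ge0 pd ?lerD2r ?sq//.
      by rewrite addr_ge0// sqr_ge0.
    by move=> s t s0 st; apply: pc => //; rewrite ?sqr_ge0 ?sq.
  by rewrite ler_norml mulrBr => /andP[l1 l2]; lra.
have K2 : `|\int[mu]_(y in `]0, +oo[) (cos (a * y) * phi (y ^+ 2))| <= pi / `|a| * phi 0.
  apply: cos_integral_bound => //.
  - exact: integrable_sq.
  - by move=> y y0; rewrite p0 ?sqr_ge0// pd// sqr_ge0.
  - by move=> y z y0 yz; rewrite pd ?sq// sqr_ge0.
have icK : mu.-integrable `]0, +oo[ (EFin \o (fun y => cos (a * y) *
    radial [:: b] (fun t => phi (y ^+ 2 + t)))).
  exact: (integrable_radial [tuple b] a rphi).
have icp := integrableZl_EFin c mI (integrable_cos_sq a rphi).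
have E : \int[mu]_(y in `]0, +oo[) (cos (a * y) * K y) =
    \int[mu]_(y in `]0, +oo[) (cos (a * y) * radial [:: b] (fun t => phi (y ^+ 2 + t))) +
    c * \int[mu]_(y in `]0, +oo[) (cos (a * y) * phi (y ^+ 2)).
  rewrite -RintegralZl//; last exact: integrable_cos_sq.
  rewrite -RintegralD//; apply: eq_Rintegral => y _.
  by rewrite /K; ring.
have -> : radial [:: a; b] phi = 2 * \int[mu]_(y in `]0, +oo[) (cos (a * y) *
    radial [:: b] (fun t => phi (y ^+ 2 + t))) by [].
move: E K1 K2.
move: (\int[mu]_(y in `]0, +oo[) (cos (a * y) * K y)) => X.
move: (\int[mu]_(y in `]0, +oo[) (cos (a * y) * radial [:: b] (fun t => phi (y ^+ 2 + t)))) => Y.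
move: (\int[mu]_(y in `]0, +oo[) (cos (a * y) * phi (y ^+ 2))) => Z E K1 K2.
(* Since |X| <= (pi/|a|) 2c phi(0) and |Z| <= (pi/|a|) phi(0), the quantity 2(|X| + c|Z|) produces
   the constant 6. *)
have -> : Y = X - c * Z by rewrite E; ring.
rewrite normrM (ger0_norm (ler0n _ _)).
apply: (@le_trans _ _ (2 * (`|X| + c * `|Z|))).
  rewrite ler_wpM2l// (le_trans (ler_normB _ _))// lerD2l normrM.
  by rewrite (ger0_norm c0).
have := ler_wpM2l c0 K2; lra.
Qed.

(** Oscillation is exploited in the last two variables only; the first is integrated in absolute
    value, at the cost of the integral of phi(y^2). *)
Lemma radial3_bound (a b c : R) (phi : R -> R) : b != 0 -> c != 0 -> rapid phi ->
  convex_decr phi ->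
  `|radial [:: a; b; c] phi| <= 2 * (6 * (pi / `|b|) * (2 * (pi / `|c|))) *
    \int[mu]_(y in `]0, +oo[) phi (y ^+ 2).
Proof.
move=> b0 c0 rphi [p0 pd pc].
set D := 6 * _ * _.
have i0 : mu.-integrable `]0, +oo[ (EFin \o (fun y => cos (a * y) *
    radial [:: b; c] (fun t => phi (y ^+ 2 + t)))).
  exact: (integrable_radial [tuple b; c] a rphi).
have -> : radial [:: a; b; c] phi = 2 * \int[mu]_(y in `]0, +oo[) (cos (a * y) *
    radial [:: b; c] (fun t => phi (y ^+ 2 + t))) by [].
rewrite normrM (ger0_norm (ler0n _ _)) -mulrA ler_wpM2l//.
apply: (le_trans (le_normr_Rintegral mI i0)).
rewrite -RintegralZl//; last exact: integrable_sq.
apply: le_Rintegral => //.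
- exact: (integrable_norm i0).
- exact: (integrableZl_EFin D mI (integrable_sq rphi)).
move=> y _; rewrite normrM.
apply: (@le_trans _ _ `|radial [:: b; c] (fun t => phi (y ^+ 2 + t))|).
  by rewrite ler_piMl// cos_max.
have := @radial2_bound b c (fun t => phi (y ^+ 2 + t)) b0 c0.
rewrite addr0 -/D; apply; first by apply: rapid_shift => //; exact: sqr_ge0.
split.
- by move=> s s0; rewrite p0// addr_ge0// sqr_ge0.
- by move=> s t s0 st; rewrite pd// ?lerD2l// addr_ge0// sqr_ge0.
- move=> p q s t hp pq s0 st; rewrite !addrA; apply: pc => //; last by rewrite lerD2l.
  by rewrite addr_ge0// sqr_ge0.
Qed.

End radial_bounds.

(** * Concavity of powers and the multipliers exp(-t symbol) *)

Section symbol_semigroup.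
Context {R : realType}.
Notation mu := (@lebesgue_measure R).

(** The concave power lies below its tangent at z0. This is Young's inequality for z^b and z0^(1-b)
    with exponents 1/b and 1/(1-b), divided by z0^(1-b). *)
Lemma powR_tangent (b z z0 : R) : 0 < b < 1 -> 0 <= z -> 0 < z0 ->
  z `^ b <= b * z0 `^ (b - 1) * z + (1 - b) * z0 `^ b.
Proof.
move=> /andP[b0 b1] zge0 z00.
have q0 : 0 < (1 - b)^-1 by rewrite invr_gt0; lra.
have pq : b^-1^-1 + (1 - b)^-1^-1 = 1 by rewrite !invrK; ring.
have bi0 : 0 < b^-1 by rewrite invr_gt0.
have := conjugate_powR (powR_ge0 z b) (powR_ge0 z0 (1 - b)) bi0 q0 pq.
rewrite -!powRrM !invrK divff ?gt_eqF// divff ?gt_eqF ?subr_gt0// !powRr1 ?(ltW z00)//.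
have z0b : 0 < z0 `^ (b - 1) by exact: powR_gt0.
have e1 : z0 `^ (1 - b) * z0 `^ (b - 1) = 1.
  rewrite -powRD; last by rewrite (gt_eqF z00) implybT.
  by rewrite (_ : 1 - b + (b - 1) = 0) ?powRr0//; ring.
move=> /(ler_wpM2r (ltW z0b)) H; have {H} : z `^ b <= (z * b + z0 * (1 - b)) * z0 `^ (b - 1).
  by apply: le_trans H; rewrite -mulrA e1 mulr1.
move=> H; apply: (le_trans H).
have -> : z0 `^ b = z0 * z0 `^ (b - 1) by rewrite mulr_powRB1// ltW.
by rewrite le_eqVlt; apply/orP; left; apply/eqP; ring.
Qed.

(** Jensen's inequality with weights i and j of arbitrary sum, from the tangent at the mean z. The
    case z = 0, where there is no tangent, forces i u and j w to vanish. *)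
Lemma powR_concave2 (b i j u w z : R) : 0 < b < 1 -> 0 <= i -> 0 <= j ->
  0 <= u -> 0 <= w -> 0 <= z -> (i + j) * z = i * u + j * w ->
  i * u `^ b + j * w `^ b <= (i + j) * z `^ b.
Proof.
move=> b01 i0 j0 u0 w0; have /andP[b0 b1] := b01.
rewrite le_eqVlt => /predU1P[<-|z0] E.
  have iu : 0 <= i * u by exact: mulr_ge0.
  have jw : 0 <= j * w by exact: mulr_ge0.
  have Z (k v : R) : k * v = 0 -> k * v `^ b = 0.
    by move=> /eqP; rewrite mulf_eq0 => /orP[] /eqP ->; rewrite ?mul0r// powR0 ?gt_eqF// mulr0.
  by rewrite !Z ?addr0 ?mulr_ge0 ?addr_ge0 ?powR_ge0//; lra.
have H1 := ler_wpM2l i0 (powR_tangent b01 u0 z0).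
have H2 := ler_wpM2l j0 (powR_tangent b01 w0 z0).
apply: (le_trans (lerD H1 H2)).
rewrite le_eqVlt; apply/orP; left; apply/eqP.
have zb : z `^ b = z * z `^ (b - 1) by rewrite mulr_powRB1// ltW.
rewrite zb.
transitivity (b * z `^ (b - 1) * (i * u + j * w) + (i + j) * (1 - b) * (z * z `^ (b - 1))).
  by ring.
by rewrite -E; ring.
Qed.

(** p + t and q + s are the two convex combinations of p + s and q + t with weights t - s and q - p
    exchanged; add the two Jensen inequalities. *)
Lemma powR_concave4 (b p q s t : R) : 0 < b < 1 -> 0 <= p -> p <= q -> 0 <= s -> s <= t ->
  (q + t) `^ b - (p + t) `^ b <= (q + s) `^ b - (p + s) `^ b.
Proof.
move=> b01 p0 pq s0 st.
have q0 : 0 <= q by exact: le_trans pq.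
have t0 : 0 <= t by exact: le_trans st.
have [E|D0] := eqVneq ((q - p) + (t - s)) 0.
  have -> : q = p by lra.
  by rewrite !subrr.
have D : 0 < (q - p) + (t - s) by rewrite lt_neqAle eq_sym D0 addr_ge0 ?subr_ge0.
have i0 : 0 <= q - p by rewrite subr_ge0.
have j0 : 0 <= t - s by rewrite subr_ge0.
have H1 := @powR_concave2 b (q - p) (t - s) (p + s) (q + t) (p + t) b01 i0 j0
  (addr_ge0 p0 s0) (addr_ge0 q0 t0) (addr_ge0 p0 t0) ltac:(ring).
have H2 := @powR_concave2 b (t - s) (q - p) (p + s) (q + t) (q + s) b01 j0 i0
  (addr_ge0 p0 s0) (addr_ge0 q0 t0) (addr_ge0 q0 s0) ltac:(ring).
rewrite lerBlDr addrAC -lerBlDr opprK -(ler_pM2l D); move: H1 H2; lra.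
Qed.

(** With b = alpha/2, M = m^(1/b) and s = |y|^2, the value at e = 0 is the multiplier of the
    semigroup at time t; e > 0 adds the Gaussian regularization e^(-e|y|^2). *)
Definition hphi (b M m t e s : R) : R := expR (- (t * ((s + M) `^ b - m) + e * s)).

Lemma measurable_hphi b M m t e : measurable_fun setT (hphi b M m t e).
Proof.
apply: measurableT_comp => //; apply: measurableT_comp => //.
apply: measurable_funD; last exact: measurable_funM.
apply: measurable_funM => //; apply: measurable_funB => //.
by apply: (measurableT_comp (measurable_powR b)); exact: measurable_funD.
Qed.

(** This is e^(-G) with G increasing and concave. The difference between the values at x and y is
    e^(-G(x)) (1 - e^(-(G(y) - G(x)))), and shifting x and y together decreases both factors. *)
Lemma hphi_convex_decr b M m t e : 0 < b < 1 -> 0 <= M -> 0 <= t -> 0 <= e ->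
  convex_decr (hphi b M m t e).
Proof.
move=> b01 M0 t0 e0; have /andP[b0 b1] := b01.
have mono (s s' : R) : 0 <= s -> s <= s' -> (s + M) `^ b <= (s' + M) `^ b.
  move=> s0 ss; apply: ge0_ler_powR; rewrite ?nnegrE ?addr_ge0 ?(ltW b0)//.
    exact: le_trans ss.
  by rewrite lerD2r.
have G1 (s s' : R) : 0 <= s -> s <= s' ->
    t * ((s + M) `^ b - m) + e * s <= t * ((s' + M) `^ b - m) + e * s'.
  by move=> s0 ss; rewrite lerD ?ler_wpM2l// lerD2r mono.
split.
- by move=> s s0; exact: expR_ge0.
- by move=> s s' s0 ss; rewrite /hphi ler_expR lerN2 G1.
move=> p q s s' p0 pq s0 ss.
have q0 : 0 <= q by exact: le_trans pq.
have E (x y : R) : hphi b M m t e x - hphi b M m t e y = hphi b M m t e x *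
    (1 - expR (- ((t * ((y + M) `^ b - m) + e * y) - (t * ((x + M) `^ b - m) + e * x)))).
  rewrite mulrBr mulr1 -expRD; congr (_ - expR _); ring.
rewrite !E; apply: ler_pM => //.
- exact: expR_ge0.
- rewrite subr_ge0 -expR0 ler_expR oppr_le0 subr_ge0 G1 ?lerD2r// addr_ge0//.
  exact: le_trans ss.
- by rewrite /hphi ler_expR lerN2 G1 ?lerD2l// addr_ge0.
rewrite lerD2l lerN2 ler_expR lerN2.
have H := @powR_concave4 b p q (s + M) (s' + M) b01 p0 pq (addr_ge0 s0 M0).
have {}H := ler_wpM2l t0 (H _); rewrite !addrA in H.
rewrite lerD2r in H; have := H ss; lra.
Qed.

(** The constant is uniform in e. By subadditivity (1+s)^b <= 1 + s^b, so the decay is that of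
    e^(-t(1+s)^b), which beats every power of 1+s. *)
Lemma hphi_bound b M m t N : 0 < b < 1 -> 0 <= M -> 0 < t ->
  exists C : R, forall e s, 0 <= e -> 0 <= s -> `|hphi b M m t e s| <= C * (1 + s) ^- N.
Proof.
move=> b01 M0 t0; have /andP[b0 b1] := b01.
have Nb0 : 0 <= N%:R / b by rewrite divr_ge0// ltW.
have [C C0 HC] := powR_le_expR Nb0 t0.
exists (expR (t * m) * (expR t * C)) => e s e0 s0.
have s1 : 0 < 1 + s by rewrite ltr_pwDl.
rewrite ger0_norm ?expR_ge0// /hphi.
apply: (@le_trans _ _ (expR (t * m) * expR (- (t * s `^ b)))).
  rewrite -expRD ler_expR.
  have : s `^ b <= (s + M) `^ b.
    by apply: ge0_ler_powR; rewrite ?nnegrE ?addr_ge0 ?(ltW b0)// lerDl.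
  move=> /(ler_wpM2l (ltW t0)) H; have := mulr_ge0 e0 s0; lra.
rewrite -!mulrA ler_wpM2l ?expR_ge0//.
have sub : (1 + s) `^ b <= 1 + s `^ b.
  have := @powR_concave4 b 0 s 0 1 b01 (lexx _) s0 (lexx _) ler01.
  by rewrite !add0r !addr0 powR1 powR0 ?gt_eqF// subr0 (addrC s) => ?; lra.
apply: (@le_trans _ _ (expR t * expR (- (t * (1 + s) `^ b)))).
  rewrite -expRD ler_expR; move: (ler_wpM2l (ltW t0) sub); lra.
rewrite ler_wpM2l ?expR_ge0// expRN -div1r ler_pdivrMr ?expR_gt0//.
rewrite mulrAC ler_pdivlMr ?exprn_gt0// mul1r.
have := HC ((1 + s) `^ b) (powR_ge0 _ _).
by rewrite -powRrM mulrC divfK ?gt_eqF// powR_mulrn// ltW.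
Qed.

Lemma hphi_rapid b M m t e : 0 < b < 1 -> 0 <= M -> 0 < t -> 0 <= e ->
  rapid (hphi b M m t e).
Proof.
move=> b01 M0 t0 e0; split; first exact: measurable_hphi.
move=> N; have [C HC] := hphi_bound m N b01 M0 t0.
by exists C => s s0; exact: HC.
Qed.

End symbol_semigroup.

(** * Bounding the heat kernel in time *)

Section radial_time_bound.
Context {R : realType}.
Notation mu := (@lebesgue_measure R).

Lemma powR_inv_cancel (b m : R) : 0 < b -> 0 <= m -> (m `^ b^-1) `^ b = m.
Proof. by move=> b0 m0; rewrite -powRrM mulVf ?gt_eqF// powRr1. Qed.

Lemma hphi_le1 (b m t e s : R) : 0 < b < 1 -> 0 <= m -> 0 <= t -> 0 <= e -> 0 <= s ->
  hphi b (m `^ b^-1) m t e s <= 1.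
Proof.
move=> b01 m0 t0 e0 s0; have /andP[b0 b1] := b01.
have [_ H _] := hphi_convex_decr m b01 (powR_ge0 m b^-1) t0 e0.
apply: (le_trans (H 0 s (lexx _) s0)).
by rewrite /hphi add0r powR_inv_cancel// subrr !mulr0 addr0 oppr0 expR0.
Qed.

(** Dividing by s^b turns the claim into (1+M)^b - M^b <= (1+M/s)^b - (M/s)^b, which is concavity as
    M/s <= M. *)
Let symbol_lower (b m s : R) : 0 < b < 1 -> 0 <= m -> 1 <= s ->
  ((1 + m `^ b^-1) `^ b - m) * s `^ b <= (s + m `^ b^-1) `^ b - m.
Proof.
move=> b01 m0 s1; have /andP[b0 b1] := b01.
have s0 : 0 < s by exact: lt_le_trans s1.
set M := m `^ b^-1; have M0 : 0 <= M by exact: powR_ge0.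
have r0 : 0 <= M / s by rewrite divr_ge0// ltW.
have rM : M / s <= M by rewrite ler_piMr// invf_le1.
have := @powR_concave4 R b 0 1 (M / s) M b01 (lexx _) ler01 r0 rM.
rewrite !add0r /M powR_inv_cancel// -/M.
move=> /(ler_wpM2r (powR_ge0 s b)) H; apply: (le_trans H).
rewrite mulrBl -!powRM ?addr_ge0 ?(ltW s0)//.
by rewrite mulrDl mul1r divfK ?gt_eqF// /M powR_inv_cancel.
Qed.

Let symbol_lower_gt0 (b m : R) : 0 < b < 1 -> 0 <= m -> 0 < (1 + m `^ b^-1) `^ b - m.
Proof.
move=> /andP[b0 b1] m0; rewrite -{2}(powR_inv_cancel b0 m0) subr_gt0.
apply: gt0_ltr_powR; rewrite ?nnegrE ?addr_ge0 ?powR_ge0// ltrDr//.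
Qed.

Let cutoff (q y : R) : R := if y <= 1 then 1 else y `^ (- q).

Let integrable_cutoff (q : R) : 1 < q ->
  mu.-integrable `]0, +oo[ (EFin \o cutoff q).
Proof.
move=> q1; apply: (@integrable_oy R _ 1 (q - 1) 1) => //; first by rewrite subr_gt0.
- by apply: measurable_fun_ifT => //; exact: measurable_fun_ler.
- by move=> u /andP[u0 u1]; rewrite /cutoff u1 subrr powRr0 mulr1 normr1.
- move=> u u1; rewrite mul1r (_ : - (q - 1) - 1 = - q); last by ring.
  rewrite /cutoff; case: ifPn => [u2|_]; last by rewrite ger0_norm// powR_ge0.
  have -> : u = 1 by apply/eqP; rewrite eq_le u1 u2.
  by rewrite powR1 normr1.
Qed.

(** For y <= 1 the multiplier is at most 1. For y > 1 it is at most e^(-v) with v = t c y^(2b), and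
    e^(-v) <= C v^(-p). *)
Let hphi_cutoff (b m p : R) : 0 < b < 1 -> 0 <= m -> 0 < p ->
  exists2 C : R, 0 <= C & forall t e y, 0 < t -> 0 <= e -> 0 < y ->
    hphi b (m `^ b^-1) m t e (y ^+ 2) <= C * (1 + t `^ (- p)) * cutoff (2 * b * p) y.
Proof.
move=> b01 m0 p0; have /andP[b0 b1] := b01.
have [C C0 HC] := powR_le_expR (ltW p0) (@ltr01 R).
have c0 := symbol_lower_gt0 b01 m0; set c := _ - m in c0.
exists (1 + C * c `^ (- p)) => [|t e y t0 e0 y0].
  by rewrite addr_ge0// mulr_ge0// ?powR_ge0 ?ltW.
have D0 : 0 <= C * c `^ (- p) by rewrite mulr_ge0 ?powR_ge0// ltW.
have T0 : 0 <= t `^ (- p) by exact: powR_ge0.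
rewrite /cutoff; case: (leP y 1) => y1.
  apply: (le_trans (hphi_le1 b01 m0 (ltW t0) e0 (sqr_ge0 y))).
  by rewrite mulr1; have := mulr_ge0 D0 T0; lra.
have y2 : 1 <= y ^+ 2 by rewrite expr_ge1 ?(ltW y0)// ltW.
have L := symbol_lower b01 m0 y2; rewrite -/c in L.
pose v := t * (c * (y ^+ 2) `^ b).
have yb0 : 0 < (y ^+ 2) `^ b by rewrite powR_gt0// exprn_gt0.
have v0 : 0 < v by rewrite !mulr_gt0.
apply: (@le_trans _ _ (expR (- v))).
  rewrite ler_expR lerN2; have := ler_wpM2l (ltW t0) L.
  by have := mulr_ge0 e0 (sqr_ge0 y); rewrite /v; lra.
apply: (@le_trans _ _ (C * v `^ (- p))).
  rewrite powRN expRN -div1r ler_pdivrMr ?expR_gt0// mulrAC ler_pdivlMr ?powR_gt0// mul1r.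
  by have := HC v (ltW v0); rewrite mul1r.
have -> : v `^ (- p) = t `^ (- p) * (c `^ (- p) * y `^ (- (2 * b * p))).
  have cy : 0 <= c * (y ^+ 2) `^ b by rewrite mulr_ge0// ltW.
  rewrite /v (powRM _ (ltW t0) cy) (powRM _ (ltW c0) (ltW yb0)).
  by rewrite -powR_mulrn ?(ltW y0)// -!powRrM; do 2!congr (_ * _); congr (_ `^ _); ring.
have Y0 : 0 <= y `^ (- (2 * b * p)) by exact: powR_ge0.
rewrite [leLHS](_ : _ = (C * c `^ (- p)) * t `^ (- p) * y `^ (- (2 * b * p))); last by ring.
rewrite ler_wpM2r//; have := mulr_ge0 D0 T0; lra.
Qed.

(** d < 4b < 4 leaves d <= 3. For d <= 2 the oscillation bounds are uniform in t. For d = 3 the one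
    variable integrated in absolute value costs t^(-p) with p above 1/(2b), and p < 1 is possible
    because 2b > 3/2. *)
Lemma radial_hphi_bound (b m : R) d (x : euclid R d) : 0 < b < 1 -> d%:R < 4 * b ->
  0 <= m -> (forall i, tnth x i != 0) ->
  exists C p : R, [/\ 0 <= C, 0 < p < 1 & forall t e, 0 < t -> 0 <= e ->
    `|radial x (hphi b (m `^ b^-1) m t e)| <= C * (1 + t `^ (- p))].
Proof.
move=> b01 db m0 x0; have /andP[b0 b1] := b01.
have small (C : R) : 0 <= C -> (forall t e : R, 0 < t -> 0 <= e ->
    `|radial x (hphi b (m `^ b^-1) m t e)| <= C * hphi b (m `^ b^-1) m t e 0) ->
  exists C p : R, [/\ 0 <= C, 0 < p < 1 & forall t e, 0 < t -> 0 <= e ->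
    `|radial x (hphi b (m `^ b^-1) m t e)| <= C * (1 + t `^ (- p))].
  (* A bound uniform in t fits with any exponent; 1/2 is one choice. *)
  move=> C0 HC; exists C, 2^-1; split => //; first by apply/andP; split; lra.
  move=> t e t0 e0; apply: (le_trans (HC t e t0 e0)); rewrite ler_wpM2l//.
  apply: (le_trans (hphi_le1 b01 m0 (ltW t0) e0 (lexx _))).
  by rewrite lerDl powR_ge0.
have rap (t e : R) : 0 < t -> 0 <= e -> rapid (hphi b (m `^ b^-1) m t e).
  by move=> t0 e0; apply: hphi_rapid => //; exact: powR_ge0.
have cd (t e : R) : 0 < t -> 0 <= e -> convex_decr (hphi b (m `^ b^-1) m t e).
  by move=> t0 e0; apply: hphi_convex_decr => //; [exact: powR_ge0|exact: ltW].
have pi0 (a : R) : 0 <= pi / `|a| by rewrite divr_ge0// pi_ge0.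
have : (d < 4)%N by rewrite -(ltr_nat R); lra.
case: d x db x0 small => [|[|[|[|//]]]] x db x0 small _.
- apply: (small 1) => // t e t0 e0; rewrite tuple0 /= mul1r ger0_norm//.
  exact: expR_ge0.
- case/tupleP: x x0 small => x1 x x0 small.
  rewrite (tuple0 x) /= in x0 small *.
  have h1 : x1 != 0 by have := x0 ord0; rewrite tnth0.
  apply: (small (2 * (pi / `|x1|))) => [|t e t0 e0]; first exact: mulr_ge0.
  have [p0 pd _] := cd t e t0 e0.
  exact: (radial1_bound h1 (rap t e t0 e0) p0 pd).
- case/tupleP: x x0 small => x1 x; case/tupleP: x => x2 x x0 small.
  rewrite (tuple0 x) /= in x0 small *.
  have h1 : x1 != 0 by have := x0 ord0; rewrite tnth0.
  have h2 : x2 != 0 by have := x0 (lift ord0 ord0); rewrite tnthS tnth0.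
  apply: (small (6 * (pi / `|x1|) * (2 * (pi / `|x2|)))) => [|t e t0 e0].
    by rewrite !mulr_ge0 ?pi_ge0 ?invr_ge0.
  exact: (radial2_bound h1 h2 (rap t e t0 e0) (cd t e t0 e0)).
case/tupleP: x x0 small => x1 x; case/tupleP: x => x2 x; case/tupleP: x => x3 x x0 _.
rewrite (tuple0 x) /= in x0 *.
have h2 : x2 != 0 by have := x0 (lift ord0 ord0); rewrite tnthS tnth0.
have h3 : x3 != 0 by have := x0 (lift ord0 (lift ord0 ord0)); rewrite !tnthS tnth0.
(* The midpoint of 1/(2b) and 1: p > 1/(2b) makes [cutoff (2 * b * p)] integrable, and p < 1 makes
   t^(-p) integrable at 0. *)
pose p : R := ((2 * b)^-1 + 1) / 2.
have i1 : (2 * b)^-1 < 1 by rewrite invf_lt1; lra.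
have i0 : 0 < (2 * b)^-1 by rewrite invr_gt0; lra.
have p0 : 0 < p by rewrite /p; lra.
have q1 : 1 < 2 * b * p.
  have -> : 2 * b * p = (1 + 2 * b) / 2 by rewrite /p; field; rewrite gt_eqF.
  by lra.
have [C C0 HC] := hphi_cutoff b01 m0 p0.
set B := 2 * (6 * (pi / `|x2|) * (2 * (pi / `|x3|))).
have B0 : 0 <= B by rewrite !mulr_ge0 ?pi_ge0 ?invr_ge0.
pose I := \int[mu]_(y in `]0, +oo[) cutoff (2 * b * p) y.
have I0 : 0 <= I.
  by apply: Rintegral_ge0 => y _; rewrite /cutoff; case: ifP => // _; exact: powR_ge0.
have mI : measurable (`]0%R, +oo[%classic : set (measurableTypeR R)).
  exact: measurable_itv.
exists (B * (C * I)), p; split => [||t e t0 e0]; first exact: mulr_ge0 B0 (mulr_ge0 C0 I0).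
  by apply/andP; split => //; rewrite /p; lra.
have H := radial3_bound x1 h2 h3 (rap t e t0 e0) (cd t e t0 e0); rewrite -/B in H.
apply: (le_trans H); rewrite -mulrA ler_wpM2l// mulrAC.
rewrite /I -RintegralZl//; last exact: integrable_cutoff.
apply: le_Rintegral => //.
- exact: integrable_sq (rap t e t0 e0).
- by apply: integrableZl_EFin => //; exact: integrable_cutoff.
- by move=> y; rewrite /= in_itv/= andbT => y0; exact: HC.
Qed.

End radial_time_bound.

(** * The subordination formula with Gaussian regularization *)

Section resolvent_regularized.
Context {R : realType}.
Notation mu := (@lebesgue_measure R).

Let mI : measurable (`]0%R, +oo[%classic : set (measurableTypeR R)).
Proof. exact: measurable_itv. Qed.

Lemma measurable_expRNM (c : R) (D : set R) :
  measurable_fun D (fun u : R => expR (- (c * u))).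
Proof.
apply: measurable_funTS; apply: continuous_measurable_fun => u.
exact: (is_derive_for_continuous (is_derive_comp1 (is_derive_expR _)
  (is_deriveN1 (is_deriveZ1 c (is_derive_id u 1))))).
Qed.

Lemma cvg_powR_invn (a : R) : 0 < a -> (n.+2%:R^-1 : R) `^ a @[n --> \oo] --> (0 : R).
Proof.
move=> a0; have [_ H] := @tail_dom_cvg R 1 a a a0 a0.
apply: cvg_trans H; apply: near_eq_cvg; near=> n.
by rewrite /tail_dom mul1r invf_le1 ?ltr0n// ler1n.
Unshelve. all: end_near. Qed.

Lemma cvg_invn2 : (n.+2%:R^-1 : R) @[n --> \oo] --> (0 : R).
Proof.
have := cvg_powR_invn ltr01; apply: cvg_trans; apply: near_eq_cvg; near=> n.
by rewrite powRr1 ?invr_ge0.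
Unshelve. all: end_near. Qed.

Lemma integrable_kappa (b : R) : 0 < b -> mu.-integrable `]0, +oo[ (EFin \o kappa b).
Proof.
move=> b0; apply: (@integrable_oy R _ b b 1) => //; first exact: measurable_kappa.
- by move=> u /andP[u0 u1]; rewrite mul1r ger0_norm ?kappa_ge0// kappa_le.
- move=> u u1; rewrite mul1r ger0_norm ?kappa_ge0// /kappa; case: ifPn => // u2.
  have -> : u = 1 by apply/eqP; rewrite eq_le u1 u2.
  by rewrite !powR1.
Qed.

Lemma le_kappa_integrable (b C : R) (g : R -> R) : 0 < b -> measurable_fun setT g ->
  (forall u, 0 <= g u) -> (forall u, 0 < u -> g u <= C * kappa b u) ->
  mu.-integrable `]0, +oo[ (EFin \o g).
Proof.
move=> b0 mg g0 gC.
apply: (@le_integrable_EFin R _ (measurableTypeR R) mu _ _ (fun u => C * kappa b u)) => //.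
- exact: measurable_funTS.
- by move=> u; rewrite /= in_itv/= andbT => u0; rewrite ger0_norm// gC.
- exact: (integrableZl_EFin C mI (integrable_kappa b0)).
Qed.

(** The formula will be evaluated at s = |y|^2, which may be 0. That value is the limit along s =
    1/(n+2), by dominated convergence with majorant g. *)
Lemma laplace_at0 (b m l : R) (g : R -> R) : 0 < b < 1 -> 0 <= m -> 0 < l ->
  mu.-integrable `]0, +oo[ (EFin \o g) -> (forall u, 0 <= g u) ->
  (forall s, 0 < s -> (\int[mu]_(u in `]0%R, +oo[) (g u * expR (- (s * u)))%:E =
      ((l + ((s + m `^ b^-1) `^ b - m))^-1)%:E)%E) ->
  forall s, 0 <= s -> (\int[mu]_(u in `]0%R, +oo[) (g u * expR (- (s * u)))%:E =
      ((l + ((s + m `^ b^-1) `^ b - m))^-1)%:E)%E.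
Proof.
move=> b01 m0 l0 ig g0 L s; rewrite le_eqVlt => /predU1P[<-|]; last exact: L.
have /andP[b0 b1] := b01.
set M := m `^ b^-1; have M0 : 0 <= M by exact: powR_ge0.
under eq_integral do rewrite mul0r oppr0 expR0 mulr1.
pose f (n : nat) (u : R) : R := g u * expR (- (n.+2%:R^-1 * u)).
have mg : measurable_fun (`]0, +oo[%classic : set R) g.
  by apply/measurable_EFinP; case/integrableP: ig.
have H : (\int[mu]_(u in `]0%R, +oo[) (f n u)%:E @[n --> \oo] -->
   \int[mu]_(u in `]0%R, +oo[) (g u)%:E)%E.
  apply: (@dominated_cvg _ (measurableTypeR R) R mu `]0%R, +oo[%classic
    (measurable_itv _) _ _ (fun r => (g r)%:E)).
  - move=> n; apply/measurable_EFinP; apply: measurable_funM => //.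
    exact: measurable_expRNM.
  - move=> u _; apply: cvg_EFin; first by near=> n.
    rewrite -[X in _ --> X]mulr1; apply: cvgM; first exact: cvg_cst.
    have c0 : {for 0, continuous (fun x : R => expR (- (x * u)))}.
      exact: (is_derive_for_continuous (is_derive_comp1 (is_derive_expR _)
        (is_deriveN1 (is_deriveM1 (is_derive_id (0 : R) 1) (is_derive_cst u (0 : R) 1))))).
    have := continuous_cvg _ c0 cvg_invn2.
    by rewrite mul0r oppr0 expR0; apply.
  - by [].
  - exact: ig.
  - move=> n u; rewrite /= in_itv/= andbT => u0; rewrite lee_fin ger0_norm ?mulr_ge0 ?expR_ge0//.
    by rewrite ler_piMr// expR_le1 oppr_le0 mulr_ge0// ltW.
have E : (fun n => \int[mu]_(u in `]0%R, +oo[) (f n u)%:E)%E =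
    (fun n => ((l + ((n.+2%:R^-1 + M) `^ b - m))^-1)%:E).
  by apply/funext => n; rewrite /f L.
rewrite E in H.
have H2 : ((l + ((n.+2%:R^-1 + M) `^ b - m))^-1)%:E @[n --> \oo] -->
    ((l + ((0 + M) `^ b - m))^-1)%:E.
  apply: cvg_EFin; first by near=> n.
  apply: cvgV; first by rewrite add0r powR_inv_cancel// subrr addr0 gt_eqF.
  apply: cvgD; first exact: cvg_cst.
  apply: cvgB; last exact: cvg_cst.
  rewrite add0r.
  have S : M `^ b + (n.+2%:R^-1 : R) `^ b @[n --> \oo] --> M `^ b.
    rewrite -[X in _ --> X]addr0; apply: cvgD; first exact: cvg_cst.
    exact: cvg_powR_invn.
  (* (x+M)^b lies between M^b and M^b + x^b; this covers M = 0, that is m = 0, as well. *)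
  apply: (@squeeze_cvgr _ _ _ _ (fun=> M `^ b) (fun n => M `^ b + (n.+2%:R^-1 : R) `^ b));
    [|exact: cvg_cst|exact: S].
  near=> n; have e0 : 0 <= n.+2%:R^-1 :> R by rewrite invr_ge0.
  apply/andP; split.
    by apply: ge0_ler_powR; rewrite ?nnegrE ?addr_ge0 ?(ltW b0)// lerDr.
  have := @powR_concave4 R b 0 n.+2%:R^-1 0 M b01 (lexx _) e0 (lexx _) M0.
  by rewrite !addr0 !add0r powR0 ?gt_eqF// subr0; lra.
exact: (cvg_unique _ H H2).
Unshelve. all: end_near. Qed.

Lemma rapid_expRN (k v : R) : 0 < v -> rapid (fun t => k * expR (- (v * t))).
Proof.
move=> v0; split.
  by apply: measurable_funM => //; exact: measurable_expRNM.
move=> N; have [C C0 HC] := powR_le_expR (ler0n R N) v0.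
exists (`|k| * (expR v * C)) => s s0.
have s1 : 0 < 1 + s by rewrite ltr_pwDl.
rewrite normrM [ `|expR _| ]ger0_norm ?expR_ge0// -!mulrA ler_wpM2l//.
rewrite mulrA ler_pdivlMr ?exprn_gt0//.
have := HC (1 + s) (ltW s1); rewrite powR_mulrn ?(ltW s1)// mulrDr mulr1 expRD => H.
rewrite expRN mulrC ler_pdivrMr ?expR_gt0//; lra.
Qed.

Lemma integral_cos_radial d (x : euclid R d) (phi : R -> R) : rapid phi ->
  (\int[lebesgueE d]_y (cos (dotE x y) * phi (dotE y y))%:E = (radial x phi)%:E)%E.
Proof.
move=> rphi; have := radial_fourier x 0 rphi; rewrite cos0 mul1r => <-.
by apply: eq_integral => y _; rewrite add0r.
Qed.

(** The Fourier transform of e^(-w|y|^2) at a point with |x|^2 = q, without the factor (2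
    pi)^(-d). *)
Definition gauss_kernel (d : nat) (q w : R) : R :=
  Num.sqrt (pi / w) ^+ d * expR (- (q / (4 * w))).

Let measurable_cos_dot d1 (T : measurableType d1) d (x : euclid R d) (D : set T)
  (f : T -> euclid R d) : measurable_fun D f -> measurable_fun D (fun z => cos (dotE x (f z))).
Proof.
move=> mf; apply: measurableT_comp; first exact: (continuous_measurable_fun (@continuous_cos R)).
exact: (measurableT_comp (measurable_dotE x) mf).
Qed.

(** Integrate in t first: this gives 1/(l + symbol), which is the Laplace transform of g at |y|^2.
    Then integrate in y first: this leaves the Fourier transform of e^(-(u+e)|y|^2). The factor
    e^(-e|y|^2) makes both interchanges absolutely convergent. *)
Lemma resolvent_regularized (b m l e : R) (g : R -> R) d (x : euclid R d) :
  0 < b < 1 -> 0 <= m -> 0 < l -> 0 < e ->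
  measurable_fun setT g -> (forall u, 0 <= g u) ->
  (forall s, 0 <= s -> (\int[mu]_(u in `]0%R, +oo[) (g u * expR (- (s * u)))%:E =
      ((l + ((s + m `^ b^-1) `^ b - m))^-1)%:E)%E) ->
  (\int[mu]_(t in `]0%R, +oo[) (expR (- (l * t)) * radial x (hphi b (m `^ b^-1) m t e))%:E =
   \int[mu]_(u in `]0%R, +oo[) (g u * gauss_kernel d (dotE x x) (u + e))%:E)%E.
Proof.
move=> b01 m0 l0 e0 mg g0 L; have /andP[b0 b1] := b01.
set M := m `^ b^-1; have M0 : 0 <= M by exact: powR_ge0.
have Mb : M `^ b = m by exact: powR_inv_cancel.
have sym0 (s : R) : 0 <= s -> 0 <= (s + M) `^ b - m.
  move=> s0; rewrite subr_ge0 -Mb; apply: ge0_ler_powR; rewrite ?nnegrE ?addr_ge0 ?(ltW b0)//.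
  by rewrite lerDr.
have rap (t : R) : 0 < t -> rapid (hphi b M m t e).
  by move=> t0; apply: hphi_rapid => //; exact: ltW.
pose dd := (@dotE R d).
have mdd2 : measurable_fun setT (fun z : measurableTypeR R * euclid R d => dotE z.2 z.2).
  exact: (measurableT_comp (@measurable_dotEE R d) measurable_snd).
have mdd1 : measurable_fun setT (fun z : euclid R d * measurableTypeR R => dotE z.1 z.1).
  exact: (measurableT_comp (@measurable_dotEE R d) measurable_fst).
have mcx : measurable_fun setT (fun y : euclid R d => cos (dotE x y)).
  exact: (@measurable_cos_dot _ _ _ x setT id).
pose E (y : euclid R d) := expR (- (e * dotE y y)).
have E0 y : 0 <= E y by exact: expR_ge0.
have iE : (lebesgueE d).-integrable setT (EFin \o E).
  have := @rapid_integrable R d _ (fun=> 1) (rapid_expRN 1 e0) (measurable_cst _).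
  have n1 (y : euclid R d) : `|1 : R| <= 1 by rewrite normr1.
  move=> /(_ n1); apply: eq_integrable => // y _.
  by rewrite /= !mul1r.
have mE : measurable_fun setT E by apply/measurable_EFinP; case/integrableP: iE.
pose IE : R := fine (\int[lebesgueE d]_y (E y)%:E).
have IEE : (\int[lebesgueE d]_y (E y)%:E = IE%:E)%E.
  by rewrite fineK//; exact: (integrable_fin_num measurableT iE).
have IE0 : 0 <= IE by rewrite -lee_fin -IEE integral_ge0// => y _; rewrite lee_fin.
pose f1 (z : measurableTypeR R * euclid R d) : R :=
  expR (- (l * z.1)) * (cos (dotE x z.2) * hphi b M m z.1 e (dotE z.2 z.2)).
have mf1 : measurable_fun setT f1.
  apply: measurable_funM; first exact: (measurableT_comp (@measurable_expRNM l setT) measurable_fst).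
  apply: measurable_funM; first by apply: measurable_cos_dot; exact: measurable_snd.
  apply: measurableT_comp => //; apply: measurableT_comp => //.
  apply: measurable_funD; last exact: measurable_funM.
  apply: measurable_funM; first exact: measurable_fst.
  apply: measurable_funB => //.
  by apply: (measurableT_comp (measurable_powR b)); exact: measurable_funD.
have hE (t s : R) : 0 <= t -> 0 <= s -> hphi b M m t e s <= expR (- (e * s)).
  by move=> t0 s0; rewrite ler_expR lerN2 lerDr mulr_ge0// sym0.
have exp_int (s : R) : 0 < s -> mu.-integrable `]0, +oo[ (EFin \o (fun t => expR (- (s * t)))).
  move=> s0; apply: ge0_integrable_EFin => //; first exact: measurable_expRNM.
  by rewrite integral_expRN// ltry.
transitivity (\int[mu]_(t in `]0%R, +oo[) \int[lebesgueE d]_y (f1 (t, y))%:E)%E.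
  apply: eq_integral => t /set_mem; rewrite /= in_itv/= andbT => t0.
  rewrite EFinM -(integral_cos_radial x (rap t t0)) -integralZl//.
  have := @rapid_integrable R d _ (fun y => cos (dotE x y)) (rap t t0).
  by apply=> [|y]; [exact: mcx|exact: cos_max].
(* First interchange, t with y; the integrand is dominated by e^(-lt) e^(-e|y|^2). *)
rewrite (@fubini_on _ _ _ _ R mu (lebesgueE d) `]0, +oo[%classic setT mI measurableT f1)//; last first.
  apply: (@le_lt_trans _ _ (\int[mu]_(t in `]0%R, +oo[) (expR (- (l * t)) * IE)%:E)%E).
    apply: ge0_le_integral => //.
    - by move=> t _; apply: integral_ge0 => y _; rewrite lee_fin.
    - have := @measurable_fun_fubini_tonelli_F _ _ _ _ R (lebesgueE d)
        (fun z : measurableTypeR R * euclid R d => (`|f1 z|)%:E).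
      move=> H; apply: measurable_funTS; apply: H.
        by apply/measurable_EFinP; exact: measurableT_comp.
      by move=> z; rewrite lee_fin.
    - have mX : measurable_fun (`]0, +oo[%classic : set (measurableTypeR R))
          (fun t => expR (- (l * t)) * IE).
        by apply: measurable_funM => //; exact: measurable_expRNM.
      exact/measurable_EFinP.
    move=> t; rewrite /= in_itv/= andbT => t0.
    rewrite EFinM -IEE -ge0_integralZl_EFin//; last 2 first.
    - by move=> ? _; rewrite lee_fin.
    - exact/measurable_EFinP.
    apply: ge0_le_integral_EFin => //.
    - apply: measurableT_comp => //.
      exact: (measurableT_comp mf1 (measurable_pair1 t)).
    - exact: measurable_funM.
    move=> y _; rewrite /f1/= normrM (ger0_norm (expR_ge0 _)) ler_wpM2l ?expR_ge0//.
    rewrite normrM (ger0_norm (expR_ge0 _)) -[leRHS]mul1r.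
    by apply: ler_pM; rewrite ?expR_ge0 ?cos_max// hE ?dotEE_ge0// ltW.
  under eq_integral do rewrite EFinM.
  rewrite ge0_integralZr//; last first.
    by have /integrableP[] := exp_int l l0.
  by rewrite integral_expRN// -EFinM ltry.
pose f2 (z : euclid R d * measurableTypeR R) : R :=
  cos (dotE x z.1) * E z.1 * (g z.2 * expR (- (dotE z.1 z.1 * z.2))).
have mf2 : measurable_fun setT f2.
  apply: measurable_funM.
    apply: measurable_funM; first by apply: measurable_cos_dot; exact: measurable_fst.
    exact: (measurableT_comp mE measurable_fst).
  apply: measurable_funM; first exact: (measurableT_comp mg measurable_snd).
  apply: measurableT_comp => //; apply: measurableT_comp => //.
  exact: measurable_funM.
have gint (s : R) : 0 <= s ->
    mu.-integrable `]0, +oo[ (EFin \o (fun u => g u * expR (- (s * u)))).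
  move=> s0; apply: ge0_integrable_EFin => //.
  - by apply: measurable_funM; [exact: measurable_funTS|exact: measurable_expRNM].
  - by move=> u _; rewrite mulr_ge0 ?expR_ge0.
  - by rewrite L// ltry.
transitivity (\int[lebesgueE d]_y \int[mu]_(u in `]0%R, +oo[) (f2 (y, u))%:E)%E.
  apply: eq_integral => y _.
  have s0 := dotEE_ge0 y; have := sym0 _ s0; set S := _ - m => S0.
  have lS : 0 < l + S by rewrite ltr_wpDr.
  transitivity ((cos (dotE x y) * E y)%:E * ((l + S)^-1)%:E)%E; last first.
    rewrite -L// -integralZl//; last exact: gint.
  rewrite -integral_expRN// -integralZl//; last exact: exp_int.
  apply: eq_integral => t _; rewrite -EFinM /f1 /hphi /E /=; congr EFin.
  rewrite mulrCA -!mulrA -!expRD; congr (_ * expR _).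
  by rewrite -/S; ring.
(* Second interchange, y with u; the u-integral of the absolute value is at most e^(-e|y|^2)/l. *)
rewrite (@fubini_on _ _ _ _ R (lebesgueE d) mu setT `]0, +oo[%classic measurableT mI f2)//; last first.
  apply: (@le_lt_trans _ _ (\int[lebesgueE d]_y ((E y)%:E * (l^-1)%:E))%E); last first.
    rewrite ge0_integralZr//; last 3 first.
    - exact/measurable_EFinP.
    - by move=> ? _; rewrite lee_fin.
    - by rewrite lee_fin invr_ge0 ltW.
    by rewrite IEE -EFinM ltry.
  apply: ge0_le_integral => //.
  - by move=> t _; apply: integral_ge0 => y _; rewrite lee_fin.
  - under eq_fun do rewrite integral_mkcond.
    have := @measurable_fun_fubini_tonelli_F _ _ _ _ R mu
      (fun z : euclid R d * measurableTypeR R => (`|f2 z| * \1_(`]0, +oo[%classic : set R) z.2)%:E).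
    move=> H; rewrite (_ : (fun y => _) = (fun y => \int[mu]_u
       (`|f2 (y, u)| * \1_(`]0, +oo[%classic : set R) u)%:E)%E).
      apply: H; last by move=> z; rewrite lee_fin mulr_ge0.
      apply/measurable_EFinP; apply: measurable_funM; first exact: measurableT_comp.
      by apply: (measurableT_comp _ measurable_snd); exact: measurable_indic.
    apply/funext => y; apply: eq_integral => u _.
    exact: (congr1 (@^~ u) (patch_mul_indic (`]0, +oo[%classic : set (measurableTypeR R))
      (fun u => `|f2 (y, u)|))).
  - by apply: emeasurable_funM => //; exact/measurable_EFinP.
  move=> y _; have s0 := dotEE_ge0 y; have := sym0 _ s0; set S := _ - m => S0.
  have lS : 0 < l + S by rewrite ltr_wpDr.
  apply: (@le_trans _ _ ((E y)%:E * ((l + S)^-1)%:E)%E); last first.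
    by rewrite -!EFinM lee_fin ler_wpM2l// lef_pV2 ?posrE// lerDl.
  rewrite -L// -ge0_integralZl_EFin//; last 2 first.
  - by move=> u _; rewrite lee_fin mulr_ge0 ?expR_ge0.
  - by case/integrableP: (gint _ s0).
  apply: ge0_le_integral_EFin => //.
  - apply: measurableT_comp => //.
    exact: (measurableT_comp mf2 (measurable_pair1 y)).
  - by apply: measurable_funM => //; apply: measurable_funM => //; exact: measurable_expRNM.
  move=> u _; have h0 : 0 <= g u * expR (- (dotE y y * u)) by rewrite mulr_ge0 ?expR_ge0.
  rewrite /f2/= normrM (ger0_norm h0) ler_wpM2r// normrM (ger0_norm (E0 y)).
  by rewrite ler_piMl// cos_max.
apply: eq_integral => u /set_mem; rewrite /= in_itv/= andbT => u0.
have ue : 0 < u + e by rewrite addr_gt0.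
have rr := rapid_expRN 1 ue.
transitivity ((g u)%:E * \int[lebesgueE d]_y (cos (dotE x y) * (1 * expR (- ((u + e) * dotE y y))))%:E)%E.
  rewrite -integralZl//; last first.
    have := @rapid_integrable R d _ (fun y => cos (dotE x y)) rr.
    by apply=> [|y]; [exact: mcx|exact: cos_max].
  apply: eq_integral => y _; rewrite -EFinM /f2 /E/=; congr EFin.
  rewrite mul1r mulrDl opprD expRD (mulrC (dotE y y)); ring.
rewrite (integral_cos_radial x rr) radial_gauss// mul1r -EFinM size_tuple.
by rewrite /gauss_kernel /dotE big_tuple; under eq_bigr do rewrite expr2.
Qed.

End resolvent_regularized.

(** * Measurability of section integrals of signed functions *)

Section integral_sections.
Context {R : realType} d1 d2 (T1 : measurableType d1) (T2 : measurableType d2).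
Local Open Scope ereal_scope.

(** Tonelli gives the nonnegative case; the positive and negative parts give the general one, which
    the oscillating integrand of the heat kernel calls for. *)
Lemma measurable_integral_section (m2 : {sigma_finite_measure set T2 -> \bar R})
    (D2 : set T2) (f : T1 * T2 -> \bar R) : measurable D2 -> measurable_fun setT f ->
  measurable_fun setT (fun x => \int[m2]_(y in D2) f (x, y)).
Proof.
move=> mD mf.
have H (h : T1 * T2 -> \bar R) : measurable_fun setT h -> (forall z, 0 <= h z) ->
    measurable_fun setT (fun x => \int[m2]_(y in D2) h (x, y)).
  move=> mh h0.
  rewrite (_ : (fun x => _) = (fun x => \int[m2]_y (h (x, y) * (\1_D2 y)%:E))).
    apply: (@measurable_fun_fubini_tonelli_F _ _ _ _ _ m2 (fun z => h z * (\1_D2 z.2)%:E)).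
      apply: emeasurable_funM => //; apply/measurable_EFinP.
      by apply: (measurableT_comp _ measurable_snd); exact: measurable_indic.
    by move=> z; rewrite mule_ge0// lee_fin.
  apply/funext => x; rewrite integral_mkcond; apply: eq_integral => y _.
  by rewrite patchE indicE; case: ifPn => _; rewrite ?mule1 ?mule0.
have H1 := H _ (measurable_funepos mf) (fun z => funepos_ge0 f z).
have H2 := H _ (measurable_funeneg mf) (fun z => funeneg_ge0 f z).
rewrite (_ : (fun x => _) = (fun x => \int[m2]_(y in D2) f^\+ (x, y)) \-
  (fun x => \int[m2]_(y in D2) f^\- (x, y))); first exact: emeasurable_funB.
apply/funext => x; rewrite integralE.
by congr (_ - _); apply: eq_integral => y _; rewrite unlock.
Qed.

End integral_sections.

(** * Removing the regularization *)

Section resolvent_formula.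
Context {R : realType}.
Notation mu := (@lebesgue_measure R).

Let mI : measurable (`]0%R, +oo[%classic : set (measurableTypeR R)).
Proof. exact: measurable_itv. Qed.

Lemma gauss_kernelE d (q w : R) : 0 < w ->
  gauss_kernel d q w = Num.sqrt pi ^+ d * w `^ (- (d%:R / 2)) * expR (- (q / (4 * w))).
Proof.
move=> w0; rewrite /gauss_kernel sqrtrM ?pi_ge0// exprMn; congr (_ * _ * _).
rewrite -powR12_sqrt ?invr_ge0 ?(ltW w0)// -powR_mulrn ?powR_ge0// -powRrM.
rewrite -powR_inv1 ?(ltW w0)// -powRrM; congr (_ `^ _); ring.
Qed.

Lemma gauss_kernel_ge0 d (q w : R) : 0 <= gauss_kernel d q w.
Proof. by rewrite mulr_ge0 ?exprn_ge0 ?sqrtr_ge0 ?expR_ge0. Qed.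

(** Away from the origin e^(-q/(4w)) kills w^(-d/2) as w tends to 0. The uniform bound supplies the
    majorant on the subordinated side. *)
Lemma gauss_kernel_bounded d (q : R) : 0 < q ->
  exists2 B : R, 0 <= B & forall w, 0 < w -> gauss_kernel d q w <= B.
Proof.
move=> q0; have d0 : 0 <= d%:R / 2 :> R by rewrite divr_ge0.
have q4 : 0 < q / 4 by rewrite divr_gt0.
have [C C0 HC] := powR_le_expR d0 q4.
exists (Num.sqrt pi ^+ d * C) => [|w w0].
  by rewrite mulr_ge0 ?exprn_ge0 ?sqrtr_ge0// ltW.
rewrite gauss_kernelE// -mulrA ler_wpM2l ?exprn_ge0 ?sqrtr_ge0//.
have wi0 : 0 <= w^-1 by rewrite invr_ge0 ltW.
have := HC _ wi0; rewrite -(powR_inv1 (ltW w0)) -powRrM mulN1r => H.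
rewrite expRN ler_pdivrMr ?expR_gt0//; apply: (le_trans H).
rewrite ler_wpM2l ?(ltW C0)// ler_expR powR_inv1 ?(ltW w0)//.
by rewrite le_eqVlt; apply/orP; left; apply/eqP; field; rewrite gt_eqF.
Qed.

Lemma continuous_gauss_kernel d (q u : R) : 0 < u ->
  {for u, continuous (gauss_kernel d q)}.
Proof.
move=> u0.
have h4 : 4 * u != 0 by rewrite gt_eqF// mulr_gt0.
have D1 := is_deriveZ1 q (@is_deriveV1 R (fun w => 4 * w) u _ h4
  (is_deriveZ1 4 (is_derive_id u 1))).
have D2 := is_derive_comp1 (is_derive_expR _) (is_deriveN1 D1).
have D3 := is_deriveM1 (is_deriveZ1 (Num.sqrt pi ^+ d) (is_derive_powR (- (d%:R / 2)) u0)) D2.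
have := is_derive_for_continuous D3.
rewrite /prop_for /continuous_at => H.
rewrite gauss_kernelE//.
apply: cvg_trans H; apply: near_eq_cvg; near=> w.
rewrite gauss_kernelE//; near: w; exact: lt_nbhsr.
Unshelve. all: end_near. Qed.

Lemma measurable_gauss_kernel d (q : R) : measurable_fun setT (gauss_kernel d q).
Proof.
apply: measurable_funM.
  apply: measurable_funX; apply: measurableT_comp; 
    first exact: (continuous_measurable_fun (@sqrt_continuous R)).
  by apply: measurable_funM => //; exact: measurable_funV.
apply: measurableT_comp => //; apply: measurableT_comp => //.
by apply: measurable_funM => //; apply: measurable_funV; exact: measurable_funM.
Qed.

Lemma hphi_le (b M m t e s : R) : 0 <= e -> 0 <= s -> hphi b M m t e s <= hphi b M m t 0 s.
Proof. by move=> e0 s0; rewrite ler_expR lerN2 mul0r addr0 lerDl mulr_ge0. Qed.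

Lemma cvg_hphi (b M m t s : R) : hphi b M m t n.+2%:R^-1 s @[n --> \oo] --> hphi b M m t 0 s.
Proof.
have c0 : {for 0, continuous (fun e : R => hphi b M m t e s)}.
  exact: (is_derive_for_continuous (is_derive_comp1 (is_derive_expR _)
    (is_deriveN1 (is_deriveD1 (is_derive_cst (t * ((s + M) `^ b - m)) (0 : R) 1)
    (is_deriveM1 (is_derive_id (0 : R) 1) (is_derive_cst s (0 : R) 1)))))).
by have := continuous_cvg _ c0 cvg_invn2; apply.
Qed.

Lemma cvg_radial_hphi (b m t : R) d (x : euclid R d) : 0 < b < 1 -> 0 < t ->
  radial x (hphi b (m `^ b^-1) m t n.+2%:R^-1) @[n --> \oo] -->
  radial x (hphi b (m `^ b^-1) m t 0).
Proof.
move=> b01 t0; set M := m `^ b^-1; have M0 : 0 <= M by exact: powR_ge0.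
have mcx : measurable_fun setT (fun y : euclid R d => cos (dotE x y)).
  apply: measurableT_comp; first exact: (continuous_measurable_fun (@continuous_cos R)).
  exact: measurable_dotE.
have e0 (n : nat) : 0 <= n.+2%:R^-1 :> R by rewrite invr_ge0.
have r (e : R) : 0 <= e -> rapid (hphi b M m t e) by move=> ?; exact: hphi_rapid.
have n1 (y : euclid R d) : `|1 : R| <= 1 by rewrite normr1.
have i0 := rapid_integrable (r 0 (lexx _)) (measurable_cst _) n1.
have ic (e : R) (he : 0 <= e) := rapid_integrable (r e he) mcx (fun y => cos_max _).
have H : (\int[lebesgueE d]_y (cos (dotE x y) * hphi b M m t n.+2%:R^-1 (dotE y y))%:E @[n --> \oo]
    --> \int[lebesgueE d]_y (cos (dotE x y) * hphi b M m t 0 (dotE y y))%:E)%E.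
  apply: (@dominated_cvg _ _ R (lebesgueE d) setT measurableT _ _
    (EFin \o (fun y : euclid R d => 1 * hphi b M m t 0 (dotE y y)))) => //.
  - by move=> n; case/integrableP: (ic _ (e0 n)).
  - move=> y _; apply: cvg_EFin; first by near=> n.
    by apply: cvgM; [exact: cvg_cst|exact: cvg_hphi].
  - move=> n y _; rewrite /= lee_fin normrM (ger0_norm (expR_ge0 _)).
    by apply: ler_pM; rewrite ?expR_ge0// ?cos_max// hphi_le ?dotEE_ge0.
rewrite (integral_cos_radial x (r 0 (lexx _))) in H.
have E : (fun n => \int[lebesgueE d]_y (cos (dotE x y) * hphi b M m t n.+2%:R^-1 (dotE y y))%:E)%E =
    (fun n => (radial x (hphi b M m t n.+2%:R^-1))%:E).
  by apply/funext => n; exact: (integral_cos_radial x (r _ (e0 n))).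
rewrite E in H.
exact: (fine_cvg H).
Unshelve. all: end_near. Qed.

Lemma measurable_radial_hphi (b m e : R) d (x : euclid R d) : 0 < b < 1 -> 0 <= e ->
  measurable_fun (`]0, +oo[%classic : set R) (fun t => radial x (hphi b (m `^ b^-1) m t e)).
Proof.
move=> b01 e0; set M := m `^ b^-1; have M0 : 0 <= M by exact: powR_ge0.
pose f (z : measurableTypeR R * euclid R d) : \bar R :=
  (cos (dotE x z.2) * hphi b M m z.1 e (dotE z.2 z.2))%:E.
have mf : measurable_fun setT f.
  have mdd : measurable_fun setT (fun z : measurableTypeR R * euclid R d => dotE z.2 z.2).
    exact: (measurableT_comp (@measurable_dotEE R d) measurable_snd).
  apply/measurable_EFinP; apply: measurable_funM.
    apply: measurableT_comp; first exact: (continuous_measurable_fun (@continuous_cos R)).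
    exact: (measurableT_comp (measurable_dotE x) measurable_snd).
  apply: measurableT_comp => //; apply: measurableT_comp => //.
  apply: measurable_funD; last exact: measurable_funM.
  apply: measurable_funM; first exact: measurable_fst.
  apply: measurable_funB => //.
  by apply: (measurableT_comp (measurable_powR b)); exact: measurable_funD.
have H0 := measurable_integral_section (lebesgueE d) measurableT mf.
have H : measurable_fun (`]0, +oo[%classic : set (measurableTypeR R))
    (fun t => \int[lebesgueE d]_y f (t, y))%E by exact: measurable_funTS.
apply/measurable_EFinP; apply: eq_measurable_fun H => t /set_mem.
rewrite /= in_itv/= andbT => t0; apply: integral_cos_radial; exact: hphi_rapid.
Qed.

(** The function A(1 + t^(-p)) e^(-lt) on t > 0, written as two Gamma integrands with exponents 1
    and 1 - p. *)
Lemma integrable_time_majorant (A p l : R) : p < 1 -> 0 < l ->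
  mu.-integrable `]0, +oo[ (EFin \o (fun t => A * (t `^ (1 - 1) * expR (- (l * t))) +
       A * (t `^ (1 - p - 1) * expR (- (l * t))))).
Proof.
move=> p1 l0.
have ga (a : R) : 0 < a ->
    mu.-integrable `]0, +oo[ (EFin \o (fun t => A * (t `^ (a - 1) * expR (- (l * t))))).
  move=> a0; apply: (integrableZl_EFin A mI).
  apply: ge0_integrable_EFin => //.
  - by apply: measurable_funTS; exact: measurable_gammaf.
  - by move=> t _; rewrite mulr_ge0 ?powR_ge0 ?expR_ge0.
  by rewrite integral_gamma_scale// ltry.
apply: integrableD_EFin => //; first exact: ga.
by apply: ga; rewrite subr_gt0.
Qed.

Lemma time_majorant (b m l A p t e : R) d (x : euclid R d) : 0 < t ->
  `|radial x (hphi b (m `^ b^-1) m t e)| <= A * (1 + t `^ (- p)) ->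
  `|expR (- (l * t)) * radial x (hphi b (m `^ b^-1) m t e)| <=
    A * (t `^ (1 - 1) * expR (- (l * t))) + A * (t `^ (1 - p - 1) * expR (- (l * t))).
Proof.
move=> t0 HA; rewrite normrM (ger0_norm (expR_ge0 _)) subrr powRr0 mul1r.
rewrite (_ : 1 - p - 1 = - p); last by ring.
apply: (le_trans (ler_wpM2l (expR_ge0 _) HA)).
by rewrite le_eqVlt; apply/orP; left; apply/eqP; ring.
Qed.

Lemma integrable_resolvent_radial (b m l : R) d (x : euclid R d) :
  0 < b < 1 -> d%:R < 4 * b -> 0 <= m -> 0 < l -> (forall i, tnth x i != 0) ->
  mu.-integrable `]0, +oo[
    (EFin \o (fun t => expR (- (l * t)) * radial x (hphi b (m `^ b^-1) m t 0))).
Proof.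
move=> b01 db m0 l0 x0.
have [A [p [A0 /andP[p0 p1] HA]]] := radial_hphi_bound b01 db m0 x0.
apply: (le_integrable_EFin _ _ _ (integrable_time_majorant A p1 l0)) => //.
- by apply: measurable_funM; [exact: measurable_expRNM|exact: measurable_radial_hphi].
- by move=> t; rewrite /= in_itv/= andbT => t0; apply: time_majorant => //; exact: HA.
Qed.

(** Let e = 1/(n+2) tend to 0 in [resolvent_regularized]. The left side is dominated by the time
    majorant, available because x has no zero coordinate; the right side by a multiple of g. *)
Lemma resolvent_radial (b m l C : R) (g : R -> R) d (x : euclid R d) : (0 < d)%N ->
  0 < b < 1 -> d%:R < 4 * b -> 0 <= m -> 0 < l ->
  measurable_fun setT g -> (forall u, 0 <= g u) ->
  (forall u, 0 < u -> g u <= C * kappa b u) ->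
  (forall s, 0 < s -> (\int[mu]_(u in `]0%R, +oo[) (g u * expR (- (s * u)))%:E =
      ((l + ((s + m `^ b^-1) `^ b - m))^-1)%:E)%E) ->
  (forall i, tnth x i != 0) ->
  (\int[mu]_(t in `]0%R, +oo[) (expR (- (l * t)) * radial x (hphi b (m `^ b^-1) m t 0))%:E =
   \int[mu]_(u in `]0%R, +oo[) (g u * gauss_kernel d (dotE x x) u)%:E)%E.
Proof.
move=> d0 b01 db m0 l0 mg g0 gC L x0; have /andP[b0 b1] := b01.
set M := m `^ b^-1; have M0 : 0 <= M by exact: powR_ge0.
have q0 : 0 < dotE x x.
  rewrite lt_neqAle dotEE_ge0 andbT eq_sym; apply/negP => /eqP q.
  case: d d0 x x0 q {db} => // d _ x x0 /eqP.
  rewrite /dotE psumr_eq0 => [/allP /(_ ord0)|i _]; last by rewrite -expr2 sqr_ge0.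
  by rewrite mem_index_enum mulf_eq0 orbb (negbTE (x0 _)) => /(_ isT).
have ig := le_kappa_integrable b0 mg g0 gC.
have L0 := laplace_at0 b01 m0 l0 ig g0 L.
have [A [p [A0 /andP[p0 p1] HA]]] := radial_hphi_bound b01 db m0 x0.
have [B B0 HB] := gauss_kernel_bounded d q0.
have e0 (n : nat) : 0 < n.+2%:R^-1 :> R by rewrite invr_gt0.
have e0' (n : nat) : 0 <= n.+2%:R^-1 :> R by rewrite ltW.
have H1 : (\int[mu]_(t in `]0%R, +oo[) (expR (- (l * t)) * radial x (hphi b M m t n.+2%:R^-1))%:E
    @[n --> \oo] -->
    \int[mu]_(t in `]0%R, +oo[) (expR (- (l * t)) * radial x (hphi b M m t 0))%:E)%E.
  apply: (@dominated_cvg _ (measurableTypeR R) R mu `]0%R, +oo[%classic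
    mI _ _ (EFin \o (fun t => A * (t `^ (1 - 1) * expR (- (l * t))) +
       A * (t `^ (1 - p - 1) * expR (- (l * t)))))).
  - move=> n; apply/measurable_EFinP; apply: measurable_funM; first exact: measurable_expRNM.
    exact: measurable_radial_hphi.
  - move=> t; rewrite /= in_itv/= andbT => t0; apply: cvg_EFin; first by near=> n.
    by apply: cvgM; [exact: cvg_cst|exact: cvg_radial_hphi].
  - by [].
  - exact: integrable_time_majorant.
  - move=> n t; rewrite /= in_itv/= andbT => t0; rewrite lee_fin.
    by apply: time_majorant => //; exact: HA.
have H2 : (\int[mu]_(u in `]0%R, +oo[) (g u * gauss_kernel d (dotE x x) (u + n.+2%:R^-1))%:E
    @[n --> \oo] -->
    \int[mu]_(u in `]0%R, +oo[) (g u * gauss_kernel d (dotE x x) u)%:E)%E.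
  apply: (@dominated_cvg _ (measurableTypeR R) R mu `]0%R, +oo[%classic
    mI _ _ (EFin \o (fun u => B * g u))).
  - move=> n; apply/measurable_EFinP; apply: measurable_funTS; apply: measurable_funM => //.
    apply: (measurableT_comp (measurable_gauss_kernel d _)); exact: measurable_funD.
  - move=> u; rewrite /= in_itv/= andbT => u0; apply: cvg_EFin; first by near=> n.
    apply: cvgM; first exact: cvg_cst.
    have c : u + (n.+2%:R^-1 : R) @[n --> \oo] --> u.
      by rewrite -[X in _ --> X]addr0; apply: cvgD; [exact: cvg_cst|exact: cvg_invn2].
    by have := continuous_cvg _ (@continuous_gauss_kernel d (dotE x x) u u0) c; apply.
  - by [].
  - exact: (integrableZl_EFin B mI ig).
  - move=> n u; rewrite /= in_itv/= andbT => u0; rewrite lee_fin.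
    rewrite ger0_norm ?mulr_ge0 ?gauss_kernel_ge0// mulrC ler_wpM2r// HB//.
    by rewrite addr_gt0.
have E : (fun n => \int[mu]_(t in `]0%R, +oo[)
      (expR (- (l * t)) * radial x (hphi b M m t n.+2%:R^-1))%:E)%E =
    (fun n => \int[mu]_(u in `]0%R, +oo[) (g u * gauss_kernel d (dotE x x) (u + n.+2%:R^-1))%:E)%E.
  by apply/funext => n; rewrite (resolvent_regularized x b01 m0 l0 (e0 n) mg g0 L0).
by rewrite E in H1; exact: (cvg_unique _ H1 H2).
Unshelve. all: end_near. Qed.

End resolvent_formula.

(** * The tail of the Rollnik kernel as an integral *)

Section kernel_comparison.
Context {R : realType}.
Notation mu := (@lebesgue_measure R).

Let mI : measurable (`]0%R, +oo[%classic : set (measurableTypeR R)).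
Proof. exact: measurable_itv. Qed.

(* [invgammaf M p q] is, for [p = rho], the integrand of the Bessel function
   K_rho up to the substitution t = M u. *)
Definition invgammaf (M p q u : R) : R :=
  u `^ (- p - 1) * expR (- (M * u) - q / (4 * u)).

Lemma measurable_invgammaf M p q : measurable_fun setT (invgammaf M p q).
Proof.
apply: measurable_funM; first exact: measurable_powR.
apply: measurableT_comp => //; apply: measurable_funB.
  by apply: measurableT_comp => //; exact: measurable_funM.
by apply: measurable_funM => //; apply: measurable_funV; exact: measurable_funM.
Qed.

Lemma invgammaf_ge0 M p q u : 0 <= invgammaf M p q u.
Proof. by rewrite mulr_ge0 ?powR_ge0 ?expR_ge0. Qed.

Lemma powR_expRV_bounded (p q : R) : 0 <= p -> 0 < q ->
  exists2 C : R, 0 < C & forall u, 0 < u -> u `^ (- p) * expR (- (q / u)) <= C.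
Proof.
move=> p0 q0; have [C C0 HC] := powR_le_expR p0 q0; exists C => // u u0.
have ui0 : 0 <= u^-1 by rewrite invr_ge0 ltW.
rewrite expRN ler_pdivrMr ?expR_gt0//.
by have := HC _ ui0; rewrite -(powR_inv1 (ltW u0)) -powRrM mulN1r powR_inv1// ltW.
Qed.

Lemma integrable_invgammaf M p q : 0 <= M -> 0 < p -> 0 < q ->
  mu.-integrable `]0, +oo[ (EFin \o invgammaf M p q).
Proof.
move=> M0 p0 q0; have p1 : 0 <= p + 1 by rewrite addr_ge0// ltW.
have q4 : 0 < q / 4 by rewrite divr_gt0.
have [C C0 HC] := powR_expRV_bounded p1 q4.
have le1 (u : R) : 0 < u -> expR (- (M * u) - q / (4 * u)) <= expR (- (q / 4 / u)).
  move=> u0; rewrite ler_expR [X in _ - X](_ : _ = q / 4 / u).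
    by rewrite gerDr oppr_le0 mulr_ge0// ltW.
  by rewrite invfM; field; rewrite gt_eqF.
apply: (@integrable_oy R _ 1 p (C + 1)) => //; first exact: measurable_invgammaf.
- move=> u /andP[u0 u1]; rewrite ger0_norm ?invgammaf_ge0// subrr powRr0 mulr1.
  apply: (@le_trans _ _ C); last by lra.
  apply: le_trans (HC u u0); rewrite /invgammaf opprD ler_wpM2l ?powR_ge0//.
  exact: le1.
- move=> u u1; have u0 : 0 < u by exact: lt_le_trans u1.
  rewrite ger0_norm ?invgammaf_ge0// /invgammaf mulrC ler_wpM2r ?powR_ge0//.
  apply: (le_trans (le1 u u0)); apply: (@le_trans _ _ 1); last by lra.
  by rewrite expR_le1 oppr_le0 divr_ge0// ltW.
Qed.

Lemma integral_invgammaf_gt0 M p q : 0 <= M -> 0 < p -> 0 < q ->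
  exists2 I : R, 0 < I & (\int[mu]_(u in `]0%R, +oo[) (invgammaf M p q u)%:E = I%:E)%E.
Proof.
move=> M0 p0 q0; have fi := integrable_fin_num mI (integrable_invgammaf M0 p0 q0).
exists (fine (\int[mu]_(u in `]0%R, +oo[) (invgammaf M p q u)%:E)%E); last by rewrite fineK.
rewrite -lte_fin fineK//.
have c0 : 0 < 2 `^ (- p - 1) * expR (- (M * 2) - q / 4) :> R.
  by rewrite mulr_gt0 ?powR_gt0 ?expR_gt0.
have l12 : 0 < (1 : R) < 2 by rewrite ltr01 ltr1n.
apply: lt_le_trans (integral_oy_ge l12 (ltW c0) _ _ _).
- by rewrite lte_fin mulr_gt0// subr_gt0 ltr1n.
- by apply/measurable_EFinP; exact: measurable_invgammaf.
- by move=> u _; rewrite lee_fin invgammaf_ge0.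
move=> u /andP[u1 u2]; have u0 : 0 < u by exact: lt_le_trans u1.
rewrite lee_fin; apply: ler_pM; rewrite ?powR_ge0 ?expR_ge0//.
  have -> : - p - 1 = - (p + 1) by ring.
  rewrite !powRN lef_pV2 ?posrE ?powR_gt0//.
  by apply: ge0_ler_powR; rewrite ?nnegrE ?addr_ge0 ?(ltW p0) ?(ltW u0).
rewrite ler_expR lerB//; first by rewrite lerN2 ler_wpM2l.
rewrite ler_wpM2l ?(ltW q0)// lef_pV2 ?posrE ?mulr_gt0//.
by rewrite ler_peMr.
Qed.

Lemma integral_invgammaf_scale (M p q c : R) : 0 < c ->
  (\int[mu]_(u in `]0%R, +oo[) (invgammaf M p q u)%:E =
   (c `^ (- p))%:E * \int[mu]_(u in `]0%R, +oo[) (invgammaf (M * c) p (q / c) u)%:E)%E.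
Proof.
move=> c0.
rewrite (@ge0_integral_scale R c (fun u => (invgammaf M p q u)%:E) c0); last 2 first.
- by apply/measurable_EFinP; exact: measurable_invgammaf.
- by move=> u; rewrite lee_fin invgammaf_ge0.
rewrite -!ge0_integralZl_EFin ?powR_ge0 ?(ltW c0)//; last 4 first.
- by move=> u _; rewrite lee_fin invgammaf_ge0.
- by apply/measurable_EFinP; apply: measurable_funTS; exact: measurable_invgammaf.
- by move=> u _; rewrite lee_fin invgammaf_ge0.
- apply/measurable_EFinP; apply: measurable_funTS.
  by apply: (measurableT_comp (@measurable_invgammaf M p q)); exact: measurable_funM.
apply: eq_integral => u /set_mem; rewrite /= in_itv/= andbT => u0.
rewrite -!EFinM; congr EFin; rewrite /invgammaf powRM ?(ltW c0) ?(ltW u0)//.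
rewrite !mulrA; congr (_ * expR _).
  rewrite (_ : c `^ (- p) = c * c `^ (- p - 1)); first by ring.
  rewrite -{2}(powRr1 (ltW c0)) -powRD ?(gt_eqF c0) ?implybT//.
  by congr (_ `^ _); ring.
by congr (_ - _); field; rewrite !gt_eqF.
Qed.

Let powRNK (x p : R) : 0 < x -> x `^ (- p) * x `^ p = 1.
Proof. by move=> x0; rewrite powRN mulVf// gt_eqF// powR_gt0. Qed.

Lemma Gamma_pos (p : R) : 0 < p -> 0 < Gamma p.
Proof. exact: Gamma_gt0. Qed.

(** One formula covers the tails for m = 0 and m > 0. If m > 0, it is the Bessel integral after t =
    Mu; if m = 0, then M = 0 and scaling by r^2 extracts r^(-(d+alpha)). *)
Lemma rollnik_H_gt1 (d : nat) (alpha m : R) : 0 < alpha -> 0 <= m ->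
  exists2 k : R, 0 < k & forall r, 1 < r -> (rollnik_H d alpha m r)%:E =
    (k%:E * \int[mu]_(u in `]0%R, +oo[)
      (invgammaf (m `^ (alpha / 2)^-1) ((d%:R + alpha) / 2) (r ^+ 2) u)%:E)%E.
Proof.
move=> a0 m0; set M := m `^ _; set p := (d%:R + alpha) / 2.
have p0 : 0 < p by rewrite divr_gt0// ltr_wpDl.
have M0 : 0 <= M by exact: powR_ge0.
have [m_eq0|m_neq0] := eqVneq m 0.
  have ME : M = 0 by rewrite /M m_eq0 powR0// invr_eq0 mulf_neq0 ?gt_eqF// invr_eq0.
  have [I I0 HI] := integral_invgammaf_gt0 (lexx (0 : R)) p0 ltr01.
  exists (2 `^ (p - 1) * Gamma p / I) => [|r r1].
    by rewrite divr_gt0// mulr_gt0 ?powR_gt0 ?Gamma_pos.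
  have r0 : 0 < r by exact: lt_trans r1.
  have r20 : 0 < r ^+ 2 by rewrite exprn_gt0.
  rewrite ME (integral_invgammaf_scale 0 p _ r20) mul0r divff ?gt_eqF// HI -!EFinM.
  rewrite /rollnik_H leNgt r1/= m_eq0 eqxx -/p; congr EFin.
  have -> : r `^ (- (d%:R + alpha)) = (r ^+ 2) `^ (- p).
    rewrite -powR_mulrn ?(ltW r0)// -powRrM; congr (_ `^ _).
    by rewrite /p; field.
  by field; rewrite gt_eqF.
have mp : 0 < m by rewrite lt_neqAle eq_sym m_neq0.
have Mp : 0 < M by exact: powR_gt0.
exists (2^-1 * 2^-1 `^ p) => [|r r1]; first by rewrite mulr_gt0// powR_gt0.
have r0 : 0 < r by exact: lt_trans r1.
have r20 : 0 < r ^+ 2 by rewrite exprn_gt0.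
have [I I0 HI] := integral_invgammaf_gt0 M0 p0 r20.
rewrite HI -EFinM /rollnik_H leNgt r1/= (negbTE m_neq0) /rollnik_kappa /besselK -/p.
set z := m `^ alpha^-1 * r.
have z2 : z ^+ 2 = M * r ^+ 2.
  rewrite /z exprMn -powR_mulrn ?powR_ge0// -powRrM; congr (_ `^ _ * _).
  by rewrite invf_div mulrC.
have -> : \int[mu]_(t in `]0, +oo[) (t `^ (- p - 1) * expR (- t - z ^+ 2 / (4 * t))) =
    M `^ (- p) * I.
  rewrite /Rintegral.
  have -> : (\int[mu]_(t in `]0%R, +oo[) (t `^ (- p - 1) * expR (- t - z ^+ 2 / (4 * t)))%:E =
      \int[mu]_(t in `]0%R, +oo[) (invgammaf 1 p (M * r ^+ 2) t)%:E)%E.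
    by apply: eq_integral => t _; rewrite /invgammaf mul1r z2.
  by rewrite (integral_invgammaf_scale 1 p _ Mp) mul1r mulrC mulKf ?gt_eqF// HI -EFinM.
have -> : (z / 2) `^ p = m `^ (alpha^-1 * p) * r `^ p * 2^-1 `^ p.
  by rewrite /z !powRM ?mulr_ge0 ?powR_ge0 ?invr_ge0 ?(ltW r0)// -powRrM.
have E : m `^ ((d%:R + alpha) / (2 * alpha)) * m `^ (alpha^-1 * p) * M `^ (- p) = 1.
  have -> : m `^ ((d%:R + alpha) / (2 * alpha)) * m `^ (alpha^-1 * p) = M `^ p.
    rewrite -powRD ?(gt_eqF mp) ?implybT// -powRrM; congr (_ `^ _).
    by rewrite /p; field; rewrite gt_eqF.
  by rewrite mulrC powRNK.
congr EFin.
transitivity (2^-1 * 2^-1 `^ p * I * (r `^ (- p) * r `^ p) *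
  (m `^ ((d%:R + alpha) / (2 * alpha)) * m `^ (alpha^-1 * p) * M `^ (- p))).
  by ring.
by rewrite powRNK// E !mulr1.
Qed.

End kernel_comparison.

(** * The potential integral far from the origin *)

Section kernel_bounds.
Context {R : realType}.
Notation mu := (@lebesgue_measure R).

Let mI : measurable (`]0%R, +oo[%classic : set (measurableTypeR R)).
Proof. exact: measurable_itv. Qed.

(* Up to a power of pi, the integrand of the potential density
   [exp (- M u) * kappa b u] against the Gaussian kernel. *)
Definition potentialf (d : nat) (b M q u : R) : R :=
  expR (- (M * u)) * kappa b u * (u `^ (- (d%:R / 2)) * expR (- (q / (4 * u)))).

Lemma measurable_potentialf d b M q : measurable_fun setT (potentialf d b M q).
Proof.
apply: measurable_funM.
  by apply: measurable_funM; [exact: measurable_expRNM|exact: measurable_kappa].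
apply: measurable_funM; first exact: measurable_powR.
apply: measurableT_comp => //; apply: measurableT_comp => //.
by apply: measurable_funM => //; apply: measurable_funV; exact: measurable_funM.
Qed.

Lemma potentialf_ge0 d b M q u : 0 <= potentialf d b M q u.
Proof. by rewrite !mulr_ge0 ?kappa_ge0 ?powR_ge0 ?expR_ge0. Qed.

Lemma kappa_ge1 (b u : R) : 1 <= u -> kappa b u = u `^ (- b - 1).
Proof.
rewrite le_eqVlt /kappa => /predU1P[<-|u1]; first by rewrite lexx !powR1.
by rewrite leNgt u1.
Qed.

Lemma kappa_le_tail (b u : R) : 0 < b -> 0 < u -> kappa b u <= u `^ (- b - 1).
Proof.
move=> b0 u0; rewrite /kappa; case: (leP u 1) => // u1.
by apply: ger_powR; [rewrite u0 u1|lra].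
Qed.

Let powRDu (u p q : R) : 0 < u -> u `^ p * u `^ q = u `^ (p + q).
Proof. by move=> u0; rewrite -powRD// (gt_eqF u0) implybT. Qed.

Let gauss_le1 (q u : R) : 0 <= q -> 0 < u -> expR (- (q / (4 * u))) <= 1.
Proof. by move=> q0 u0; rewrite expR_le1 oppr_le0 divr_ge0// mulr_ge0// ltW. Qed.

Lemma potentialf_le_invgammaf d b M q u : 0 < b -> 0 < u ->
  potentialf d b M q u <= invgammaf M ((d%:R + 2 * b) / 2) q u.
Proof.
move=> b0 u0; rewrite /potentialf /invgammaf expRD.
rewrite (_ : u `^ (- ((d%:R + 2 * b) / 2) - 1) = u `^ (- b - 1) * u `^ (- (d%:R / 2))); last first.
  by rewrite powRDu//; congr (_ `^ _); field.
have k := kappa_le_tail b0 u0.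
rewrite [leLHS](_ : _ = kappa b u * (u `^ (- (d%:R / 2)) *
  (expR (- (M * u)) * expR (- (q / (4 * u)))))); last by ring.
rewrite -[leRHS]mulrA ler_wpM2r// !mulr_ge0 ?powR_ge0 ?expR_ge0//.
Qed.

Lemma potentialf_le_invgammaf0 d b M q u : 0 < b -> 0 <= M -> 0 < u ->
  potentialf d b M q u <= invgammaf 0 ((d%:R - 2 * b) / 2) q u.
Proof.
move=> b0 M0 u0; rewrite /potentialf /invgammaf mul0r oppr0 add0r.
rewrite (_ : u `^ (- ((d%:R - 2 * b) / 2) - 1) = u `^ (b - 1) * u `^ (- (d%:R / 2))); last first.
  by rewrite powRDu//; congr (_ `^ _); field.
rewrite mulrA ler_wpM2r ?expR_ge0// ler_wpM2r ?powR_ge0//.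
apply: (@le_trans _ _ (kappa b u)); last exact: kappa_le.
by rewrite ler_piMl ?kappa_ge0// expR_le1 oppr_le0 mulr_ge0// ltW.
Qed.

Lemma potentialf_ge d b M q u : 0 <= M -> 0 < u -> u <= 1 ->
  expR (- M) * (u `^ (b - 1 - d%:R / 2) * expR (- (q / (4 * u)))) <= potentialf d b M q u.
Proof.
move=> M0 u0 u1; rewrite /potentialf /kappa u1 -(powRDu (b - 1) (- (d%:R / 2)) u0).
rewrite !mulrA ler_wpM2r ?expR_ge0// ler_wpM2r ?powR_ge0// ler_wpM2r ?powR_ge0//.
by rewrite ler_expR lerN2 ler_piMr.
Qed.

Let mZ d b M q : measurable_fun setT (EFin \o potentialf d b M q).
Proof. by apply/measurable_EFinP; exact: measurable_potentialf. Qed.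

Lemma potential_le_invgammaf d b M q : 0 < b ->
  (\int[mu]_(u in `]0%R, +oo[) (potentialf d b M q u)%:E <=
   \int[mu]_(u in `]0%R, +oo[) (invgammaf M ((d%:R + 2 * b) / 2) q u)%:E)%E.
Proof.
move=> b0; apply: ge0_le_integral_EFin.
- exact: mI.
- exact: measurable_potentialf.
- exact: measurable_invgammaf.
- by move=> u _; exact: potentialf_ge0.
- by move=> u; rewrite /= in_itv/= andbT => u0; exact: potentialf_le_invgammaf.
Qed.

(** The two integrands agree for u >= 1. For u <= 1 and q >= 1, q/(4u) >= 1/(4u) + (q-1)/4, so
    [invgammaf] is at most [D] e^(-q/4) on ]0, 1]. This is absorbed by the part of the potential
    over [1, 2], which is at least [c0] e^(-q/4). *)
Lemma invgammaf_le_potential d b M : 0 < b -> 0 <= M ->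
  exists2 C : R, 0 < C & forall q, 1 <= q ->
  (\int[mu]_(u in `]0%R, +oo[) (invgammaf M ((d%:R + 2 * b) / 2) q u)%:E <=
   C%:E * \int[mu]_(u in `]0%R, +oo[) (potentialf d b M q u)%:E)%E.
Proof.
move=> b0 M0; set p := (d%:R + 2 * b) / 2.
have p0 : 0 < p by rewrite divr_gt0// ltr_wpDl// mulr_gt0.
have p1 : 0 <= p + 1 by rewrite addr_ge0// ltW.
have i4 : (0 : R) < 4^-1 by rewrite invr_gt0.
have [C1 C10 HC1] := powR_expRV_bounded p1 i4.
pose D := expR 4^-1 * C1.
have D0 : 0 < D by rewrite mulr_gt0 ?expR_gt0.
pose c0 := 2 `^ (- p - 1) * expR (- (M * 2)).
have c00 : 0 < c0 by rewrite mulr_gt0 ?powR_gt0 ?expR_gt0.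
exists (1 + D / c0) => [|q q1]; first by rewrite ltr_pwDl// divr_ge0 ?ltW.
have q0 : 0 < q by exact: lt_le_trans q1.
set Z := (\int[mu]_(u in _) (potentialf _ _ _ _ u)%:E)%E.
have Zlow : ((c0 * expR (- (q / 4)))%:E <= Z)%E.
  have l12 : 0 < (1 : R) < 2 by rewrite ltr01 ltr1n.
  have c1 : 0 <= c0 * expR (- (q / 4)) by rewrite mulr_ge0 ?expR_ge0// ltW.
  have := @integral_oy_ge R (EFin \o potentialf d b M q) 1 2 _ l12 c1 (mZ d b M q).
  rewrite (_ : 2 - 1 = 1) ?mulr1; last by ring.
  apply=> [u _|u /andP[u1 u2]]; first by rewrite lee_fin potentialf_ge0.
  have u0 : 0 < u by exact: lt_le_trans u1.
  rewrite lee_fin /potentialf kappa_ge1// /c0.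
  rewrite [leRHS](_ : _ = u `^ (- b - 1) * u `^ (- (d%:R / 2)) * expR (- (M * u)) *
    expR (- (q / (4 * u)))); last by ring.
  rewrite powRDu// (_ : - b - 1 + - (d%:R / 2) = - p - 1); last by rewrite /p; field.
  apply: ler_pM; rewrite ?mulr_ge0 ?powR_ge0 ?expR_ge0//.
    apply: ler_pM; rewrite ?powR_ge0 ?expR_ge0//.
      have -> : - p - 1 = - (p + 1) by ring.
      rewrite !powRN lef_pV2 ?posrE ?powR_gt0//.
      by apply: ge0_ler_powR; rewrite ?nnegrE ?(ltW u0).
    by rewrite ler_expR lerN2 ler_wpM2l.
  rewrite ler_expR lerN2 ler_wpM2l ?(ltW q0)// lef_pV2 ?posrE ?mulr_gt0//.
  by rewrite ler_peMr.
have fZ : measurable_fun setT (potentialf d b M q) by exact: measurable_potentialf.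
have m1 : measurable_fun setT (fun u : R => D * expR (- (q / 4)) * \1_(`]0, 1]%classic : set R) u).
  by apply: measurable_funM => //; apply: measurable_indic; exact: measurable_itv.
have pw (u : R) : 0 < u -> invgammaf M p q u <= potentialf d b M q u +
    D * expR (- (q / 4)) * \1_(`]0, 1]%classic : set R) u.
  move=> u0; have [u1|u1] := leP u 1; last first.
    rewrite -[leLHS]addr0 lerD//; last by rewrite mulr_ge0// mulr_ge0 ?expR_ge0// ltW.
    rewrite /invgammaf /potentialf kappa_ge1 ?(ltW u1)// expRD.
    rewrite [leRHS](_ : _ = u `^ (- b - 1) * u `^ (- (d%:R / 2)) *
      (expR (- (M * u)) * expR (- (q / (4 * u))))); last by ring.
    by rewrite powRDu// (_ : - b - 1 + - (d%:R / 2) = - p - 1)//; rewrite /p; field.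
  rewrite indicE mem_set ?mulr1; last by rewrite /= in_itv/= u0.
  rewrite -[leLHS]add0r lerD ?potentialf_ge0//.
  apply: (@le_trans _ _ (u `^ (- (p + 1)) * expR (- (4^-1 / u)) * (expR 4^-1 * expR (- (q / 4))))).
    rewrite -mulrA opprD ler_wpM2l ?powR_ge0// -!expRD ler_expR.
    have -> : q / (4 * u) = 4^-1 / u + (q - 1) / 4 * (1 / u - 1) + (q - 1) / 4.
      by field; rewrite gt_eqF.
    have h1 : 0 <= M * u by rewrite mulr_ge0// ltW.
    have h2 : 0 <= (q - 1) / 4 * (1 / u - 1).
      apply: mulr_ge0; first by rewrite divr_ge0// subr_ge0.
      by rewrite subr_ge0 div1r invr_ge1// ?unitfE ?gt_eqF// u0.
    lra.
  rewrite /D -mulrA [leRHS](_ : _ = C1 * (expR 4^-1 * expR (- (q / 4)))); last by ring.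
  rewrite mulrA ler_wpM2r ?mulr_ge0 ?expR_ge0//; exact: HC1.
apply: (@le_trans _ _ (Z + (D * expR (- (q / 4)))%:E)%E).
  apply: (@le_trans _ _ (\int[mu]_(u in `]0%R, +oo[) (potentialf d b M q u +
    D * expR (- (q / 4)) * \1_(`]0, 1]%classic : set R) u)%:E)%E).
    apply: ge0_le_integral_EFin.
    - exact: mI.
    - exact: measurable_invgammaf.
    - exact: measurable_funD.
    - by move=> u _; exact: invgammaf_ge0.
    - by move=> u; rewrite /= in_itv/= andbT; exact: pw.
  under eq_integral do rewrite EFinD.
  have D1 : 0 <= D * expR (- (q / 4)) by rewrite mulr_ge0 ?expR_ge0// ltW.
  rewrite ge0_integralD//; last 4 first.
  - by move=> u _; rewrite lee_fin potentialf_ge0.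
  - by apply/measurable_EFinP; exact: measurable_funTS.
  - by move=> u _; rewrite lee_fin mulr_ge0.
  - by apply/measurable_EFinP; exact: measurable_funTS.
  rewrite leeD2l//; under eq_integral do rewrite EFinM.
  rewrite ge0_integralZl_EFin//; last first.
    by apply/measurable_EFinP; apply: measurable_funTS; apply: measurable_indic; exact: measurable_itv.
  have mS : measurable (`]0%R, 1%R]%classic : set (measurableTypeR R)) by exact: measurable_itv.
  rewrite (integral_indic mu mI mS) /= setIidl; last first.
    by move=> u /=; rewrite !in_itv/= andbT => /andP[].
  by rewrite lebesgue_measure_itv/= lte_fin ltr01 sube0 mule1.
rewrite EFinD ge0_muleDl//; last by rewrite lee_fin divr_ge0// ltW.
rewrite mul1e leeD2l//.
apply: (@le_trans _ _ ((D / c0)%:E * (c0 * expR (- (q / 4)))%:E)%E).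
  rewrite -EFinM lee_fin le_eqVlt; apply/orP; left; apply/eqP.
  by field; rewrite gt_eqF.
by apply: lee_wpmul2l => //; rewrite lee_fin divr_ge0// ltW.
Qed.

End kernel_bounds.

(** * The potential integral near the origin *)

Section kernel_bounds_near0.
Context {R : realType}.
Notation mu := (@lebesgue_measure R).

Let mI : measurable (`]0%R, +oo[%classic : set (measurableTypeR R)).
Proof. exact: measurable_itv. Qed.

Let powRDu (u p q : R) : 0 < u -> u `^ p * u `^ q = u `^ (p + q).
Proof. by move=> u0; rewrite -powRD// (gt_eqF u0) implybT. Qed.

Let sq_powR (r p : R) : 0 < r -> (r ^+ 2) `^ p = r `^ (2 * p).
Proof. by move=> r0; rewrite -powR_mulrn ?(ltW r0)// -powRrM. Qed.

Lemma integral_invf (a b : R) : 0 < a -> a < b ->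
  (\int[mu]_(u in `[a, b]) (u^-1)%:E = (ln b - ln a)%:E)%E.
Proof.
move=> a0 ab.
have p (x : R) : a <= x <= b -> 0 < x by move=> /andP[ax _]; exact: lt_le_trans ax.
have dF (x : R) : a <= x <= b -> is_derive x 1 (@ln R) x^-1.
  by move=> /p x0; exact: is_derive1_ln.
have cf (x : R) : a <= x <= b -> {for x, continuous (fun y : R => y^-1)}.
  by move=> /p x0; apply: inv_continuous; rewrite gt_eqF.
by rewrite (ftc2 ab dF cf) -EFinB.
Qed.

Let ln_half (r : R) : 0 < r -> r <= 1 -> ln 2 <= ln (1 + r^-1).
Proof.
move=> r0 r1; rewrite ler_ln ?posrE ?addr_gt0 ?invr_gt0//.
by rewrite lerD2l invf_ge1.
Qed.

(** Majorize [kappa] by u^(b-1) and drop e^(-Mu); the pure power integral scales exactly. *)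
Let upper_lt d (b M : R) : 0 < b -> 0 <= M -> 2 * b < d%:R ->
  exists2 C : R, 0 < C & forall r, 0 < r <= 1 ->
    (\int[mu]_(u in `]0%R, +oo[) (potentialf d b M (r ^+ 2) u)%:E <=
     (C * r `^ (- (d%:R - 2 * b)))%:E)%E.
Proof.
move=> b0 M0 bd; set p := (d%:R - 2 * b) / 2.
have p0 : 0 < p by rewrite divr_gt0// subr_gt0.
have [I I0 HI] := integral_invgammaf_gt0 (lexx (0 : R)) p0 ltr01.
exists I => // r /andP[r0 r1]; have r20 : 0 < r ^+ 2 by rewrite exprn_gt0.
apply: (@le_trans _ _ (\int[mu]_(u in `]0%R, +oo[) (invgammaf 0 p (r ^+ 2) u)%:E)%E).
  apply: ge0_le_integral_EFin.
  - exact: mI.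
  - exact: measurable_potentialf.
  - exact: measurable_invgammaf.
  - by move=> u _; exact: potentialf_ge0.
  - by move=> u; rewrite /= in_itv/= andbT => u0; exact: potentialf_le_invgammaf0.
rewrite (integral_invgammaf_scale 0 p _ r20) mul0r divff ?gt_eqF// HI -EFinM mulrC.
by rewrite sq_powR// (_ : 2 * - p = - (d%:R - 2 * b))// /p; field.
Qed.

(** The range u in [r^2/2, r^2] suffices: there the Gaussian factor is at least e^(-1/2). *)
Let lower_lt d (b M : R) : 0 < b < 1 -> 0 <= M -> 2 * b < d%:R ->
  exists2 C : R, 0 < C & forall r, 0 < r <= 1 ->
    ((C * r `^ (- (d%:R - 2 * b)))%:E <=
     \int[mu]_(u in `]0%R, +oo[) (potentialf d b M (r ^+ 2) u)%:E)%E.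
Proof.
move=> /andP[b0 b1] M0 bd.
exists (expR (- M) * expR (- 2^-1) / 2) => [|r /andP[r0 r1]].
  by rewrite divr_gt0// mulr_gt0 ?expR_gt0.
set q := r ^+ 2; have q0 : 0 < q by rewrite exprn_gt0.
have q1 : q <= 1 by rewrite exprn_ile1// ltW.
have qq : 0 < q / 2 < q by rewrite divr_gt0//=; lra.
pose s := b - 1 - d%:R / 2.
have s0 : 0 <= - s by rewrite /s; have := ler0n R d; lra.
have := @integral_oy_ge R (fun u => (potentialf d b M q u)%:E) (q / 2) q
  (expR (- M) * (q `^ s * expR (- 2^-1))) qq.
rewrite (_ : _ * (q - q / 2) = expR (- M) * expR (- 2^-1) / 2 * r `^ (- (d%:R - 2 * b))).
  apply.
  - by rewrite !mulr_ge0 ?powR_ge0 ?expR_ge0.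
  - by apply/measurable_EFinP; exact: measurable_potentialf.
  - by move=> u _; rewrite lee_fin potentialf_ge0.
  move=> u /andP[u1 u2]; have u0 : 0 < u by apply: lt_le_trans u1; case/andP: qq.
  rewrite lee_fin; apply: (le_trans _ (potentialf_ge d b _ M0 u0 (le_trans u2 q1))).
  rewrite ler_wpM2l ?expR_ge0//; apply: ler_pM; rewrite ?powR_ge0 ?expR_ge0//.
    rewrite -/s -(opprK s) !(powRN _ (- s)) lef_pV2 ?posrE ?powR_gt0//.
    by apply: ge0_ler_powR; rewrite ?nnegrE ?(ltW u0) ?(ltW q0).
  rewrite ler_expR lerN2 ler_pdivrMr ?mulr_gt0//; lra.
have -> : q - q / 2 = q / 2 by field.
have -> : r `^ (- (d%:R - 2 * b)) = q `^ s * q.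
  rewrite -{2}(powRr1 (ltW q0)) powRDu// /q sq_powR//; congr (_ `^ _).
  by rewrite /s; field.
by ring.
Qed.

(** Here u^(b-1-d/2) is integrable at 0, so the Gaussian factor can be bounded by 1. *)
Let upper_gt d (b M : R) : 0 < b -> 0 <= M -> d%:R < 2 * b ->
  exists2 C : R, 0 < C & forall r, 0 < r <= 1 ->
    (\int[mu]_(u in `]0%R, +oo[) (potentialf d b M (r ^+ 2) u)%:E <= C%:E)%E.
Proof.
move=> b0 M0 bd.
pose f (u : R) := kappa b u * u `^ (- (d%:R / 2)).
have f0 (u : R) : 0 <= f u by rewrite mulr_ge0 ?kappa_ge0 ?powR_ge0.
have mf : measurable_fun setT f.
  by apply: measurable_funM; [exact: measurable_kappa|exact: measurable_powR].
have if_ : mu.-integrable `]0, +oo[ (EFin \o f).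
  apply: (@integrable_oy R _ (b - d%:R / 2) (b + d%:R / 2) 1) => //.
  - by lra.
  - by have := ler0n R d; lra.
  - move=> u /andP[u0 u1]; rewrite mul1r ger0_norm// /f /kappa u1 powRDu//.
    by rewrite (_ : b - 1 + - (d%:R / 2) = b - d%:R / 2 - 1)//; ring.
  - move=> u u1; have u0 : 0 < u by exact: lt_le_trans u1.
    rewrite mul1r ger0_norm// /f kappa_ge1// powRDu//.
    by rewrite (_ : - b - 1 + - (d%:R / 2) = - (b + d%:R / 2) - 1)//; ring.
have fi := integrable_fin_num mI if_.
have I0 : (0 <= \int[mu]_(u in `]0%R, +oo[) (f u)%:E)%E.
  by apply: integral_ge0 => u _; rewrite lee_fin.
exists (fine (\int[mu]_(u in `]0%R, +oo[) (f u)%:E)%E + 1) => [|r /andP[r0 r1]].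
  by rewrite ltr_wpDl// fine_ge0.
apply: (@le_trans _ _ (\int[mu]_(u in `]0%R, +oo[) (f u)%:E)%E); last first.
  by rewrite EFinD fineK// leeDl.
apply: ge0_le_integral_EFin.
- exact: mI.
- exact: measurable_potentialf.
- exact: mf.
- by move=> u _; exact: potentialf_ge0.
move=> u; rewrite /= in_itv/= andbT => u0; rewrite /potentialf /f.
have e1 : expR (- (M * u)) <= 1 by rewrite expR_le1 oppr_le0 mulr_ge0// ltW.
have e2 : expR (- (r ^+ 2 / (4 * u))) <= 1.
  by rewrite expR_le1 oppr_le0 divr_ge0// ?sqr_ge0// mulr_ge0// ltW.
apply: ler_pM; rewrite ?mulr_ge0 ?expR_ge0 ?kappa_ge0 ?powR_ge0//.
  by rewrite ler_piMl ?kappa_ge0.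
by rewrite ler_piMr ?powR_ge0.
Qed.

Let lower_gt d (b M : R) : 0 < b < 1 -> 0 <= M ->
  exists2 C : R, 0 < C & forall r, 0 < r <= 1 ->
    (C%:E <= \int[mu]_(u in `]0%R, +oo[) (potentialf d b M (r ^+ 2) u)%:E)%E.
Proof.
move=> /andP[b0 b1] M0.
exists (expR (- M) * expR (- 2^-1) / 2) => [|r /andP[r0 r1]].
  by rewrite divr_gt0// mulr_gt0 ?expR_gt0.
have q1 : r ^+ 2 <= 1 by rewrite exprn_ile1// ltW.
have qq : 0 < (2^-1 : R) < 1 by apply/andP; split; lra.
have := @integral_oy_ge R (fun u => (potentialf d b M (r ^+ 2) u)%:E) 2^-1 1
  (expR (- M) * expR (- 2^-1)) qq.
rewrite (_ : _ * (1 - 2^-1) = expR (- M) * expR (- 2^-1) / 2); last by field.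
apply.
- by rewrite mulr_ge0 ?expR_ge0.
- by apply/measurable_EFinP; exact: measurable_potentialf.
- by move=> u _; rewrite lee_fin potentialf_ge0.
move=> u /andP[u1 u2]; have u0 : 0 < u by lra.
rewrite lee_fin; apply: (le_trans _ (potentialf_ge d b _ M0 u0 u2)).
rewrite ler_wpM2l ?expR_ge0// -[leLHS]mul1r; apply: ler_pM; rewrite ?expR_ge0//.
  rewrite -[leLHS](powRr0 u); apply: ger_powR; first by rewrite u0 u2.
  by have := ler0n R d; lra.
by rewrite ler_expR lerN2 ler_pdivrMr ?mulr_gt0//; lra.
Qed.

(** The integrand is at least c/u on [r^2/2, 1], which gives c ln(2/r^2), and 2/r^2 >= 2/r >= 1 +
    1/r. *)
Let lower_eq (M : R) : 0 <= M ->
  exists2 C : R, 0 < C & forall r, 0 < r <= 1 ->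
    ((C * ln (1 + r^-1))%:E <=
     \int[mu]_(u in `]0%R, +oo[) (potentialf 1 2^-1 M (r ^+ 2) u)%:E)%E.
Proof.
move=> M0.
pose c := expR (- M) * expR (- 2^-1).
have c0 : 0 < c by rewrite mulr_gt0 ?expR_gt0.
exists c => // r /andP[r0 r1].
set q := r ^+ 2; have q0 : 0 < q by rewrite exprn_gt0.
have q1 : q <= 1 by rewrite exprn_ile1// ltW.
have q2 : 0 < q / 2 by rewrite divr_gt0.
have q21 : q / 2 < 1 by lra.
have mS : measurable (`[q / 2, 1]%classic : set (measurableTypeR R)) by exact: measurable_itv.
have mV (D : set R) : measurable_fun D (fun u : R => (u^-1)%:E).
  by apply/measurable_EFinP; apply: measurable_funTS; exact: (measurable_funV (@measurable_id _ _ _)).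
apply: (@le_trans _ _ (\int[mu]_(u in `[(q / 2)%R, 1%R]) (potentialf 1 2^-1 M q u)%:E)%E); last first.
  apply: ge0_subset_integral => //.
  - by apply/measurable_EFinP; apply: measurable_funTS; exact: measurable_potentialf.
  - by move=> u _; rewrite lee_fin potentialf_ge0.
  - by move=> u /=; rewrite !in_itv/= andbT => /andP[u1 _]; exact: lt_le_trans u1.
apply: (@le_trans _ _ (\int[mu]_(u in `[(q / 2)%R, 1%R]) (c * u^-1)%:E)%E); last first.
  apply: ge0_le_integral_EFin.
  - exact: mS.
  - by apply: measurable_funM => //; exact: (measurable_funV (@measurable_id _ _ _)).
  - exact: measurable_potentialf.
  - move=> u; rewrite /= in_itv/= => /andP[u1 _].
    by rewrite mulr_ge0 ?(ltW c0)// invr_ge0 (le_trans (ltW q2)).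
  move=> u; rewrite /= in_itv/= => /andP[u1 u2].
  have u0 : 0 < u by exact: lt_le_trans u1.
  apply: (le_trans _ (potentialf_ge 1 2^-1 _ M0 u0 u2)).
  rewrite /c -mulrA ler_wpM2l ?expR_ge0// mulrC.
  rewrite (_ : 2^-1 - 1 - 1 / 2 = - 1); last by field.
  rewrite powR_inv1 ?(ltW u0)// ler_wpM2l ?invr_ge0 ?(ltW u0)//.
  by rewrite ler_expR lerN2 ler_pdivrMr ?mulr_gt0//; lra.
under eq_integral do rewrite EFinM.
rewrite ge0_integralZl_EFin ?(ltW c0)//; last 2 first.
- move=> u; rewrite /= in_itv/= => /andP[u1 _].
  by rewrite lee_fin invr_ge0 (le_trans (ltW q2)).
- exact: mV.
rewrite integral_invf// -EFinM lee_fin ler_wpM2l ?(ltW c0)// ln1 sub0r -lnV ?posrE//.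
rewrite ler_ln ?posrE ?addr_gt0 ?invr_gt0//.
have rq : q <= r by rewrite /q expr2 ler_piMr// ltW.
rewrite invf_div; apply: (@le_trans _ _ (2 / r)).
  by rewrite ler_pdivlMr// mulrDl mulVf ?gt_eqF//; lra.
by rewrite ler_wpM2l// lef_pV2 ?posrE.
Qed.

(** Split at r^2 and 1. Below r^2 the integrand is at most C0/r^2, between it is at most 1/u, and
    above 1 at most u^(-2). The total C0 - ln(r^2) + 1 is absorbed using ln(1 + 1/r) >= ln 2 and
    ln(1 + 1/r) >= -ln r. *)
Let upper_eq (M : R) : 0 <= M ->
  exists2 C : R, 0 < C & forall r, 0 < r <= 1 ->
    (\int[mu]_(u in `]0%R, +oo[) (potentialf 1 2^-1 M (r ^+ 2) u)%:E <=
     (C * ln (1 + r^-1))%:E)%E.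
Proof.
move=> M0.
have i4 : (0 : R) < 4^-1 by rewrite invr_gt0.
have [C0 C00 HC0] := powR_expRV_bounded (ler01 : (0 : R) <= 1) i4.
have l2 : 0 < ln (2 : R) by rewrite ln_gt0// ltr1n.
exists ((C0 + 1) / ln 2 + 2) => [|r /andP[r0 r1]].
  by rewrite addr_gt0// divr_gt0// addr_gt0.
set q := r ^+ 2; have q0 : 0 < q by rewrite exprn_gt0.
have q1 : q <= 1 by rewrite exprn_ile1// ltW.
have E (u : R) : 0 < u -> u <= 1 -> potentialf 1 2^-1 M q u <= u^-1 * expR (- (q / (4 * u))).
  move=> u0 u1; rewrite /potentialf /kappa u1 mulrA ler_wpM2r ?expR_ge0// -mulrA powRDu//.
  rewrite (_ : 2^-1 - 1 + - (1 / 2) = - 1); last by field.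
  rewrite powR_inv1 ?(ltW u0)// ler_piMl ?invr_ge0 ?(ltW u0)//.
  by rewrite expR_le1 oppr_le0 mulr_ge0// ltW.
have E0 (u : R) : 0 < u -> u <= q -> potentialf 1 2^-1 M q u <= C0 / q.
  move=> u0 uq; apply: (le_trans (E u u0 (le_trans uq q1))).
  rewrite ler_pdivlMr// -mulrA mulrC -mulrA.
  have := HC0 (u / q) (divr_gt0 u0 q0); apply: le_trans.
  rewrite powR_inv1 ?divr_ge0 ?(ltW u0) ?(ltW q0)// invf_div.
  rewrite le_eqVlt; apply/orP; left; apply/eqP.
  rewrite (_ : 4^-1 * (q / u) = q / (4 * u)); first by ring.
  by field; rewrite !gt_eqF.
have E1 (u : R) : 0 < u -> u <= 1 -> potentialf 1 2^-1 M q u <= u^-1.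
  move=> u0 u1; apply: (le_trans (E u u0 u1)); rewrite ler_piMr ?invr_ge0 ?(ltW u0)//.
  by rewrite expR_le1 oppr_le0 divr_ge0 ?(ltW q0)// mulr_ge0// ltW.
have E2 (u : R) : 1 <= u -> potentialf 1 2^-1 M q u <= u `^ (- 1 - 1).
  move=> u1; have u0 : 0 < u by exact: lt_le_trans u1.
  rewrite /potentialf kappa_ge1//.
  rewrite (_ : u `^ (- 1 - 1) = 1 * u `^ (- 2^-1 - 1) * (u `^ (- (1 / 2)) * 1)); last first.
    by rewrite mul1r mulr1 powRDu//; congr (_ `^ _); field.
  apply: ler_pM; rewrite ?mulr_ge0 ?expR_ge0 ?powR_ge0//.
    by rewrite ler_wpM2r ?powR_ge0// expR_le1 oppr_le0 mulr_ge0// ltW.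
  rewrite ler_wpM2l ?powR_ge0// expR_le1 oppr_le0 divr_ge0 ?(ltW q0)//.
  by rewrite mulr_ge0// ltW.
have mS (a b : itv_bound R) : measurable ([set` Interval a b] : set (measurableTypeR R)).
  exact: measurable_itv.
have mf (D : set R) : measurable_fun D (fun u => (potentialf 1 2^-1 M q u)%:E).
  by apply/measurable_EFinP; apply: measurable_funTS; exact: measurable_potentialf.
have f0 (u : R) : (0 <= (potentialf 1 2^-1 M q u)%:E)%E by rewrite lee_fin potentialf_ge0.
have split1 : (\int[mu]_(u in `]0%R, +oo[) (potentialf 1 2^-1 M q u)%:E <=
   \int[mu]_(u in `]0%R, q]) (potentialf 1 2^-1 M q u)%:E +
   (\int[mu]_(u in `[q, 1%R]) (potentialf 1 2^-1 M q u)%:E +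
   \int[mu]_(u in `[1%R, +oo[) (potentialf 1 2^-1 M q u)%:E))%E.
  have -> : (`]0, +oo[%classic : set R) = `]0, q]%classic `|` (`]q, 1]%classic `|` `]1, +oo[%classic).
    rewrite -itv_bndbnd_setU// ?bnd_simp// -itv_bndbnd_setU// bnd_simp//.
    exact: ltW.
  have dj1 : [disjoint (`]0, q]%classic : set R) & `]q, 1]%classic `|` `]1, +oo[%classic].
    apply/disj_set2P/seteqP; split => // u [] /=; rewrite !in_itv/= !andbT.
    by move=> /andP[_ uq] []; [move=> /andP[qu _]|move=> qu]; move: uq; rewrite leNgt ?qu// (le_lt_trans q1).
  have dj2 : [disjoint (`]q, 1]%classic : set R) & `]1, +oo[%classic].
    apply/disj_set2P/seteqP; split => // u [] /=; rewrite !in_itv/= andbT.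
    by move=> /andP[_ u1]; rewrite ltNge u1.
  rewrite (ge0_integral_setU mu (mS _ _) (measurableU _ _ (mS _ _) (mS _ _)) (mf _) (fun u _ => f0 u) dj1).
  rewrite (ge0_integral_setU mu (mS _ _) (mS _ _) (mf _) (fun u _ => f0 u) dj2).
  apply: leeD => //.
  apply: leeD; (apply: ge0_subset_integral;
    [exact: mS|exact: mS|exact: mf|by move=> u _; exact: f0|]).
    by move=> u /=; rewrite !in_itv/= => /andP[/ltW -> ->].
  by move=> u /=; rewrite !in_itv/= !andbT => /ltW.
apply: (le_trans split1).
apply: (@le_trans _ _ (C0%:E + ((- ln q)%:E + 1%:E))%E); last first.
  rewrite -!EFinD lee_fin /q lnXn// mulrDl.
  have h1 := ln_half r0 r1.
  have h2 : - ln r <= ln (1 + r^-1).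
    by rewrite -lnV ?posrE// ler_ln ?posrE ?addr_gt0 ?invr_gt0// lerDr.
  have : C0 + 1 <= (C0 + 1) / ln 2 * ln (1 + r^-1).
    rewrite -[leLHS](divfK (lt0r_neq0 l2)) ler_wpM2l//.
    by rewrite divr_ge0// ?(ltW l2)// addr_ge0// ltW.
  by rewrite mulr2n; lra.
apply: leeD; last apply: leeD.
- apply: (@le_trans _ _ (\int[mu]_(u in `]0%R, q]) (C0 / q)%:E)%E).
    apply: ge0_le_integral_EFin => //.
    - exact: measurable_potentialf.
    - by move=> u _; exact: potentialf_ge0.
    - by move=> u; rewrite /= in_itv/= => /andP[]; exact: E0.
  rewrite (integral_cst mu (mS _ _) (C0 / q)%:E) /= lebesgue_measure_itv/= lte_fin q0 sube0.
  by rewrite -EFinM divfK// gt_eqF.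
- move: (q1); rewrite le_eqVlt => /predU1P[->|qlt].
    by rewrite set_itv1 integral_set1 ln1 oppr0.
  apply: (@le_trans _ _ (\int[mu]_(u in `[q, 1%R]) (u^-1)%:E)%E).
    apply: ge0_le_integral_EFin => //.
    - exact: measurable_potentialf.
    - exact: (measurable_funV (@measurable_id _ _ _)).
    - by move=> u _; exact: potentialf_ge0.
    move=> u; rewrite /= in_itv/= => /andP[qu u1].
    by apply: E1 => //; exact: lt_le_trans qu.
  by rewrite integral_invf// ln1 sub0r.
- apply: (@le_trans _ _ (\int[mu]_(u in `[1%R, +oo[) (u `^ (- 1 - 1))%:E)%E).
    apply: ge0_le_integral_EFin => //.
    - exact: measurable_potentialf.
    - by move=> u _; exact: potentialf_ge0.
    - by move=> u; rewrite /= in_itv/= andbT; exact: E2.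
  by rewrite integral1y_powR// invr1.
Qed.

(** Near the origin the integral behaves like that of u^(b-1-d/2) over [r^2, 1]; the sign of 2b - d
    decides between a power, a logarithm and a constant, which are the three cases of
    [rollnik_h]. *)
Lemma potential_rollnik_h d (b M : R) : (0 < d)%N -> 0 < b < 1 -> 0 <= M ->
  exists2 C : R, 0 < C & forall r, 0 < r <= 1 ->
    (\int[mu]_(u in `]0%R, +oo[) (potentialf d b M (r ^+ 2) u)%:E <=
     (C * rollnik_h d (2 * b) r)%:E)%E /\
    ((C^-1 * rollnik_h d (2 * b) r)%:E <=
     \int[mu]_(u in `]0%R, +oo[) (potentialf d b M (r ^+ 2) u)%:E)%E.
Proof.
move=> d0 b01 M0; have /andP[b0 b1] := b01.
have comb (h : R -> R) (Z : R -> \bar R) :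
    (forall r, 0 < r <= 1 -> 0 <= h r) ->
    (exists2 C : R, 0 < C & forall r, 0 < r <= 1 -> (Z r <= (C * h r)%:E)%E) ->
    (exists2 C : R, 0 < C & forall r, 0 < r <= 1 -> ((C * h r)%:E <= Z r)%E) ->
    exists2 C : R, 0 < C & forall r, 0 < r <= 1 ->
      (Z r <= (C * h r)%:E)%E /\ ((C^-1 * h r)%:E <= Z r)%E.
  move=> h0 [C C0 HC] [c c0 Hc]; exists (C + c^-1) => [|r r01].
    by rewrite addr_gt0// invr_gt0.
  split.
    by apply: (le_trans (HC r r01)); rewrite lee_fin ler_wpM2r ?h0// lerDl invr_ge0 ltW.
  apply: (le_trans _ (Hc r r01)); rewrite lee_fin ler_wpM2r ?h0//.
  by rewrite invf_ple ?posrE ?addr_gt0 ?invr_gt0// lerDr ltW.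
have [bd|bd|bd] := ltgtP (2 * b) d%:R.
- have -> : rollnik_h d (2 * b) = (fun r => r `^ (- (d%:R - 2 * b))).
    by apply/funext => r; rewrite /rollnik_h bd.
  apply: comb; [by move=> r _; exact: powR_ge0|exact: upper_lt|exact: lower_lt].
- have -> : rollnik_h d (2 * b) = fun=> 1.
    by apply/funext => r; rewrite /rollnik_h ltNge (ltW bd)/= gt_eqF.
  apply: comb => //.
    have [C C0 HC] := upper_gt b0 M0 bd; exists C => // r r01.
    by rewrite mulr1; exact: HC.
  have [C C0 HC] := lower_gt d b01 M0; exists C => // r r01.
  by rewrite mulr1; exact: HC.
(* 2b = d with b < 1 leaves d = 1 and b = 1/2. *)
have d1 : d = 1%N.
  have : (d < 2)%N by rewrite -(ltr_nat R) -bd; lra.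
  by case: d d0 {bd} => [|[|d]].
have bE : b = 2^-1 by move: bd; rewrite d1 => ?; lra.
rewrite d1 in bd *.
have -> : rollnik_h 1 (2 * b) = (fun r => ln (1 + r^-1)).
  by apply/funext => r; rewrite /rollnik_h bd ltxx eqxx.
rewrite bE; apply: comb; [|exact: upper_eq|exact: lower_eq].
by move=> r /andP[r0 r1]; rewrite ln_ge0// lerDl invr_ge0 ltW.
Qed.

End kernel_bounds_near0.

(** * Pointwise bounds for the resolvent kernel *)

Section resolvent_bounds.
Context {R : realType}.
Notation mu := (@lebesgue_measure R).

Let mI : measurable (`]0%R, +oo[%classic : set (measurableTypeR R)).
Proof. exact: measurable_itv. Qed.

Lemma potential_rollnik_H d (b m : R) : (0 < d)%N -> 0 < b < 1 -> 0 <= m ->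
  exists2 C : R, 0 < C & forall r, 0 < r ->
    (\int[mu]_(u in `]0%R, +oo[) (potentialf d b (m `^ b^-1) (r ^+ 2) u)%:E <=
     (C * rollnik_H d (2 * b) m r)%:E)%E /\
    ((rollnik_H d (2 * b) m r)%:E <=
     C%:E * \int[mu]_(u in `]0%R, +oo[) (potentialf d b (m `^ b^-1) (r ^+ 2) u)%:E)%E.
Proof.
move=> d0 b01 m0; have /andP[b0 b1] := b01.
have a0 : 0 < 2 * b by rewrite mulr_gt0.
set M := m `^ b^-1; have M0 : 0 <= M by exact: powR_ge0.
have [C1 C10 H1] := potential_rollnik_h d0 b01 M0.
have [k k0 Hk] := rollnik_H_gt1 d a0 m0.
have [C2 C20 H2] := invgammaf_le_potential d b0 M0.
have Mb : m `^ (2 * b / 2)^-1 = M by rewrite /M mulrC mulKf.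
exists (C1 + k^-1 + k * C2) => [|r r0].
  by rewrite !addr_gt0 ?invr_gt0 ?mulr_gt0.
have Z0 : (0 <= \int[mu]_(u in `]0%R, +oo[) (potentialf d b M (r ^+ 2) u)%:E)%E.
  by apply: integral_ge0 => u _; rewrite lee_fin potentialf_ge0.
have kC0 : 0 < k * C2 by rewrite mulr_gt0.
have ki0 : 0 < k^-1 by rewrite invr_gt0.
have [r1|r1] := leP r 1.
  have r01 : 0 < r <= 1 by rewrite r0.
  have [h1 h2] := H1 r r01.
  have HE : rollnik_H d (2 * b) m r = rollnik_h d (2 * b) r by rewrite /rollnik_H r1.
  have h0 : 0 <= rollnik_h d (2 * b) r.
    rewrite /rollnik_h; case: ifP => _; first exact: powR_ge0.
    by case: ifP => // _; rewrite ln_ge0// lerDl invr_ge0 ltW.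
  rewrite HE; split.
    by apply: (le_trans h1); rewrite lee_fin ler_wpM2r//; lra.
  have h3 : ((rollnik_h d (2 * b) r)%:E <= C1%:E *
      \int[mu]_(u in `]0%R, +oo[) (potentialf d b M (r ^+ 2) u)%:E)%E.
    have -> : rollnik_h d (2 * b) r = C1 * (C1^-1 * rollnik_h d (2 * b) r).
      by rewrite mulVKf// gt_eqF.
    by rewrite EFinM; apply: lee_wpmul2l => //; rewrite lee_fin ltW.
  by apply: (le_trans h3); apply: lee_wpmul2r => //; rewrite lee_fin; lra.
have q1 : 1 <= r ^+ 2 by rewrite expr_ge1// ltW.
have := Hk r r1; rewrite Mb.
have h1 := @potential_le_invgammaf R d b M (r ^+ 2) b0.
have h2 := H2 _ q1.
move: h1 h2; set Y := (\int[mu]_(u in _) (invgammaf _ _ _ _)%:E)%E.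
set Z := (\int[mu]_(u in _) _)%E in Z0 * => h1 h2 HH.
have Y0 : (0 <= Y)%E by exact: le_trans h1.
have H0 : 0 <= rollnik_H d (2 * b) m r.
  by rewrite -lee_fin HH mule_ge0// lee_fin ltW.
have YE : Y = (k^-1 * rollnik_H d (2 * b) m r)%:E.
  by rewrite EFinM HH muleA -EFinM mulVf ?gt_eqF// mul1e.
split.
  by apply: (le_trans h1); rewrite YE lee_fin ler_wpM2r//; lra.
rewrite HH; apply: (@le_trans _ _ (k%:E * (C2%:E * Z))%E).
  by apply: lee_wpmul2l => //; rewrite lee_fin ltW.
rewrite muleA -EFinM; apply: lee_wpmul2r => //; rewrite lee_fin; lra.
Qed.

Lemma normE_sqr d (x : euclid R d) : normE x ^+ 2 = dotE x x.
Proof. by rewrite /normE sqr_sqrtr// dotEE_ge0. Qed.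

Lemma dotEE_gt0 d (x : euclid R d) : (0 < d)%N -> (forall i, tnth x i != 0) ->
  0 < dotE x x.
Proof.
move=> d0 x0; rewrite lt_neqAle dotEE_ge0 andbT eq_sym; apply/negP => /eqP q.
case: d d0 x x0 q => // d _ x x0 /eqP.
rewrite /dotE psumr_eq0 => [/allP /(_ ord0)|i _]; last by rewrite -expr2 sqr_ge0.
by rewrite mem_index_enum mulf_eq0 orbb (negbTE (x0 _)) => /(_ isT).
Qed.

Lemma heat_kernelE d (alpha m t : R) (x : euclid R d) : 0 < alpha < 2 -> 0 <= m -> 0 < t ->
  heat_kernel alpha m t x =
  (2 * pi) ^- d * radial x (hphi (alpha / 2) (m `^ (alpha / 2)^-1) m t 0).
Proof.
move=> /andP[a0 a2] m0 t0; rewrite /heat_kernel; congr (_ * _).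
have b01 : 0 < alpha / 2 < 1 by apply/andP; split; lra.
have rh : rapid (hphi (alpha / 2) (m `^ (alpha / 2)^-1) m t 0).
  by apply: hphi_rapid => //; exact: powR_ge0.
have := congr1 fine (integral_cos_radial x rh); rewrite /= => <-.
rewrite /Rintegral; congr fine; apply: eq_integral => y _; congr EFin; congr (_ * expR _).
by rewrite /symbolL normE_sqr invf_div mul0r addr0 mulNr.
Qed.

(** The factor (2 pi)^(-d) is that of the inverse Fourier transform, and the power of the square
    root of pi comes from the Gaussian kernels. *)
Lemma resolvent_kernelE d (alpha m l C : R) (g : R -> R) (x : euclid R d) : (0 < d)%N ->
  0 < alpha < 2 -> d%:R < 2 * alpha -> 0 <= m -> 0 < l ->
  measurable_fun setT g -> (forall u, 0 <= g u) ->
  (forall u, 0 < u -> g u <= C * kappa (alpha / 2) u) ->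
  (forall s, 0 < s -> (\int[mu]_(u in `]0%R, +oo[) (g u * expR (- (s * u)))%:E =
      ((l + ((s + m `^ (alpha / 2)^-1) `^ (alpha / 2) - m))^-1)%:E)%E) ->
  (forall i, tnth x i != 0) ->
  (resolvent_kernel alpha m l x = ((Num.sqrt pi / (2 * pi)) ^+ d)%:E *
    \int[mu]_(u in `]0%R, +oo[)
      (g u * (u `^ (- (d%:R / 2)) * expR (- (dotE x x / (4 * u)))))%:E)%E.
Proof.
move=> d0 a02 da m0 l0 mg g0 gC L x0; have /andP[a0 a2] := a02.
have b01 : 0 < alpha / 2 < 1 by apply/andP; split; lra.
have db : d%:R < 4 * (alpha / 2) by lra.
have ir := integrable_resolvent_radial b01 db m0 l0 x0.
transitivity (((2 * pi) ^- d)%:E * \int[mu]_(t in `]0%R, +oo[)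
    (expR (- (l * t)) * radial x (hphi (alpha / 2) (m `^ (alpha / 2)^-1) m t 0))%:E)%E.
  rewrite /resolvent_kernel -(integralZl mI ir).
  apply: eq_integral => t /set_mem; rewrite /= in_itv/= andbT => t0.
  by rewrite heat_kernelE// -EFinM mulNr mulrCA.
rewrite (resolvent_radial d0 b01 db m0 l0 mg g0 gC L x0).
have E : (\int[mu]_(u in `]0%R, +oo[) (g u * gauss_kernel d (dotE x x) u)%:E =
    (Num.sqrt pi ^+ d)%:E * \int[mu]_(u in `]0%R, +oo[)
      (g u * (u `^ (- (d%:R / 2)) * expR (- (dotE x x / (4 * u)))))%:E)%E.
  rewrite -ge0_integralZl_EFin ?exprn_ge0 ?sqrtr_ge0//; last 2 first.
  - by move=> u _; rewrite lee_fin !mulr_ge0 ?powR_ge0 ?expR_ge0.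
  - apply/measurable_EFinP; apply: measurable_funTS; apply: measurable_funM => //.
    apply: measurable_funM; first exact: measurable_powR.
    apply: measurableT_comp => //; apply: measurableT_comp => //.
    by apply: measurable_funM => //; apply: measurable_funV; exact: measurable_funM.
  apply: eq_integral => u /set_mem; rewrite /= in_itv/= andbT => u0.
  by rewrite gauss_kernelE// -EFinM; congr EFin; ring.
by rewrite E muleA -EFinM expr_div_n mulrC.
Qed.

(** The bounds on g carry over to its integral against the Gaussian weight, and
    [potential_rollnik_H] names the result. *)
Lemma resolvent_kernel_bounds d (alpha m l : R) : (0 < d)%N ->
  0 < alpha < 2 -> d%:R < 2 * alpha -> 0 <= m -> 0 < l ->
  [/\ forall x : euclid R d, (forall i, tnth x i != 0) ->
        (0 <= resolvent_kernel alpha m l x)%E,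
      exists2 C : R, 0 < C & forall x : euclid R d, (forall i, tnth x i != 0) ->
        (resolvent_kernel alpha m l x <= (C * rollnik_H d alpha 0 (normE x))%:E)%E,
      exists2 C : R, 0 < C & forall x : euclid R d, (forall i, tnth x i != 0) ->
        ((rollnik_H d alpha m (normE x))%:E <= C%:E * resolvent_kernel alpha m l x)%E &
      m < l -> exists2 C : R, 0 < C & forall x : euclid R d, (forall i, tnth x i != 0) ->
        (resolvent_kernel alpha m l x <= (C * rollnik_H d alpha m (normE x))%:E)%E].
Proof.
move=> d0 a02 da m0 l0; have /andP[a0 a2] := a02.
set b := alpha / 2.
have b01 : 0 < b < 1 by apply/andP; split; rewrite /b; lra.
have ab : alpha = 2 * b by rewrite /b mulrC divfK.
have [g [[mg g0] L [c c0 glow] [C C0 ghi] ghi2]] := resolvent_density b01 m0 l0.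
pose w (q u : R) := u `^ (- (d%:R / 2)) * expR (- (q / (4 * u))).
have w0 q u : 0 <= w q u by rewrite mulr_ge0 ?powR_ge0 ?expR_ge0.
have mw q : measurable_fun setT (w q).
  apply: measurable_funM; first exact: measurable_powR.
  apply: measurableT_comp => //; apply: measurableT_comp => //.
  by apply: measurable_funM => //; apply: measurable_funV; exact: measurable_funM.
have mgw q : measurable_fun setT (fun u => g u * w q u) by exact: measurable_funM.
have [S S0 RE] : exists2 S : R, 0 < S & forall x : euclid R d, (forall i, tnth x i != 0) ->
    resolvent_kernel alpha m l x =
    (S%:E * \int[mu]_(u in `]0%R, +oo[) (g u * w (dotE x x) u)%:E)%E.
  exists ((Num.sqrt pi / (2 * pi)) ^+ d) => [|x x0].
    by rewrite exprn_gt0// divr_gt0 ?sqrtr_gt0 ?pi_gt0// mulr_gt0 ?pi_gt0.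
  exact: (resolvent_kernelE d0 a02 da m0 l0 mg g0 ghi L x0).
have nx0 (x : euclid R d) : (forall i, tnth x i != 0) -> 0 < normE x.
  by move=> x0; rewrite sqrtr_gt0 dotEE_gt0.
have P0 M q : (0 <= \int[mu]_(u in `]0%R, +oo[) (potentialf d b M q u)%:E)%E.
  by apply: integral_ge0 => u _; rewrite lee_fin potentialf_ge0.
have ZL k M q : 0 <= k -> (\int[mu]_(u in `]0%R, +oo[) (k * potentialf d b M q u)%:E =
    k%:E * \int[mu]_(u in `]0%R, +oo[) (potentialf d b M q u)%:E)%E.
  move=> k0; under eq_integral do rewrite EFinM.
  rewrite ge0_integralZl_EFin//.
  - by move=> u _; rewrite lee_fin potentialf_ge0.
  - by apply/measurable_EFinP; apply: measurable_funTS; exact: measurable_potentialf.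
(* One argument for both upper bounds: m' = m keeps the exponential, while m' = 0 removes it because
   the power 1/b of 0 is 0. *)
have upper (m' A : R) : 0 <= m' -> 0 < A ->
    (forall u, 0 < u -> g u <= A * expR (- (m' `^ b^-1 * u)) * kappa b u) ->
    exists2 C : R, 0 < C & forall x : euclid R d, (forall i, tnth x i != 0) ->
        (resolvent_kernel alpha m l x <= (C * rollnik_H d alpha m' (normE x))%:E)%E.
  move=> m'0 A0 gA; have [B B0 HB] := potential_rollnik_H d0 b01 m'0.
  exists (S * (A * B)) => [|x x0]; first exact: mulr_gt0 S0 (mulr_gt0 A0 B0).
  have [h _] := HB _ (nx0 x x0); rewrite (RE x x0) ab.
  set H := rollnik_H _ _ _ _ in h *.
  have -> : S * (A * B) * H = S * (A * (B * H)) by ring.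
  rewrite (EFinM S); apply: lee_wpmul2l; first by rewrite lee_fin ltW.
  rewrite (EFinM A); apply: le_trans (lee_wpmul2l _ h); last by rewrite lee_fin ltW.
  rewrite -ZL ?(ltW A0)// normE_sqr; apply: ge0_le_integral_EFin.
  - exact: mI.
  - exact: mgw.
  - by apply: measurable_funM => //; exact: measurable_potentialf.
  - by move=> u _; rewrite mulr_ge0.
  - move=> u; rewrite /= in_itv/= andbT => u0.
    rewrite (_ : A * potentialf _ _ _ _ _ =
      A * expR (- (m' `^ b^-1 * u)) * kappa b u * w (dotE x x) u); last first.
      by rewrite /potentialf /w; ring.
    by apply: ler_wpM2r; [exact: w0|exact: gA].
split.
- move=> x x0; rewrite RE// mule_ge0 ?lee_fin ?(ltW S0)//.
  by apply: integral_ge0 => u _; rewrite lee_fin mulr_ge0.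
- apply: (upper 0 C) => // u u0; rewrite powR0; last first.
    by rewrite invr_eq0 gt_eqF//; case/andP: b01.
  by rewrite mul0r oppr0 expR0 mulr1; exact: ghi.
- have [B B0 HB] := potential_rollnik_H d0 b01 m0.
  exists (B / (S * c)) => [|x x0]; first exact: divr_gt0 B0 (mulr_gt0 S0 c0).
  have [_ h] := HB _ (nx0 x x0); rewrite (RE x x0) ab; apply: (le_trans h).
  have -> X : ((B / (S * c))%:E * (S%:E * X) = B%:E * ((c^-1)%:E * X))%E.
    rewrite !muleA -!EFinM; congr (_%:E * _)%E.
    by field; rewrite (gt_eqF S0) (gt_eqF c0).
  apply: lee_wpmul2l; first by rewrite lee_fin ltW.
  rewrite normE_sqr -[leLHS]mul1e -(mulVf (lt0r_neq0 c0)) EFinM -muleA.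
  apply: lee_wpmul2l; first by rewrite lee_fin invr_ge0 ltW.
  rewrite -ZL ?(ltW c0)//; apply: ge0_le_integral_EFin.
  - exact: mI.
  - by apply: measurable_funM => //; exact: measurable_potentialf.
  - exact: mgw.
  - by move=> u _; rewrite mulr_ge0 ?potentialf_ge0// ltW.
  - move=> u; rewrite /= in_itv/= andbT => u0.
    rewrite (_ : c * potentialf _ _ _ _ _ =
      c * expR (- (m `^ b^-1 * u)) * kappa b u * w (dotE x x) u); last first.
      by rewrite /potentialf /w; ring.
    by apply: ler_wpM2r; [exact: w0|exact: glow].
- by move=> ml; have [A A0 gA] := ghi2 ml; exact: (upper m A).
Qed.

End resolvent_bounds.

(** * From kernel bounds to Hilbert-Schmidt norms *)

Section birman_schwinger.
Context {R : realType}.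
Notation mu := (@lebesgue_measure R).

Let mI : measurable (`]0%R, +oo[%classic : set (measurableTypeR R)).
Proof. exact: measurable_itv. Qed.

Lemma measurable_subE d :
  measurable_fun setT (fun z : euclid R d * euclid R d => subE z.1 z.2).
Proof.
apply/measurable_fun_tnthP => i.
rewrite (_ : _ \o _ = fun z : euclid R d * euclid R d => tnth z.1 i - tnth z.2 i); last first.
  by apply/funext => z; rewrite /= tnth_mktuple.
apply: measurable_funB.
- exact: (measurableT_comp (measurable_tnth i) measurable_fst).
- exact: (measurableT_comp (measurable_tnth i) measurable_snd).
Qed.

Lemma measurable_normE d : measurable_fun setT (@normE R d).
Proof.
apply: (measurableT_comp _ (@measurable_dotEE R d)).
exact: (continuous_measurable_fun (@sqrt_continuous R)).
Qed.

Lemma measurable_symbolL d (alpha m : R) : measurable_fun setT (@symbolL R d alpha m).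
Proof.
apply: measurable_funB => //; apply: (measurableT_comp (measurable_powR _)).
by apply: measurable_funD => //; apply: measurable_funX; exact: measurable_normE.
Qed.

Lemma measurable_heat_kernel d (alpha m : R) :
  measurable_fun setT (fun z : euclid R d * measurableTypeR R => heat_kernel alpha m z.2 z.1).
Proof.
apply: measurable_funM => //.
pose f (w : (euclid R d * measurableTypeR R) * euclid R d) : \bar R :=
  (cos (dotE w.1.1 w.2) * expR (- w.1.2 * symbolL alpha m w.2))%:E.
have mf : measurable_fun setT f.
  have m11 : measurable_fun setT
      (fun w : (euclid R d * measurableTypeR R) * euclid R d => w.1.1).
    exact: (measurableT_comp measurable_fst measurable_fst).
  have m12 : measurable_fun setT
      (fun w : (euclid R d * measurableTypeR R) * euclid R d => w.1.2).
    exact: (measurableT_comp measurable_snd measurable_fst).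
  apply/measurable_EFinP; apply: measurable_funM.
    apply: measurableT_comp; first exact: (continuous_measurable_fun (@continuous_cos R)).
    apply: measurable_sum => i; apply: measurable_funM.
    - exact: (measurableT_comp (measurable_tnth i) m11).
    - exact: (measurableT_comp (measurable_tnth i) measurable_snd).
  apply: measurableT_comp => //; apply: measurable_funM.
    exact: measurableT_comp.
  exact: (measurableT_comp (@measurable_symbolL d alpha m) measurable_snd).
exact: (measurableT_comp (fine_measurable measurableT)
  (measurable_integral_section (lebesgueE d) measurableT mf)).
Qed.

Lemma measurable_resolvent_kernel d (alpha m l : R) :
  measurable_fun setT (@resolvent_kernel R d alpha m l).
Proof.
apply: (@measurable_integral_section R _ _ _ _ mu `]0, +oo[%classic
  (fun z : euclid R d * measurableTypeR R =>
    (expR (- l * z.2) * heat_kernel alpha m z.2 z.1)%:E) mI).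
apply/measurable_EFinP; apply: measurable_funM; last exact: measurable_heat_kernel.
by apply: measurableT_comp => //; exact: measurable_funM.
Qed.

Lemma measurable_BS_kernel d (alpha m l : R) (V : euclid R d -> R) :
  measurable_fun setT V -> measurable_fun setT (BS_kernel alpha m l V).
Proof.
move=> mV.
have ms (f : euclid R d * euclid R d -> euclid R d) : measurable_fun setT f ->
    measurable_fun setT (fun z => (Num.sqrt `|V (f z)|)%:E).
  move=> mf; apply/measurable_EFinP; apply: measurableT_comp.
    exact: (continuous_measurable_fun (@sqrt_continuous R)).
  by apply: measurableT_comp => //; exact: measurableT_comp.
apply: emeasurable_funM; last by apply: ms; exact: measurable_snd.
apply: emeasurable_funM; first by apply: ms; exact: measurable_fst.
exact: (measurableT_comp (@measurable_resolvent_kernel d alpha m l) (@measurable_subE d)).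
Qed.

Lemma measurable_besselK (p : R) : measurable_fun setT (besselK p).
Proof.
apply: measurable_funM.
  apply: measurable_funM => //; apply: (measurableT_comp (measurable_powR p)).
  exact: measurable_funM.
pose f (w : measurableTypeR R * measurableTypeR R) : \bar R :=
  (w.2 `^ (- p - 1) * expR (- w.2 - w.1 ^+ 2 / (4 * w.2)))%:E.
have mf : measurable_fun setT f.
  apply/measurable_EFinP; apply: measurable_funM.
    exact: (measurableT_comp (measurable_powR _) measurable_snd).
  apply: measurableT_comp => //; apply: measurable_funB; first exact: measurableT_comp.
  apply: measurable_funM; first by apply: measurable_funX; exact: measurable_fst.
  apply: measurable_funV; apply: measurable_funM => //; exact: measurable_snd.
exact: (measurableT_comp (fine_measurable measurableT)
  (measurable_integral_section mu mI mf)).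
Qed.

Lemma measurable_rollnik_H d (alpha m : R) : measurable_fun setT (rollnik_H d alpha m).
Proof.
apply: measurable_fun_ifT; first exact: measurable_fun_ler.
  rewrite /rollnik_h; case: (alpha < d%:R); first exact: measurable_powR.
  case: (alpha == d%:R) => //.
  apply: (measurableT_comp (@measurable_ln R)).
  by apply: measurable_funD => //; exact: (measurable_funV (@measurable_id _ _ _)).
case: (m == 0); first by apply: measurable_funM => //; exact: measurable_powR.
apply: measurable_funM; first exact: measurable_powR.
apply: measurable_funM => //.
by apply: (measurableT_comp (measurable_besselK _)); exact: measurable_funM.
Qed.

Definition rollnik_integrand d (alpha m : R) (V : euclid R d -> R)
    (z : euclid R d * euclid R d) : \bar R :=
  (rollnik_H d alpha m (normE (subE z.1 z.2)) ^+ 2 * `|V z.1| * `|V z.2|)%:E.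

Lemma measurable_rollnik_integrand d (alpha m : R) (V : euclid R d -> R) :
  measurable_fun setT V -> measurable_fun setT (rollnik_integrand alpha m V).
Proof.
move=> mV; apply/measurable_EFinP.
have mN : measurable_fun setT (fun x => `|V x|) by exact: measurableT_comp.
apply: measurable_funM; last exact: (measurableT_comp mN measurable_snd).
apply: measurable_funM; last exact: (measurableT_comp mN measurable_fst).
apply: measurable_funX; apply: (measurableT_comp (@measurable_rollnik_H d alpha m)).
exact: (measurableT_comp (@measurable_normE d) (@measurable_subE d)).
Qed.

Lemma rollnik_integrand_ge0 d (alpha m : R) (V : euclid R d -> R) z :
  (0 <= rollnik_integrand alpha m V z)%E.
Proof.
rewrite lee_fin; apply: mulr_ge0 => //; apply: mulr_ge0 => //; exact: sqr_ge0.
Qed.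

Local Open Scope ereal_scope.

(** The hyperplane is a box with one side reduced to a point, so the product formula for its measure
    has a factor 0. *)
Let coord_null d (x : euclid R d) (i : 'I_d) :
  measurable [set y : euclid R d | tnth y i = tnth x i] /\
  lebesgueE d [set y : euclid R d | tnth y i = tnth x i] = 0.
Proof.
pose A (j : 'I_d) : set (measurableTypeR R) := if j == i then [set tnth x i] else setT.
have mA j : measurable (A j) by rewrite /A; case: ifP.
have E : [set y : euclid R d | tnth y i = tnth x i] =
    [set y : euclid R d | forall j, A j (tnth y j)].
  apply/seteqP; split => y /= H; last by have := H i; rewrite /A eqxx.
  by move=> j; rewrite /A; case: eqP => [->|].
split.
  rewrite (_ : [set y | _] = (@tnth d (measurableTypeR R) ^~ i) @^-1` [set tnth x i])//.
  by rewrite -[X in measurable X]setTI; apply: measurable_tnth.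
rewrite E lebesgueE_box// (bigD1 i)//= {1}/A eqxx.
by rewrite (_ : lebesgue_measure _ = 0) ?mul0e//; exact: lebesgue_measure_set1.
Qed.

(** Larger than the single point x: the kernel bounds are available only where no coordinate of x -
    y vanishes. *)
Let diagonal d (x : euclid R d) : set (euclid R d) :=
  \big[setU/set0]_(i < d) [set y : euclid R d | tnth y i = tnth x i].

Let measurable_diagonal d (x : euclid R d) : measurable (diagonal x).
Proof. by apply: bigsetU_measurable => i _; have [] := coord_null x i. Qed.

Let diagonal0 d (x : euclid R d) : lebesgueE d (diagonal x) = 0.
Proof.
apply/(negligibleP (lebesgueE d) (measurable_diagonal x)).
rewrite /diagonal; elim/big_ind : _ => [|A B nA nB|i _].
- exact: negligible_set0.
- exact: negligibleU.
- by have [mA A0] := coord_null x i; exact/(negligibleP (lebesgueE d) mA).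
Qed.

(* For fixed [x], the set of [y] sharing a coordinate with [x] is a null set. *)
Lemma iterated_integral_le d (F1 F2 : euclid R d * euclid R d -> \bar R) :
  measurable_fun setT F1 -> measurable_fun setT F2 ->
  (forall z, 0 <= F1 z) -> (forall z, 0 <= F2 z) ->
  (forall x y, (forall i, tnth x i != tnth y i) -> F1 (x, y) <= F2 (x, y)) ->
  \int[lebesgueE d]_x \int[lebesgueE d]_y F1 (x, y) <=
  \int[lebesgueE d]_x \int[lebesgueE d]_y F2 (x, y).
Proof.
move=> m1 m2 p1 p2 F12.
have sec (F : euclid R d * euclid R d -> \bar R) x : measurable_fun setT F ->
    measurable_fun setT (fun y => F (x, y)).
  by move=> mF; exact: (measurableT_comp mF (measurable_pair1 x)).
apply: ge0_le_integral => //.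
- by move=> x _; exact: integral_ge0.
- exact: measurable_integral_section.
- exact: measurable_integral_section.
move=> x _.
rewrite (ge0_negligible_integral (measurable_diagonal x) measurableT
  (sec F1 x m1) (fun y _ => p1 (x, y)) (diagonal0 x)).
rewrite (ge0_negligible_integral (measurable_diagonal x) measurableT
  (sec F2 x m2) (fun y _ => p2 (x, y)) (diagonal0 x)).
apply: ge0_le_integral => //.
- by apply: measurableD => //; exact: measurable_diagonal.
- by apply: measurable_funTS; exact: sec.
- by apply: measurable_funTS; exact: sec.
move=> y [_ /= ny]; apply: F12 => i; apply/negP => /eqP xy; apply: ny.
by rewrite /diagonal (bigD1 i)//=; left.
Qed.

Lemma HS_normE d (k : euclid R d * euclid R d -> \bar R) : measurable_fun setT k ->
  HS_norm k = sqrte (\int[lebesgueE d]_x \int[lebesgueE d]_y (`|k (x, y)| `^ 2)).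
Proof.
move=> mk; rewrite /HS_norm unlock poweR12_sqrt; last first.
  by apply: integral_ge0 => z _; exact: poweR_ge0.
congr sqrte.
apply: (@fubini_tonelli1 _ _ _ _ R (lebesgueE d) (lebesgueE d) (fun z => `|k z| `^ 2)).
  apply: (measurableT_comp (measurable_poweR 2)).
  exact: measurableT_comp.
by move=> z; exact: poweR_ge0.
Qed.

Lemma sqrte_le (A B : \bar R) (C : R) : (0 <= C)%R -> 0 <= B ->
  A <= (C ^+ 2)%:E * B -> sqrte A <= C%:E * sqrte B.
Proof.
move=> C0 B0 AB.
have C2 : 0 <= (C ^+ 2)%:E by rewrite lee_fin sqr_ge0.
have -> : C%:E = sqrte (C ^+ 2)%:E by rewrite /= sqrtr_sqr ger0_norm.
by rewrite -sqrteM// lee_sqrt// mule_ge0.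
Qed.

Let integral2Zl d (C : R) (F : euclid R d * euclid R d -> \bar R) : (0 <= C)%R ->
  measurable_fun setT F -> (forall z, 0 <= F z) ->
  \int[lebesgueE d]_x \int[lebesgueE d]_y (C%:E * F (x, y)) =
  C%:E * \int[lebesgueE d]_x \int[lebesgueE d]_y F (x, y).
Proof.
move=> C0 mF F0.
under eq_integral.
  move=> x _; rewrite ge0_integralZl_EFin//; last first.
    exact: (measurableT_comp mF (measurable_pair1 x)).
  over.
rewrite ge0_integralZl_EFin//.
- by move=> x _; exact: integral_ge0.
- exact: measurable_integral_section.
Qed.

Lemma sqrte_iterated_le d (C : R) (F1 F2 : euclid R d * euclid R d -> \bar R) :
  (0 <= C)%R -> measurable_fun setT F1 -> measurable_fun setT F2 ->
  (forall z, 0 <= F1 z) -> (forall z, 0 <= F2 z) ->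
  (forall x y, (forall i, tnth x i != tnth y i) -> F1 (x, y) <= (C ^+ 2)%:E * F2 (x, y)) ->
  sqrte (\int[lebesgueE d]_x \int[lebesgueE d]_y F1 (x, y)) <=
  C%:E * sqrte (\int[lebesgueE d]_x \int[lebesgueE d]_y F2 (x, y)).
Proof.
move=> C0 m1 m2 p1 p2 F12; have C2 : (0 <= C ^+ 2)%R by exact: sqr_ge0.
apply: sqrte_le => //; first by apply: integral_ge0 => x _; exact: integral_ge0.
rewrite -integral2Zl//.
apply: (@iterated_integral_le d F1 (fun z => (C ^+ 2)%:E * F2 z)) => //.
- exact: measurable_funeM.
- by move=> z; rewrite mule_ge0.
Qed.

Let BS_kernel_sqr d (alpha m l rho : R) (V : euclid R d -> R) x y :
  resolvent_kernel alpha m l (subE x y) = rho%:E ->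
  `|BS_kernel alpha m l V (x, y)| `^ 2 = (rho ^+ 2 * `|V x| * `|V y|)%:E.
Proof.
move=> E; rewrite /BS_kernel /= E -!EFinM /=; congr EFin.
rewrite powR_mulrn// real_normK ?num_real// !exprMn !sqr_sqrtr//; ring.
Qed.

(** Off the coordinate hyperplanes the resolvent kernel is a real number rho, and the squared
    Birman-Schwinger kernel is rho^2 |V(x)||V(y)|. *)
Lemma HS_norm_le_rollnik d (alpha m l m' C : R) (V : euclid R d -> R) :
  (0 <= C)%R -> measurable_fun setT V ->
  (forall x : euclid R d, (forall i, tnth x i != 0)%R ->
    exists2 rho : R, resolvent_kernel alpha m l x = rho%:E &
      (0 <= rho <= C * rollnik_H d alpha m' (normE x))%R) ->
  HS_norm (BS_kernel alpha m l V) <= C%:E * rollnik_norm alpha m' V.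
Proof.
move=> C0 mV H; rewrite HS_normE; last exact: measurable_BS_kernel.
apply: (@sqrte_iterated_le d C (fun z => `|BS_kernel alpha m l V z| `^ 2)
  (rollnik_integrand alpha m' V)) => //.
- apply: (measurableT_comp (measurable_poweR 2)); apply: measurableT_comp => //.
  exact: measurable_BS_kernel.
- exact: measurable_rollnik_integrand.
- by move=> z; exact: poweR_ge0.
- by move=> z; exact: rollnik_integrand_ge0.
move=> x y xy.
have xy0 i : (tnth (subE x y) i != 0)%R by rewrite tnth_mktuple subr_eq0.
have [rho E /andP[r0 rC]] := H _ xy0.
rewrite (BS_kernel_sqr V E) /rollnik_integrand -EFinM lee_fin.
set h := rollnik_H _ _ _ _ in rC *.
rewrite [leRHS](_ : _ = (C * h) ^+ 2 * `|V x| * `|V y|)%R; last by rewrite /=; ring.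
by rewrite ler_wpM2r// ler_wpM2r// lerXn2r// nnegrE// (le_trans r0 rC).
Qed.

Lemma rollnik_le_HS_norm d (alpha m l m' C : R) (V : euclid R d -> R) :
  (0 <= C)%R -> measurable_fun setT V ->
  (forall x : euclid R d, (forall i, tnth x i != 0)%R ->
    exists2 rho : R, resolvent_kernel alpha m l x = rho%:E &
      (0 <= rollnik_H d alpha m' (normE x) <= C * rho)%R) ->
  rollnik_norm alpha m' V <= C%:E * HS_norm (BS_kernel alpha m l V).
Proof.
move=> C0 mV H; rewrite HS_normE; last exact: measurable_BS_kernel.
apply: (@sqrte_iterated_le d C (rollnik_integrand alpha m' V)
  (fun z => `|BS_kernel alpha m l V z| `^ 2)) => //.
- exact: measurable_rollnik_integrand.
- apply: (measurableT_comp (measurable_poweR 2)); apply: measurableT_comp => //.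
  exact: measurable_BS_kernel.
- by move=> z; exact: rollnik_integrand_ge0.
- by move=> z; exact: poweR_ge0.
move=> x y xy.
have xy0 i : (tnth (subE x y) i != 0)%R by rewrite tnth_mktuple subr_eq0.
have [rho E /andP[r0 rC]] := H _ xy0.
rewrite (BS_kernel_sqr V E) /rollnik_integrand -EFinM lee_fin.
set h := rollnik_H _ _ _ _ in r0 rC *.
rewrite [leRHS](_ : _ = (C * rho) ^+ 2 * `|V x| * `|V y|)%R; last by ring.
by rewrite ler_wpM2r// ler_wpM2r// lerXn2r// nnegrE// (le_trans r0 rC).
Qed.

End birman_schwinger.

(** * Comparison of the norms and conclusion *)

Section comparison.
Context {R : realType}.

Lemma resolvent_rollnik d (alpha m l : R) : (0 < d)%N ->
  0 < alpha < 2 -> d%:R < 2 * alpha -> 0 <= m -> 0 < l ->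
  [/\ exists2 C : R, 0 < C & forall V : euclid R d -> R, measurable_fun setT V ->
        (HS_norm (BS_kernel alpha m l V) <= C%:E * rollnik_norm alpha 0 V)%E,
      exists2 C : R, 0 < C & forall V : euclid R d -> R, measurable_fun setT V ->
        (rollnik_norm alpha m V <= C%:E * HS_norm (BS_kernel alpha m l V))%E &
      m < l -> exists2 C : R, 0 < C & forall V : euclid R d -> R, measurable_fun setT V ->
        (HS_norm (BS_kernel alpha m l V) <= C%:E * rollnik_norm alpha m V)%E].
Proof.
move=> d0 a02 da m0 l0.
have [p0 [C1 C10 H1] [C2 C20 H2] H3] := resolvent_kernel_bounds d0 a02 da m0 l0.
have fin (x : euclid R d) : (forall i, tnth x i != 0) ->
    exists2 rho : R, resolvent_kernel alpha m l x = rho%:E & 0 <= rho.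
  move=> x0; have := H1 x x0; have := p0 x x0.
  by case: (resolvent_kernel alpha m l x) => [rho| |]//; exists rho.
have upper (m' C : R) : 0 < C -> (forall x : euclid R d, (forall i, tnth x i != 0) ->
      (resolvent_kernel alpha m l x <= (C * rollnik_H d alpha m' (normE x))%:E)%E) ->
    forall V : euclid R d -> R, measurable_fun setT V ->
      (HS_norm (BS_kernel alpha m l V) <= C%:E * rollnik_norm alpha m' V)%E.
  move=> C0 H V mV; apply: HS_norm_le_rollnik => //; first exact: ltW.
  move=> x x0; have [rho E r0] := fin x x0; exists rho => //.
  by rewrite r0 -lee_fin -E H.
split.
- by exists C1 => //; exact: upper.
- exists C2 => // V mV; apply: rollnik_le_HS_norm => //; first exact: ltW.
  move=> x x0; have [rho E r0] := fin x x0; exists rho => //.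
  have := H2 x x0; rewrite E -EFinM lee_fin => ->; rewrite andbT.
  have [q0 _] := (dotEE_gt0 d0 x0, tt).
  have N0 : 0 < normE x by rewrite sqrtr_gt0.
  have b01 : 0 < alpha / 2 < 1 by case/andP: a02 => *; apply/andP; split; lra.
  have [B B0 HB] := potential_rollnik_H d0 b01 m0.
  (* The nonnegativity of [rollnik_H] is read off the upper comparison: a positive multiple of it
     dominates a nonnegative integral. *)
  have [h _] := HB _ N0.
  rewrite -(pmulr_rge0 _ B0) -lee_fin {1}(_ : alpha = 2 * (alpha / 2)).
    by apply: le_trans h; apply: integral_ge0 => u _; rewrite lee_fin potentialf_ge0.
  by rewrite mulrC divfK.
- move=> ml; have [C C0 HC] := H3 ml.
  by exists C => //; exact: upper.
Qed.

Lemma rollnik_norm_ge0 d (alpha m : R) (V : euclid R d -> R) :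
  (0 <= rollnik_norm alpha m V)%E.
Proof. exact: sqrte_ge0. Qed.

Lemma lty_le_EFinM (a b : \bar R) (C : R) : (0 <= b)%E -> (a <= C%:E * b)%E ->
  (b < +oo)%E -> (a < +oo)%E.
Proof.
move=> b0 ab boo; apply: (le_lt_trans ab).
have bf : b \is a fin_num by rewrite ge0_fin_numE.
by rewrite -(fineK bf) -EFinM ltry.
Qed.

End comparison.

Theorem theorem4p4 (R : realType) (d : nat) (alpha m lambda : R)
    (halpha : 0 < alpha < 2) (hd : (1 <= d)%N) (hm : 0 <= m)
    (hlambda : 0 < lambda) (hdalpha : d%:R < 2 * alpha) :
  (exists C : R, 0 < C /\
    forall V : euclid R d -> R, measurable_fun setT V ->
      rollnik_class alpha 0 V ->
      is_HS (BS_kernel alpha m lambda V) /\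
      (HS_norm (BS_kernel alpha m lambda V) <=
         C%:E * rollnik_norm alpha 0 V)%E) /\
  (exists C : R, 0 < C /\
    forall V : euclid R d -> R, measurable_fun setT V ->
      is_HS (BS_kernel alpha m lambda V) ->
      rollnik_class alpha m V /\
      (rollnik_norm alpha m V <=
         C%:E * HS_norm (BS_kernel alpha m lambda V))%E) /\
  (m < lambda ->
    (forall V : euclid R d -> R, measurable_fun setT V ->
      is_HS (BS_kernel alpha m lambda V) <-> rollnik_class alpha m V) /\
    exists C : R, 1 < C /\
      forall V : euclid R d -> R, measurable_fun setT V ->
        ((C^-1)%:E * rollnik_norm alpha m V <=
           HS_norm (BS_kernel alpha m lambda V))%E /\
        (HS_norm (BS_kernel alpha m lambda V) <=
           C%:E * rollnik_norm alpha m V)%E).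
Proof.
have d0 : (0 < d)%N by [].
have [[C1 C10 H1] [C2 C20 H2] H3] := resolvent_rollnik d0 halpha hdalpha hm hlambda.
have mBS (V : euclid R d -> R) := @measurable_BS_kernel R d alpha m lambda V.
have HS0 (V : euclid R d -> R) : (0 <= HS_norm (BS_kernel alpha m lambda V))%E.
  exact: Lnorm_ge0.
split; [|split].
- exists C1; split => // V mV [_ Voo]; split; last exact: H1.
  split; first exact: mBS.
  exact: lty_le_EFinM (rollnik_norm_ge0 _ _ _) (H1 V mV) Voo.
- exists C2; split => // V mV [_ Koo]; split; last exact: H2.
  by split => //; exact: lty_le_EFinM (HS0 V) (H2 V mV) Koo.
move=> ml; have [C3 C30 {}H3] := H3 ml; split.
  move=> V mV; split => -[_ foo].
    by split => //; exact: lty_le_EFinM (HS0 V) (H2 V mV) foo.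
  split; first exact: mBS.
  exact: lty_le_EFinM (rollnik_norm_ge0 _ _ _) (H3 V mV) foo.
have C0 : 0 < 1 + C2 + C3 by rewrite !addr_gt0.
(* The summand 1 makes the constant exceed 1; [C2] and [C3] serve the two inequalities. *)
exists (1 + C2 + C3); split => [|V mV]; first by rewrite -addrA ltrDl addr_gt0.
split.
  rewrite lee_pdivrMl//; apply: (le_trans (H2 V mV)).
  by apply: lee_wpmul2r => //; rewrite lee_fin; lra.
apply: (le_trans (H3 V mV)).
by apply: lee_wpmul2r; [exact: rollnik_norm_ge0|rewrite lee_fin; lra].
Qed.
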